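(* There is an absolute constant $C>0$ such that the following holds. Let $\chi$ be a primitive Dirichlet character modulo $Q$, where $Q\ge 3$, and let $r$ be any positive number such that $\operatorname{ord}_p Q \leq 1$ for all primes $p \geq r$. Let $$ q' = q'_r := \prod_{p < r} p^{\operatorname{ord}_p Q}, $$ the product being over primes $p<r$. Then for all real $y > 3$, $$ \left| L(s_y, \chi) \right| \le C\left( \log q' + \frac{\log Q}{\log \log Q} + \sqrt{(\log Q)\big(\log \mathcal{P}(Q) + \log d(Q)\big)}\right), $$ where $s_y := 1 + \frac{1}{\log y}$.
   Context: $\operatorname{ord}_p Q$ is the exponent of the prime $p$ in the factorization of $Q$; $\mathcal{P}(Q)$ is the largest prime factor of $Q$; $d(Q)$ is the number of positive divisors of $Q$. $L(s,\chi)=\sum_{n\ge 1}\chi(n)n^{-s}$ is the Dirichlet $L$-function (for $\operatorname{Re}(s)>1$). *)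

(* Defs.v *)
(* MathComp-Analysis: the reals are an arbitrary [R : realType], the complex
   numbers are [R[i]] from mathcomp-real-closed. *)
From mathcomp Require Export all_boot all_order all_algebra.
From mathcomp Require Export complex.
From mathcomp Require Export all_classical all_reals all_analysis.

Export Order.TTheory GRing.Theory Num.Theory.
Export numFieldNormedType.Exports.
#[export] Set Implicit Arguments.
#[export] Unset Strict Implicit.
#[export] Unset Printing Implicit Defensive.

Local Open Scope classical_set_scope.
Local Open Scope complex_scope.
Local Open Scope ring_scope.

Definition dirichlet_character (R : realType) (Q : nat) (chi : nat -> R[i]) : Prop :=
  [/\ forall m n : nat, m = n %[mod Q] -> chi m = chi n,
      forall m n : nat, chi (m * n)%N = chi m * chi n,
      chi 1%N = 1
    & forall n : nat, (chi n != 0) = coprime n Q].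

(* [chi] is not induced by a character of smaller modulus; [0 < Q] is intended,
   so that the divisors [d] are positive. *)
Definition primitive_character (R : realType) (Q : nat) (chi : nat -> R[i]) : Prop :=
  dirichlet_character Q chi /\
  forall (d : nat) (psi : nat -> R[i]),
    (d %| Q)%N -> (d < Q)%N -> dirichlet_character d psi ->
    ~ (forall n : nat, coprime n Q -> chi n = psi n).

Definition cexp (R : realType) (z : R[i]) : R[i] :=
  let: x +i* t := z in (expR x)%:C * (cos t +i* sin t).

(* [n ^ (- s)] with the real logarithm of [n]; meaningful for [0 < n]. *)
Definition nat_cpowN (R : realType) (n : nat) (s : R[i]) : R[i] :=
  cexp (- s * (ln (n%:R : R))%:C).

(* The index is shifted, so the sum runs over [n >= 1]. [R[i]^o] carries the
   topology of the complex modulus. The limit is meaningful when the real part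
   of [s] is greater than 1; elsewhere it may be a junk value. *)
Definition dirichlet_L (R : realType) (s : R[i]) (chi : nat -> R[i]) : R[i] :=
  limn (series (fun n : nat => chi n.+1 * nat_cpowN n.+1 s : R[i]^o)).

(* The primes [p < r] all lie in the range [0 <= p <= floor r]. *)
Definition below_part (R : realType) (Q : nat) (r : R) : nat :=
  (\prod_(0 <= p < (Num.truncn r).+1 | prime p && (p%:R < r)%R) p ^ logn p Q)%N.

(* Main.v *)
(** The L-value is bounded by partial summation: |L(s, chi)| <= log X + O(1) as soon
    as the means of chi over [0, N) are O(1 / log Q) for all N >= X, and X = Q always
    works by periodicity. So it suffices to treat X = e^Y with Y = 1024 E, where E is
    the sum of the three terms in the statement, when Y <= log Q.

    The primes p | Q with p >= r divide Q exactly once. They are grouped greedily into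
    blocks of product in [Z, Z P(Q)) with Z about e^(Y/8), leaving q' times a small
    remainder. Besides the last one there are k - 1 <= log Q / log Z blocks, so
    2^k = O((log Q)^(1/64)). Van der Corput differencing by multiples of each of the
    other moduli in turn removes the corresponding character at the cost of squaring,
    and |mean of chi|^(2^k) is at most, up to 8^(2^k), a cube average of a primitive
    character modulo the last block. By the Chinese remainder theorem that average is
    a product over the primes p of the block, of factors at most 1 and at most
    O(2^k p^(-1/4)) by a Weil-type bound for complete sums of chi(f(x)).

    That bound comes from the L-function of the multiplicative function
    P |-> chi(prod_a P(a)) on monic polynomials over F_p. It is a polynomial, so its
    power sums over irreducibles are power sums of its inverse roots, and Stepanov's
    method, counting the irreducible P of degree n with a prescribed value of
    prod_a P(a), bounds these by O(n p^(3n/4)) when 4 divides n, forcing every inverse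
    root to have modulus at most p^(3/4). This exponent, weaker than Weil's 1/2, is
    all that is needed. *)

From HB Require Import structures.
From mathcomp Require Import cyclic.
From mathcomp Require Import qfpoly finfield.
From mathcomp Require Import zify ring lra.
Require Import Defs.

(** Each differencing step squares the mean, so the saving e^(-cY) on the cube average must survive
    a 2^k-th root and still beat 1 / log Q: 2^k log log Q has to stay below a small multiple of Y.
    Since k is about log Q / log Z with log Z comparable to Y, this is where Y >= 1024 log Q / log
    log Q is needed: 2^k is then a small power of log Q, while Y is almost log Q. Any fixed power
    saving at each prime is good enough for this, and the primes too small to show a saving are too
    few to matter.

    The other terms of E control the errors of differencing. A step costs about the product of two
    moduli over N >= e^Y, and log q', log P(Q) <= Y / 1024 keep such products near e^(Y/4).

    Primitivity is used prime by prime: the component of chi at every p >= r is nontrivial, so its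
    values sum to 0.

    Degrees divisible by 4 occur because Stepanov's parameters are built from p^(n/4), which is then
    an integer. A progression of degrees suffices: it bounds the fourth powers of the inverse
    roots. *)

Local Open Scope complex_scope.
Local Open Scope ring_scope.
Local Notation normc := ComplexField.Normc.normc.

(** * Characters of polynomials and their L-functions *)

Section MonicPolynomials.
Variable F : finFieldType.
Implicit Types (p g h P : {poly F}) (n e i : nat).

Definition monics n : seq {poly F} := [seq 'X^n + val q | q : {poly_n F}].

Lemma mem_monics n p : (p \in monics n) = (p \is monic) && (size p == n.+1).
Proof.
apply/fintype.imageP/andP => [[q _ ->]|[pm /eqP sp]].
  have sq : (size (val q) < size ('X^n : {poly F}))%N.
    by rewrite size_polyXn ltnS (size_npoly q).
  by rewrite monicE lead_coefDl // lead_coefXn eqxx size_polyDl // size_polyXn.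
have sr : (size (p - 'X^n)%R <= n)%N.
  apply/leq_sizeP => j; rewrite leq_eqVlt => /orP[/eqP <-|lt_nj].
    rewrite coefB coefXn eqxx.
    by have := monicP pm; rewrite lead_coefE sp /= => ->; rewrite subrr.
  by rewrite coefB coefXn gtn_eqF // subr0 nth_default // sp.
by exists (NPoly sr); rewrite //= addrC subrK.
Qed.

Lemma monics_uniq n : uniq (monics n).
Proof.
by rewrite map_inj_uniq ?enum_uniq // => p q /addrI /val_inj.
Qed.

Lemma size_monics n : size (monics n) = (#|F| ^ n)%N.
Proof. by rewrite size_map -cardE card_npoly. Qed.

Lemma monics_neq0 n p : p \in monics n -> p != 0.
Proof. by rewrite mem_monics => /andP[/monic_neq0]. Qed.

Lemma size_mem_monics n p : p \in monics n -> size p = n.+1.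
Proof. by rewrite mem_monics => /andP[_ /eqP]. Qed.

Lemma monics0 : monics 0 = [:: 1].
Proof.
apply: perm_small_eq => //; apply: uniq_perm => //; first exact: monics_uniq.
move=> p; rewrite mem_monics inE; apply/andP/eqP => [[pm sp]|->]; last first.
  by rewrite monic1 size_poly1.
have /size_poly1P [c _ pE] := sp.
by move: pm; rewrite pE monicE lead_coefC => /eqP ->.
Qed.

Lemma perm_mul_monics e n P : P \in monics e -> (e <= n)%N ->
  perm_eq [seq g <- monics n | P %| g] [seq P * h | h <- monics (n - e)].
Proof.
move=> Pe le_en; apply: uniq_perm.
- exact/filter_uniq/monics_uniq.
- rewrite map_inj_uniq ?monics_uniq //; apply: mulfI; exact: monics_neq0 Pe.
move=> g; rewrite mem_filter; apply/andP/mapP.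
  case=> /dvdpP [h ->] gn; exists h; last by rewrite mulrC.
  move: gn Pe; rewrite !mem_monics => /andP[gm sg] /andP[Pm sP].
  have hm : h \is monic by rewrite -(monicMr _ Pm).
  rewrite hm; move: sg; rewrite size_monicM ?monic_neq0 // (eqP sP).
  have h0 : (0 < size h)%N by rewrite size_poly_gt0 monic_neq0.
  by move/eqP => E; apply/eqP; lia.
case=> h hn ->; rewrite dvdp_mulr //; split => //.
move: hn Pe; rewrite !mem_monics => /andP[hm /eqP sh] /andP[Pm /eqP sP].
rewrite monicMl // hm /= size_monicM ?monic_neq0 // sh sP; apply/eqP; lia.
Qed.

Definition irrs e : seq {poly F} := [seq P <- monics e | irreducibleb P].

Lemma mem_irrs e P : (P \in irrs e) = irreducibleb P && (P \in monics e).
Proof. by rewrite mem_filter. Qed.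

Lemma irrs_uniq e : uniq (irrs e).
Proof. exact/filter_uniq/monics_uniq. Qed.

Lemma irrs_gt0 e P : P \in irrs e -> (0 < e)%N.
Proof.
rewrite mem_irrs => /andP[/irreducibleP [sP _] /size_mem_monics].
by move: sP => /[swap] ->.
Qed.

Lemma irrs_monics e P : P \in irrs e -> P \in monics e.
Proof. by rewrite mem_irrs => /andP[]. Qed.

Lemma exists_irr_dvd n g : (0 < n)%N -> g \in monics n ->
  exists e P, [/\ P \in irrs e, P %| g & (e <= n)%N].
Proof.
elim/ltn_ind: n g => n IHn g n0 gn.
have [irr|] := boolP (irreducibleb g).
  by exists n, g; rewrite mem_irrs irr gn dvdpp.
rewrite /irreducibleb (size_mem_monics gn) ltnS n0 /= => nirr.
have [q [dq sq sqn]] : exists q : {poly F}, [/\ q %| g, (1 < size q)%N &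
    (size q <= n)%N].
  move: nirr => /forallPn [q].
  rewrite negb_imply -ltnNge -Pdiv.Idomain.dvdpE => /andP[dq sq].
  exists (val q); split=> //; exact: size_npoly.
have q0 : q != 0 by rewrite -size_poly_gt0; lia.
pose q' := (lead_coef q)^-1 *: q.
have lq : (lead_coef q)^-1 != 0 by rewrite invr_eq0 lead_coef_eq0.
have q'm : q' \is monic by rewrite monicE lead_coefZ mulVf // lead_coef_eq0.
have sq' : size q' = (size q).-1.+1 by rewrite size_scale // prednK //; lia.
have [|||e [P [Pe Pq le]]] := IHn (size q).-1 _ q'; try lia.
  by rewrite mem_monics q'm sq' /=.
exists e, P; split=> //.
  by rewrite (dvdp_trans Pq) // dvdpZl.
by lia.
Qed.

Lemma irr_coprime e e' P P' : P \in irrs e -> P' \in irrs e' -> P != P' ->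
  coprimep P P'.
Proof.
rewrite !mem_irrs => /andP[/irreducibleP iP Pm] /andP[/irreducibleP iP' Pm'].
apply: contraR; rewrite irreducible_poly_coprime // negbK => PP'.
have sP : size P != 1%N by case: iP; case: (size P) => [|[]].
have := iP'.2 _ sP PP'; rewrite eqp_monic ?(eqP _) //.
- by move: Pm; rewrite mem_monics => /andP[].
- by move: Pm'; rewrite mem_monics => /andP[].
Qed.

Lemma monics_exp e P i : P \in monics e -> P ^+ i \in monics (i * e).
Proof.
rewrite !mem_monics => /andP[Pm /eqP sP]; rewrite monic_exp //=.
have := size_exp P i; rewrite sP /= mulnC => <-; rewrite prednK // size_poly_gt0.
by rewrite monic_neq0 // monic_exp.
Qed.

(** Unique factorization, the valuation of g at P being encoded as the number of i in [1, N] with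
    P^i | g. Splitting off one irreducible factor [P0] raises only the count at [P0]. [N] is kept
    apart from [n] so that the ranges do not move during the induction. *)
Lemma deg_sum_irr N n g : g \in monics n -> (n <= N)%N ->
  n = (\sum_(1 <= e < N.+1) \sum_(P <- irrs e)
         \sum_(1 <= i < N.+1) (P ^+ i %| g)%R * e)%N.
Proof.
elim/ltn_ind: n g => n IHn g gn leN.
have [n0|n0] := posnP n.
  rewrite n0 monics0 inE in gn *; rewrite (eqP gn).
  rewrite big1_seq // => e /andP[_]; rewrite mem_index_iota => e1.
  rewrite big1_seq // => P /andP[_ Pe].
  rewrite big1_seq // => i /andP[_]; rewrite mem_index_iota => i1.
  rewrite dvdp1 (size_mem_monics (monics_exp i (irrs_monics Pe))).
  by have := irrs_gt0 Pe; case: eqP => //; nia.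
have [e0 [P0 [P0e P0g le0]]] := exists_irr_dvd n0 gn.
have e00 := irrs_gt0 P0e.
have : g \in [seq g <- monics n | P0 %| g] by rewrite mem_filter P0g.
rewrite (perm_mem (perm_mul_monics (irrs_monics P0e) le0)) => /mapP[h hn gE].
have P00 := monics_neq0 (irrs_monics P0e).
have IH := IHn (n - e0)%N _ h hn; rewrite {1}(_ : n = e0 + (n - e0))%N; last lia.
rewrite {}IH //; try lia.
have cntE e P : P \in irrs e -> (\sum_(1 <= i < N.+1) (P ^+ i %| g)%R =
    (P == P0) + \sum_(1 <= i < N.+1) (P ^+ i %| h)%R)%N.
  move=> Pe; have [->|neP] := eqVneq P P0; last first.
    rewrite add0n; apply: eq_bigr => i _; rewrite gE Gauss_dvdpr //.
    by rewrite coprimep_expl // (irr_coprime Pe P0e).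
  rewrite big_ltn; last lia.
  rewrite [X in _ = (_ + X)%N]big_nat_recr //=; last lia.
  have -> : (P0 ^+ N %| h) = false.
    apply/negP => /dvdp_leq.
    rewrite (size_mem_monics (monics_exp N (irrs_monics P0e))).
    rewrite (size_mem_monics hn) (monics_neq0 hn) => /(_ isT); nia.
  rewrite addn0 expr1 P0g; congr (_ + _)%N; rewrite big_add1 /=.
  by apply: eq_bigr => i _; rewrite gE exprS dvdp_mul2l.
transitivity (\sum_(1 <= e < N.+1) \sum_(P <- irrs e)
    ((P == P0) * e + (\sum_(1 <= i < N.+1) (P ^+ i %| h)%R * e)))%N; last first.
  apply: eq_bigr => e _; apply: eq_big_seq => P Pe.
  by rewrite -!big_distrl /= (cntE e) // mulnDl.
under [RHS]eq_bigr do rewrite big_split.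
rewrite big_split /=; congr (_ + _)%N.
have e0N : e0 \in index_iota 1 N.+1 by rewrite mem_index_iota; lia.
rewrite (bigD1_seq e0 e0N) ?iota_uniq //= (bigD1_seq P0 P0e) ?irrs_uniq //=.
rewrite eqxx mul1n big1_seq ?big1_seq ?addn0 // => [e|P] /andP[ne].
  move=> _; apply: big1_seq => P /andP[_ Pe]; case: eqVneq => // PE.
  move: Pe ne; rewrite PE => /irrs_monics /size_mem_monics.
  by rewrite (size_mem_monics (irrs_monics P0e)) => -[->]; rewrite eqxx.
by rewrite (negPf ne).
Qed.

End MonicPolynomials.

Section LFunction.
Variables (F : finFieldType) (C : numFieldType) (lam : {poly F} -> C).
Hypothesis lamM : {morph lam : p q / p * q}.
Hypothesis lam1 : lam 1 = 1.

Definition lcoef n : C := \sum_(g <- monics F n) lam g.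

(* With [lcoef] the coefficients of L(T) = sum of lam g T^(deg g) over monic g, this
   is the n-th coefficient of T L'(T) / L(T), from the Euler product. *)
Definition lpsum n : C :=
  \sum_(1 <= e < n.+1) \sum_(P <- irrs F e)
    \sum_(1 <= i < n.+1 | (i * e)%N == n) e%:R * lam P ^+ i.

Lemma lamX P i : lam (P ^+ i) = lam P ^+ i.
Proof. by elim: i => [|i IH]; rewrite ?expr0 ?exprS ?lamM // IH. Qed.

Lemma lcoef0 : lcoef 0 = 1.
Proof. by rewrite /lcoef monics0 big_seq1. Qed.

Lemma lpsum_wide N n : (0 < n <= N)%N -> lpsum n =
  \sum_(1 <= e < N.+1) \sum_(P <- irrs F e)
    \sum_(1 <= i < N.+1 | (i * e)%N == n) e%:R * lam P ^+ i.
Proof.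
case/andP=> n0 nN; rewrite [RHS](big_cat_nat _ (n := n.+1)) //=.
rewrite [X in _ + X]big1_seq ?addr0 => [|e /andP[_]]; last first.
  rewrite mem_index_iota => /andP[e1 e2].
  rewrite big1 // => P _; rewrite big1_seq // => i /andP[/eqP ie].
  by rewrite mem_index_iota; nia.
apply: eq_big_nat => e /andP[e1 e2]; apply: eq_bigr => P _.
rewrite [RHS](big_cat_nat _ (n := n.+1)) //=.
rewrite [X in _ + X]big1_seq ?addr0 // => i /andP[/eqP ie].
by rewrite mem_index_iota; nia.
Qed.

(** This is T L' = L (T L' / L), coefficient by coefficient. The factor n = deg g is expanded over
    the prime powers P^i dividing g, and g = P^i h turns each inner sum into lam(P)^i times a
    coefficient of L. *)
Lemma lcoef_newton n :
  n%:R * lcoef n = \sum_(1 <= j < n.+1) lpsum j * lcoef (n - j).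
Proof.
transitivity (\sum_(1 <= e < n.+1) \sum_(P <- irrs F e) \sum_(1 <= i < n.+1)
   \sum_(g <- monics F n | P ^+ i %| g) e%:R * lam g).
  rewrite /lcoef mulr_sumr.
  transitivity (\sum_(g <- monics F n) \sum_(1 <= e < n.+1)
     \sum_(P <- irrs F e) \sum_(1 <= i < n.+1)
       (if P ^+ i %| g then e%:R * lam g else 0)).
    apply: eq_big_seq => g gn; rewrite {1}(deg_sum_irr gn (leqnn n)).
    rewrite natr_sum mulr_suml; apply: eq_bigr => e _.
    rewrite natr_sum mulr_suml; apply: eq_bigr => P _.
    rewrite natr_sum mulr_suml; apply: eq_bigr => i _.
    by case: ifP; rewrite ?mul1n ?mul0n ?mul0r.
  rewrite exchange_big; apply: eq_bigr => e _.
  rewrite exchange_big; apply: eq_bigr => P _.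
  by rewrite exchange_big; apply: eq_bigr => i _; rewrite -big_mkcond.
transitivity (\sum_(1 <= e < n.+1) \sum_(P <- irrs F e) \sum_(1 <= i < n.+1)
   \sum_(1 <= j < n.+1) (if (i * e)%N == j then
      e%:R * lam P ^+ i * lcoef (n - j) else 0)).
  apply: eq_big_nat => e /andP[e1 e2]; apply: eq_big_seq => P Pe.
  apply: eq_big_nat => i /andP[i1 i2].
  have Pi := monics_exp i (irrs_monics Pe).
  have [le_n|gt_n] := leqP (i * e)%N n.
    rewrite (bigD1_seq (i * e)%N) ?iota_uniq ?mem_index_iota //=; last first.
      by rewrite ltnS le_n andbT; nia.
    rewrite eqxx [X in _ + X]big1 ?addr0 => [|j /negPf]; last first.
      by rewrite eq_sym => ->.
    rewrite -big_filter (perm_big _ (perm_mul_monics Pi le_n)) big_map.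
    by rewrite mulr_sumr; apply: eq_bigr => h _; rewrite lamM lamX mulrA.
  rewrite [RHS]big1_seq => [|j /andP[_]]; last first.
    by rewrite mem_index_iota => j12; rewrite gtn_eqF //; lia.
  rewrite big_seq_cond big1 // => g /andP[gn /dvdp_leq].
  rewrite (monics_neq0 gn) (size_mem_monics gn) (size_mem_monics Pi).
  by move=> /(_ isT); lia.
transitivity (\sum_(1 <= j < n.+1) \sum_(1 <= e < n.+1) \sum_(P <- irrs F e)
  \sum_(1 <= i < n.+1) (if (i * e)%N == j then
      e%:R * lam P ^+ i * lcoef (n - j) else 0)).
  rewrite [RHS]exchange_big; apply: eq_bigr => e _.
  rewrite [RHS]exchange_big; apply: eq_bigr => P _.
  by rewrite [RHS]exchange_big.
apply: eq_big_nat => j /andP[j1 j2]; rewrite (@lpsum_wide n) ?j1 //.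
rewrite mulr_suml; apply: eq_bigr => e _.
rewrite mulr_suml; apply: eq_bigr => P _.
rewrite mulr_suml -big_mkcond.
by [].
Qed.

End LFunction.

(** * Counting irreducible polynomials *)

Section PrimePolynomialTheorem.
Variables (F : finFieldType) (C : numFieldType).

(** Here L = 1 / (1 - b T) has coefficients b^n, and the Newton recursion then forces every power
    sum to be b^n. This is Gauss's count of irreducible polynomials. *)
Lemma lpsum_triv n : (0 < n)%N -> lpsum (fun _ : {poly F} => 1 : C) n = (#|F| ^ n)%:R.
Proof.
elim/ltn_ind: n => -[//|n] IHn _.
have lcE m : lcoef (fun _ : {poly F} => 1 : C) m = (#|F| ^ m)%:R.
  by rewrite /lcoef big_const_seq count_predT size_monics iter_addr_0.
have := @lcoef_newton F C (fun=> 1) (fun _ _ => esym (mul1r 1)) erefl n.+1.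
rewrite big_nat_recr //= subnn lcoef0 // mulr1 lcE.
rewrite (eq_big_nat _ _ (F2 := fun=> (#|F| ^ n.+1)%:R)); last first.
  move=> j /andP[j1 j2]; rewrite IHn // lcE -natrM -expnD subnKC //; lia.
rewrite big_const_nat iter_addr_0 subn1 /= => E.
by apply: (addrI ((#|F| ^ n.+1)%:R *+ n)); rewrite -E mulr_natl mulrSr.
Qed.

Lemma lpsum_recr (lam : {poly F} -> C) n : (0 < n)%N ->
  lpsum lam n = \sum_(1 <= e < n) \sum_(P <- irrs F e)
    \sum_(1 <= i < n.+1 | (i * e)%N == n) e%:R * lam P ^+ i
   + n%:R * \sum_(P <- irrs F n) lam P.
Proof.
move=> n0; rewrite /lpsum big_nat_recr //=; congr (_ + _).
rewrite mulr_sumr; apply: eq_bigr => P _.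
rewrite big_ltn_cond ?ltnS // mul1n eqxx big1_seq ?addr0 ?expr1 // => i.
by rewrite mem_index_iota; nia.
Qed.

End PrimePolynomialTheorem.

Section PrimePolynomialBounds.
Variables (F : finFieldType) (C : numFieldType).
Local Notation b := #|F|.

Lemma card_irrs_le n : (n * size (irrs F n) <= b ^ n)%N.
Proof.
have [->//|n0] := posnP n.
rewrite -(ler_nat rat) -(lpsum_triv F rat n0) lpsum_recr // natrM.
have -> : \sum_(P <- irrs F n) (1 : rat) = (size (irrs F n))%:R.
  by rewrite big_const_seq count_predT iter_addr_0.
rewrite lerDr sumr_ge0 // => e _; rewrite sumr_ge0 // => P _.
by rewrite sumr_ge0 // => i _; rewrite mulr_ge0 ?exprn_ge0.
Qed.

(** Degrees e < n contribute only when e divides n, hence e <= n / 2, and all irreducibles of such a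
    degree together contribute at most e times their number, which is at most b^e. *)
Lemma lpsum_irrs (lam : {poly F} -> C) n : (0 < n)%N ->
  (forall P, `|lam P| <= 1) ->
  `|lpsum lam n - n%:R * \sum_(P <- irrs F n) lam P| <= (n * b ^ n./2)%:R.
Proof.
move=> n0 lam1; rewrite lpsum_recr // addrK.
have b1 : (1 < b)%N by exact: finNzRing_gt1.
apply: (@le_trans _ _ (\sum_(1 <= e < n) (b ^ n./2)%:R)); last first.
  rewrite big_const_nat iter_addr_0 natrM mulr_natl ler_wpMn2l ?ler0n ?leq_subr //.
apply: le_trans (ler_norm_sum _ _ _) _.
rewrite !big_nat; apply: ler_sum => e /andP[e1 e2].
have [le_e|gt_e] := leqP e n./2; last first.
  rewrite big1 ?normr0 // => P _; rewrite big1_seq // => i /andP[/eqP ie].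
  rewrite mem_index_iota => i12; exfalso.
  have i2 : (1 < i)%N by nia.
  have : (2 * e <= n)%N by rewrite -ie leq_mul2r i2 orbT.
  by move: gt_e; lia.
apply: (@le_trans _ _ (e * size (irrs F e))%:R); last first.
  by rewrite ler_nat (leq_trans (card_irrs_le e)) // leq_pexp2l //; lia.
apply: le_trans (ler_norm_sum _ _ _) _.
have -> : (e * size (irrs F e))%:R = \sum_(P <- irrs F e) (e%:R : C).
  by rewrite big_const_seq count_predT iter_addr_0 natrM mulr_natr.
apply: ler_sum => P _; case: (boolP (e %| n)%N) => [/dvdnP[i ie]|ndv].
  rewrite big_mkcond (bigD1_seq i) ?iota_uniq ?mem_index_iota //=; last by nia.
  rewrite big1 => [|j ne]; last by case: eqP => // je; exfalso; nia.
  rewrite ie eqxx addr0 normrM normr_nat ler_piMr // normrX.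
  by rewrite exprn_ile1.
rewrite big1 ?normr0 // => i /eqP ie; case/negP: ndv; apply/dvdnP.
by exists i.
Qed.

End PrimePolynomialBounds.

(** Stepanov's method bounds the number of irreducibles with a given value from above only; a lower
    bound for their total number makes these bounds two-sided on average. *)
Lemma card_irrs_ge (F : finFieldType) n : (0 < n)%N ->
  (#|F| ^ n <= n * size (irrs F n) + n * #|F| ^ n./2)%N.
Proof.
move=> n0; rewrite -(ler_nat rat) natrD natrM -(lpsum_triv F rat n0) -lerBlDl.
have -> : (size (irrs F n))%:R = \sum_(P <- irrs F n) (1 : rat).
  by rewrite big_const_seq count_predT iter_addr_0.
have H : `|lpsum (fun _ : {poly F} => 1 : rat) n
           - n%:R * \sum_(P <- irrs F n) (1 : rat)| <= (n * #|F| ^ n./2)%:R.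
  by apply: lpsum_irrs => // P; rewrite normr1.
rewrite lpsum_triv // in H *.
apply: le_trans H; apply: real_ler_norm; rewrite rpredB ?realn //.
rewrite rpredM ?realn // rpred_sum // => P _; exact: real1.
Qed.

(** * Stepanov's method *)

Section HasseDerivative.
Variable R : comNzRingType.
Implicit Types p q r f : {poly R}.

Lemma nderivn_mulXr n p :
  (p * 'X)^`N(n) = p^`N(n) * 'X + (if n is m.+1 then p^`N(m) else 0).
Proof.
case: n => [|n]; first by rewrite !nderivn0 addr0.
by have := nderivnMXaddC n p 0; rewrite addr0 => ->; rewrite addrC.
Qed.

(** Hasse derivatives are used because iterated ordinary derivatives lose information from the order
    of the characteristic on. Their Leibniz rule has no binomial coefficients. *)
Lemma nderivnM n p q :
  (p * q)^`N(n) = \sum_(i < n.+1) p^`N(i) * q^`N(n - i).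
Proof.
elim/poly_ind: p n q => [|p c IH] n q.
  by rewrite mul0r linear0 big1 // => i _; rewrite linear0 mul0r.
rewrite mulrDl nderivnD -mulrA ['X * q]mulrC IH.
rewrite mul_polyC nderivnZ.
transitivity (\sum_(i < n.+1) (p * 'X)^`N(i) * q^`N(n - i)
  + \sum_(i < n.+1) (c%:P)^`N(i) * q^`N(n - i)); last first.
  by rewrite -big_split /=; apply: eq_bigr => i _; rewrite nderivnD mulrDl.
congr (_ + _); last first.
  rewrite big_ord_recl big1 ?addr0 => [|i _]; last by rewrite nderivnC /= mul0r.
  by rewrite nderivnC /= subn0 mul_polyC.
under eq_bigr do rewrite nderivn_mulXr mulrDr.
under [RHS]eq_bigr do rewrite nderivn_mulXr mulrDl.
rewrite !big_split /=; congr (_ + _).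
  by apply: eq_bigr => i _; ring.
rewrite big_ord_recr [RHS]big_ord_recl /= subnn mulr0 mul0r addr0 add0r.
apply: eq_bigr => i _.
by rewrite (_ : n - i = (n - i.+1).+1)%N //; have := ltn_ord i; lia.
Qed.

End HasseDerivative.

Section HasseDerivativeField.
Variable F : fieldType.
Implicit Types f r : {poly F}.

Lemma dvdp_bigsum (I : Type) (r : seq I) (Q : pred I) (G : I -> {poly F}) d :
  (forall i, Q i -> d %| G i) -> d %| \sum_(i <- r | Q i) G i.
Proof.
by move=> dG; elim/big_ind: _ => [|p q|i]; [rewrite dvdp0 | exact: dvdp_add | exact: dG].
Qed.

(** Differentiation to order k costs at most k factors f, whatever the cofactor. In the auxiliary
    polynomial this keeps the high powers of f out of the linear system. *)
Lemma dvd_nderivn_exp f r N k : f ^+ (N - k) %| (f ^+ N * r)^`N(k).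
Proof.
elim: N k => [|N IH] k; first by rewrite sub0n dvd1p.
rewrite exprS -mulrA nderivnM; apply: dvdp_bigsum => -[[|i] /= i_le] _.
  rewrite nderivn0 subn0; have [le_kN|lt_Nk] := leqP k N.
    by rewrite subSn // exprS dvdp_mul.
  by rewrite (_ : N.+1 - k = 0)%N ?dvd1p //; lia.
by apply: dvdp_mull; apply: (dvdp_trans _ (IH _)); apply: dvdp_exp2l; lia.
Qed.

Lemma lin_kernel (aT rT : vectType F) (u : {linear aT -> rT}) :
  (dim rT < dim aT)%N -> exists2 z, z != 0 & u z = 0.
Proof.
move=> lt_dim; have := limg_ker_dim (linfun u) fullv.
have := dimvS (subvf (limg (linfun u))).
rewrite capfv !dimvf => le1 eq1.
have ker0 : lker (linfun u) != 0%VS by rewrite -dimv_eq0; lia.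
exists (vpick (lker (linfun u))); first by rewrite vpick0.
by have := memv_pick (lker (linfun u)); rewrite memv_ker lfunE /= => /eqP.
Qed.

End HasseDerivativeField.

Section Frobenius.
Variables (F : finFieldType).
Local Notation b := #|F|.
Implicit Types (P g : {poly F}).

Lemma pchar_nat_card s : [pchar F].-nat (b ^ s)%N.
Proof.
have [p _ pF] := finPcharP F.
rewrite (eq_pnat _ (pcharf_eq pF)) pnatX; apply/orP; left.
by have := pprimeChar_pgroup pF; rewrite /pgroup.pgroup cardsT.
Qed.

Lemma expf_card_exp (x : F) s : x ^+ (b ^ s) = x.
Proof. by elim: s => [|s IH]; rewrite ?expr1 // expnSr exprM IH expf_card. Qed.

Lemma comp_polyXq P s : P \Po 'X^(b ^ s) = P ^+ (b ^ s).
Proof.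
have pn : [pchar {poly F}].-nat (b ^ s)%N.
  by rewrite (eq_pnat _ (pchar_poly F)) pchar_nat_card.
elim/poly_ind: P => [|p c IH].
  by rewrite comp_poly0 expr0n expn_eq0 -leqn0 leqNgt ltnW ?finNzRing_gt1.
rewrite comp_polyD comp_polyM comp_polyX comp_polyC IH exprDn_pchar // exprMn.
by rewrite -polyC_exp expf_card_exp.
Qed.

Lemma quotient_field n P : P \in irrs F n ->
  exists (K : finFieldType) (pi : {rmorphism {poly F} -> K}),
    [/\ #|K| = (b ^ n)%N, forall g, (pi g == 0) = (P %| g)
      & forall y, exists g, pi g = y].
Proof.
rewrite mem_irrs mem_monics => /andP[/irreducibleP Pirr /andP[Pm /eqP sP]].
have hI : monic_irreducible_poly P by [].
exists {poly %/ P with hI}, (in_qpoly P : {rmorphism {poly F} -> {poly %/ P}}).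
split; first by rewrite card_qfpoly sP.
  move=> g; rewrite -val_eqE /= mk_monicE //.
  by rewrite -Pdiv.IdomainMonic.modpE // dvdp_eq0.
move=> y; exists (val y); apply: val_inj; rewrite /= Pdiv.CommonRing.rmodp_small //.
exact: (size_mk_monic y).
Qed.

End Frobenius.

Section IrreducibleOverFinite.
Variables (F : finFieldType) (n : nat) (P : {poly F}).
Hypothesis Pn : P \in irrs F n.
Local Notation b := #|F|.

Lemma irr_dvd_Xq_sub_X : P %| 'X^(b ^ n) - 'X.
Proof.
have [K [pi [cK kpi _]]] := quotient_field Pn.
by rewrite -kpi rmorphB rmorphXn /= -cK expf_card subrr.
Qed.

(** Modulo P, X becomes a root x whose conjugates are the x^(b^i), i < n. Hence P.[a] is the product
    of the a - x^(b^i), and each of these is (a - x)^(b^i) by Frobenius. *)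
Lemma irr_dvd_norm (a : F) :
  P %| (a%:P - 'X) ^+ (\sum_(i < n) b ^ i) - P.[a]%:P.
Proof.
have [K [pi [cK kpi sur]]] := quotient_field Pn.
have n0 := irrs_gt0 Pn; have b1 : (1 < b)%N := finNzRing_gt1 F.
pose io : {rmorphism F -> K} := pi \o polyC.
pose x := pi 'X.
have piE g s : (map_poly io g).[x ^+ (b ^ s)] = pi g ^+ (b ^ s).
  rewrite -rmorphXn -comp_polyXq /x -rmorphXn.
  elim/poly_ind: g => [|g c IH]; first by rewrite comp_poly0 !rmorph0 horner0.
  rewrite comp_polyD comp_polyM comp_polyX comp_polyC !rmorphD !rmorphM /= -IH.
  by rewrite map_polyX map_polyC !hornerE.
have x_root i : root (map_poly io P) (x ^+ (b ^ i)).
  rewrite rootE piE (_ : pi P = 0) ?expr0n ?expn_eq0; last first.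
    by apply/eqP; rewrite kpi dvdpp.
  by rewrite (gtn_eqF (ltnW b1)).
(* The conjugates are distinct: if x were fixed by a smaller power of Frobenius, so would be all b^n
   elements of K, too many roots for X^(b^e) - X. *)
have x_inj e : (0 < e < n)%N -> x ^+ (b ^ e) != x.
  case/andP=> e0 en; apply/eqP => xe.
  have all_fix (y : K) : y ^+ (b ^ e) = y.
    have [g <-] := sur y.
    by rewrite -piE xe -[in RHS](expr1 (pi g)) -(expn0 b) -piE expn0 expr1.
  pose h : {poly K} := 'X^(b ^ e) - 'X.
  have be1 : (1 < b ^ e)%N by rewrite -(expn0 b) ltn_exp2l.
  have sh : size h = (b ^ e).+1.
    by rewrite size_polyDl ?size_polyXn // size_polyN size_polyX.
  have h0 : h != 0 by rewrite -size_poly_gt0 sh.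
  have allr : all (root h) (enum K).
    by apply/allP => y _; rewrite rootE !hornerE all_fix subrr.
  have := max_poly_roots h0 allr (enum_uniq _).
  by rewrite -cardE cK sh ltnS leq_exp2l // leqNgt en.
have Pm : P \is monic by have := irrs_monics Pn; rewrite mem_monics => /andP[].
pose rs := [seq x ^+ (b ^ i) | i <- iota 0 n].
have x_n : x ^+ (b ^ n) = x by rewrite -cK expf_card.
have lt_ne i j : (i < j < n)%N -> x ^+ (b ^ i) != x ^+ (b ^ j).
  case/andP=> ij jn; apply: contraNneq (x_inj (n - j + i)%N _) => [E|]; last lia.
  rewrite addnC expnD exprM E -exprM -expnD subnKC ?x_n //; lia.
have rs_uniq : uniq rs.
  rewrite map_inj_in_uniq ?iota_uniq // => i j; rewrite !mem_iota !add0n /=.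
  move=> i_n j_n E; apply/eqP; rewrite eqn_leq; apply/andP; split; rewrite leqNgt.
    by apply/negP => ji; have := lt_ne j i; rewrite E eqxx => /(_ _); lia.
  by apply/negP => ij; have := lt_ne i j; rewrite E eqxx => /(_ _); lia.
have PE : map_poly io P = \prod_(z <- rs) ('X - z%:P).
  rewrite [LHS](@all_roots_prod_XsubC _ _ rs).
  - by rewrite (monicP _) ?scale1r // map_monic.
  - rewrite size_map_poly size_map size_iota; apply: size_mem_monics.
    exact: irrs_monics.
  - by apply/allP => _ /mapP[i _ ->].
  - by rewrite uniq_rootsE.
have ioP : io P.[a] = (io a - x) ^+ (\sum_(i < n) b ^ i).
  rewrite -horner_map PE horner_prod big_map -prodrXr.
  rewrite -{1}[n]subn0 -/(index_iota 0 n) big_mkord.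
  apply: eq_bigr => i _; rewrite !hornerE.
  rewrite -[io a - x]/(pi a%:P - pi 'X) -rmorphB -[RHS]rmorphXn -comp_polyXq.
  by rewrite comp_polyB comp_polyC comp_polyX rmorphB /= rmorphXn.
rewrite -kpi rmorphB rmorphXn rmorphB subr_eq0; apply/eqP.
by rewrite -ioP.
Qed.

Lemma irr_dvd_norm_prod (s : seq F) :
  P %| (\prod_(a <- s) (a%:P - 'X)) ^+ (\sum_(i < n) b ^ i)
       - (\prod_(a <- s) P.[a])%:P.
Proof.
elim: s => [|a s IH]; first by rewrite !big_nil expr1n subrr dvdp0.
rewrite !big_cons exprMn polyCM.
set A := _ ^+ _; set B := _ ^+ _; set c := P.[a]%:P; set d := _%:P.
have -> : A * B - c * d = A * (B - d) + (A - c) * d by ring.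
apply: dvdp_add; first exact: dvdp_mull.
by apply: dvdp_mulr; exact: irr_dvd_norm.
Qed.

End IrreducibleOverFinite.

Section TaylorAtFrobenius.
Variables (F : finFieldType).
Local Notation b := #|F|.

(** Each [A k] is expanded around X^q, in powers of X - X^q, which P divides. For l >= L the power
    alone supplies P^L. For l < L the coefficient is a polynomial divisible by P evaluated at X^q,
    and P(X^q) = P^q with q >= L. *)
Lemma irr_exp_dvd_taylor n (P : {poly F}) L J (e : 'I_J -> nat)
    (A : 'I_J -> {poly F}) :
  P \in irrs F n -> (L <= b ^ n)%N ->
  (forall l, (l < L)%N -> P %| \sum_k 'X^(e k) * (A k)^`N(l)) ->
  P ^+ L %| \sum_k 'X^(b ^ n * e k) * A k.
Proof.
move=> Pn Lq dB; pose W := (\sum_k size (A k))%N.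
pose nu : {poly F} := 'X - 'X^(b ^ n).
have dnu : P %| nu by rewrite /nu -opprB dvdpNr irr_dvd_Xq_sub_X.
have AE k : A k = \sum_(l < W) ((A k)^`N(l) \Po 'X^(b ^ n)) * nu ^+ l.
  rewrite -[LHS]comp_polyXr /comp_poly -[X in _.[X]](subrK 'X^(b ^ n)) addrC.
  rewrite (@nderiv_taylor_wide _ W) //; last 2 first.
  - exact: mulrC.
  - apply: leq_trans (size_poly _ _) _.
    by rewrite /W (bigD1 k) //= leq_addr.
  by apply: eq_bigr => l _; rewrite nderivn_map.
under eq_bigr => k _ do rewrite [A k]AE mulr_sumr.
rewrite exchange_big; apply: dvdp_bigsum => l _ /=.
have -> : \sum_k 'X^(b ^ n * e k) * (((A k)^`N(l) \Po 'X^(b ^ n)) * nu ^+ l) =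
    ((\sum_k 'X^(e k) * (A k)^`N(l)) \Po 'X^(b ^ n)) * nu ^+ l.
  rewrite raddf_sum /= mulr_suml; apply: eq_bigr => k _.
  by rewrite comp_polyM comp_Xn_poly exprM mulrA.
have [lL|Ll] := ltnP l L.
  apply: dvdp_mulr; have /dvdpP[u ->] := dB l lL.
  by rewrite comp_polyM [P \Po _]comp_polyXq dvdp_mull // dvdp_exp2l.
apply: dvdp_mull; apply: (dvdp_trans (dvdp_exp2l _ Ll)); exact: dvdp_exp2r.
Qed.
End TaylorAtFrobenius.

(* For P irreducible of degree n with root x, [P.[a]] is the norm of a - x,
   hence [norm0 P] = f(x)^D, where D = (q - 1) / (b - 1). The auxiliary
   polynomial is sum over k < d I of X^(q (k / d)) f^(L + D (k mod d)) z_k(X), with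
   z_k of size at most R; at the roots x with norm c, X^q acts as X and f^D as c,
   so that vanishing to order L is a linear system on the z_k, of fewer equations
   than unknowns by [LJR]. It is a nonzero polynomial because 0 is a simple root of f. *)
Section Stepanov.
Variables (F : finFieldType) (s : seq F).
Hypothesis s0 : 0 \notin s.
Local Notation b := #|F|.
Local Notation m := (size s).+1.
Local Notation d := b.-1.
Variables (n I L R : nat) (c : F).
Local Notation q := (b ^ n)%N.
Local Notation J := (d * I)%N.
Let D := (\sum_(i < n) b ^ i)%N.
Hypothesis RID : (R + I <= D.+1)%N.
Hypothesis LJR : (L * (L * m + R + I) < J * R)%N.
Hypothesis Lq : (L <= q)%N.
Let f : {poly F} := \prod_(a <- 0 :: s) (a%:P - 'X).
Let norm0 (P : {poly F}) : F := \prod_(a <- 0 :: s) P.[a].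

Let b1 : (1 < b)%N. Proof. exact: finNzRing_gt1. Qed.
Let d0 : (0 < d)%N. Proof. by case: b b1 => [|[]]. Qed.

Let qE : (q = d * D + 1)%N.
Proof. by rewrite /D -predn_exp addn1 prednK // expn_gt0 ltnW. Qed.

Let g : {poly F} := - \prod_(a <- s) (a%:P - 'X).

Let fE : f = 'X * g.
Proof. by rewrite /f big_cons sub0r mulNr /g mulrN. Qed.

Let g0 : g.[0] != 0.
Proof.
rewrite hornerN oppr_eq0 horner_prod prodf_seq_neq0; apply/allP => a a_s /=.
by rewrite !hornerE ?subr0; apply: contraNneq s0 => <-.
Qed.

Let size_f : size f = m.+1.
Proof.
suff H (t : seq F) : size (\prod_(a <- t) (a%:P - 'X)) = (size t).+1 by rewrite H.
elim: t => [|a t IH]; first by rewrite big_nil size_poly1.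
have p0 : \prod_(x <- t) (x%:P - 'X) != 0 by rewrite -size_poly_gt0 IH.
rewrite big_cons -opprB mulNr size_polyN size_mul ?polyXsubC_eq0 //.
by rewrite size_XsubC IH.
Qed.

Let R0 : (0 < R)%N. Proof. by move: LJR; case: (R) => //; rewrite muln0. Qed.

Let f0 : f != 0. Proof. by rewrite -size_poly_gt0 size_f. Qed.

Let size_fX N : size (f ^+ N) = (N * m).+1.
Proof.
have := size_exp f N; rewrite size_f /= mulnC => <-.
by rewrite prednK // size_poly_gt0 expf_neq0.
Qed.

Let rowp (z : 'M[F]_(J, R)) (k : 'I_J) : {poly F} := rVpoly (row k z).

Let rowp_linear k a (z z' : 'M[F]_(J, R)) : rowp (a *: z + z') k = a *: rowp z k + rowp z' k.
Proof. by rewrite /rowp !linearP. Qed.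

Let size_rowp z k : (size (rowp z k) <= R)%N.
Proof. exact: size_poly. Qed.

Let A z (k : 'I_J) : {poly F} := f ^+ (L + D * (k %% d)) * rowp z k.

Let size_A z k : (size (A z k) <= (L + D * (k %% d)) * m + R)%N.
Proof.
apply: leq_trans (size_polyMleq _ _) _; rewrite size_fX addSn /=.
by rewrite leq_add2l.
Qed.

(** The exponent L in [A] pays for derivatives of order l < L, so this division is exact. The size
    of the quotient is at most L m + R, free of D, which keeps the number of equations small. *)
Let E l (z : 'M[F]_(J, R)) (k : 'I_J) : {poly F} := (A z k)^`N(l) %/ f ^+ (D * (k %% d)).

Let A_E l z k : (l < L)%N -> (A z k)^`N(l) = f ^+ (D * (k %% d)) * E l z k.
Proof.
move=> lL; rewrite mulrC divpK //.
apply: (dvdp_trans _ (dvd_nderivn_exp _ _ _ _)); apply: dvdp_exp2l.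
by rewrite -addnBAC ?leq_addl // ltnW.
Qed.

Let size_E l z k : (size (E l z k) <= L * m + R)%N.
Proof.
rewrite size_divp ?expf_neq0 // size_fX /= leq_subLR.
apply: leq_trans (leq_trans (size_poly _ _) (leq_subr _ _)) _.
by apply: leq_trans (size_A _ _) _; rewrite mulnDl -addnA addnCA.
Qed.

Let E_linear l a (z z' : 'M[F]_(J, R)) k : E l (a *: z + z') k = a *: E l z k + E l z' k.
Proof.
by rewrite /E /A rowp_linear mulrDr -scalerAr linearP /= divpD divpZl.
Qed.

Let B l z : {poly F} := \sum_(k < J) (c ^+ (k %% d))%:P * ('X^(k %/ d) * E l z k).

Let kI (k : 'I_J) : (k %/ d < I)%N.
Proof. by rewrite ltn_divLR // [(I * d)%N]mulnC. Qed.

Let size_B l z : (size (B l z) <= L * m + R + I)%N.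
Proof.
apply: leq_trans (size_sum _ _ _) _; apply/bigmax_leqP => k _.
rewrite mul_polyC; apply: leq_trans (size_scale_leq _ _) _.
apply: leq_trans (size_polyMleq _ _) _.
rewrite size_polyXn addSn /= addnC; apply: leq_add => //.
by apply/ltnW/kI.
Qed.

Let Bmx z : 'M[F]_(L, L * m + R + I) := \matrix_(l, t) (B l z)`_t.

Let Bmx_is_linear a (z z' : 'M[F]_(J, R)) :
  Bmx (a *: z + z') = a *: Bmx z + Bmx z'.
Proof.
apply/matrixP => l t; rewrite !mxE.
suff -> : B l (a *: z + z') = a%:P * B l z + B l z' by rewrite coefD coefCM.
rewrite /B mulr_sumr -big_split /=; apply: eq_bigr => k _.
by rewrite E_linear -mul_polyC; ring.
Qed.

Let stepanov_vanish z P : Bmx z = 0 -> P \in irrs F n -> norm0 P = c ->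
  P ^+ L %| \sum_(k < J) 'X^(q * (k %/ d)) * A z k.
Proof.
move=> Bz Pn Pc; apply: (@irr_exp_dvd_taylor F n P L J (fun k => k %/ d)%N (A z) Pn Lq) => l lL.
have Bl0 : B l z = 0.
  apply/polyP => t; rewrite coef0; have [tT|Tt] := ltnP t (L * m + R + I)%N.
    have /matrixP/(_ (Ordinal lL) (Ordinal tT)) := Bz; rewrite !mxE /=.
    by [].
  by rewrite nth_default // (leq_trans (size_B _ _)).
suff: P %| \sum_(k < J) 'X^(k %/ d) * (A z k)^`N(l) - B l z by rewrite Bl0 subr0.
rewrite /B -sumrB; apply: dvdp_bigsum => k _.
rewrite (A_E _ _ lL) [X in _ %| X](_ : _ = ('X^(k %/ d) * E l z k) *
   ((f ^+ D) ^+ (k %% d) - c%:P ^+ (k %% d))); last first.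
  by rewrite -exprM -polyC_exp; ring.
rewrite subrXX; apply/dvdp_mull/dvdp_mulr; rewrite -Pc.
exact: irr_dvd_norm_prod Pn (0 :: s).
Qed.

(** As f = X g and q = d D + 1, the k-th summand is X^(L + D k + k / d) times a power of g, prime to
    X, times z_k. These exponents grow by at least D, so for the least k with z_k nonzero a
    vanishing sum would make X^(D - k / d) divide z_k; [RID] excludes this, as z_k has size at most
    R. *)
Let stepanov_neq0 z : z != 0 -> \sum_(k < J) 'X^(q * (k %/ d)) * A z k != 0.
Proof.
move=> z0; apply/eqP => r0.
have [k1 k1z] : exists k, row k z != 0.
  apply/existsP; apply: contraNT z0; rewrite negb_exists => /forallP zk.
  apply/eqP/row_matrixP => k; rewrite row0; apply/eqP; move: (zk k).
  by rewrite negbK.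
have [k kz kmin] :=
  @arg_minnP _ k1 (fun i => row i z != 0) (fun k : 'I_J => k : nat) k1z.
pose w (i : 'I_J) := g ^+ (L + D * (i %% d)) * rowp z i.
have rE : \sum_(i < J) 'X^(q * (i %/ d)) * A z i =
    'X^L * \sum_(i < J) 'X^(D * i + i %/ d) * w i.
  rewrite mulr_sumr; apply: eq_bigr => i _; rewrite /A fE exprMn /w !mulrA.
  congr (_ * _ * _); rewrite -!exprD; congr ('X^_).
  by rewrite qE; have := divn_eq i d; nia.
move: r0; rewrite rE => /eqP; rewrite mulf_eq0 expf_eq0 polyX_eq0 andbF /=.
rewrite (bigD1 k) //= addr_eq0 => /eqP wE.
have kI' := kI k.
have : 'X^(D * k.+1) %| 'X^(D * k + k %/ d) * w k.
  rewrite wE dvdpNr; apply: dvdp_bigsum => i ik.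
  have [ri|iz] := eqVneq (rowp z i) 0; first by rewrite /w ri !mulr0 dvdp0.
  have ki : (k < i)%N.
    rewrite ltn_neqAle eq_sym (_ : _ != _) ?kmin //.
    by apply: contraNneq iz => iz; rewrite /rowp iz linear0.
  apply/dvdp_mulr/dvdp_exp2l/(leq_trans _ (leq_addr _ _)).
  by rewrite leq_mul2l ki orbT.
rewrite (_ : D * k.+1 = D * k + k %/ d + (D - k %/ d))%N; last first.
  by rewrite mulnS -addnA subnKC 1?addnC //; move: RID R0 kI'; lia.
rewrite exprD dvdp_mul2l ?expf_neq0 ?polyX_eq0 // /w Gauss_dvdpr; last first.
  rewrite coprimep_expl ?coprimep_expr // coprimep_sym.
  by rewrite -['X]subr0 -[0]/(0%:P) coprimep_XsubC rootE.
have kz' : rowp z k != 0.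
  apply: contraNneq kz => kz; apply/eqP/row_matrixP => i.
  by rewrite -[row k z]rVpolyK -/(rowp z k) kz linear0.
move=> /(dvdp_leq kz'); rewrite size_polyXn ltnNge; case/negP.
by apply: leq_trans (size_rowp _ _) _; lia.
Qed.

Lemma stepanov_poly : exists r : {poly F},
  [/\ r != 0, (size r <= L * m + q * (I + m))%N &
      forall P, P \in irrs F n -> norm0 P = c -> P ^+ L %| r].
Proof.
pose hB := GRing.isLinear.Build F 'M[F]_(J, R) 'M[F]_(L, L * m + R + I) _ Bmx Bmx_is_linear.
pose u : {linear 'M[F]_(J, R) -> 'M[F]_(L, L * m + R + I)} := HB.pack Bmx hB.
have [z z0 uz] := @lin_kernel F _ _ u LJR.
exists (\sum_(k < J) 'X^(q * (k %/ d)) * A z k); split; first exact: stepanov_neq0.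
  apply: leq_trans (size_sum _ _ _) _; apply/bigmax_leqP => k _.
  apply: leq_trans (size_polyMleq _ _) _; rewrite size_polyXn addSn /=.
  have := size_A z k; have kI' := kI k.
  have Dq : (D * d <= q)%N by rewrite qE mulnC leq_addr.
  have e1 : (q * (k %/ d) + q <= q * I)%N.
    by rewrite addnC -mulnS leq_mul2l kI' orbT.
  have e2 : (D * (k %% d) * m <= q * m)%N.
    rewrite leq_mul2r; apply/orP; right; apply: leq_trans Dq.
    by rewrite leq_mul2l ltnW ?orbT // ltn_mod.
  have RD : (R <= q)%N.
    apply: (@leq_trans (D * d + 1)); last by rewrite qE mulnC.
    have : (D <= D * d)%N by rewrite leq_pmulr.
    have : (0 < I)%N by case: (I) LJR => //; rewrite muln0 mul0n.
    by move: RID; lia.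
  move=> sA; apply: leq_trans (leq_add (leqnn _) sA) _.
  rewrite mulnDl mulnDr.
  have arith x1 x2 x3 x4 x5 x6 x7 : (x1 + x6 <= x3)%N -> (x2 <= x4)%N ->
    (x7 <= x6)%N -> (x1 + (x5 + x2 + x7) <= x5 + (x3 + x4))%N by lia.
  exact: arith e1 e2 RD.
by move=> P; apply: stepanov_vanish.
Qed.

Lemma prod_irr_dvd (ps : seq {poly F}) r : uniq ps -> all (mem (irrs F n)) ps ->
  (forall P, P \in ps -> P ^+ L %| r) ->
  (\prod_(P <- ps) P ^+ L \in monics F (size ps * (L * n))) &&
  (\prod_(P <- ps) P ^+ L %| r).
Proof.
elim: ps => [|P ps IH] /=; first by rewrite big_nil monics0 inE eqxx dvd1p.
case/andP=> Pps psu /andP[Pn psn] dr.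
have [|prm prd] := andP (IH psu psn _).
  by move=> P' P'ps; apply: dr; rewrite inE P'ps orbT.
rewrite !big_cons; apply/andP; split.
  move: prm (monics_exp L (irrs_monics Pn)).
  rewrite !mem_monics => /andP[m1 /eqP s1] /andP[m2 /eqP s2].
  rewrite monicMl // m1 size_monicM ?monic_neq0 // s1 s2.
  by rewrite addSn /= addnS mulSn.
rewrite Gauss_dvdp ?prd ?dr ?inE ?eqxx //.
rewrite big_seq; elim/big_ind: _ => [|x y cx cy|P' P'ps].
- by rewrite coprimep1.
- by rewrite coprimepMr cx.
apply/coprimep_expl/coprimep_expr/(irr_coprime Pn (allP psn _ P'ps)).
by apply: contraNneq Pps => ->.
Qed.

(** Powers of distinct irreducibles are coprime, so their product divides the nonzero auxiliary
    polynomial; each P accounts for n L in the degree. *)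
Lemma stepanov_count :
  (n * size [seq P <- irrs F n | norm0 P == c] * L <= L * m + q * (I + m))%N.
Proof.
have [r [r0 sr dr]] := stepanov_poly.
set ps := seq.filter _ _.
have psu : uniq ps by exact/filter_uniq/irrs_uniq.
have psn : all (mem (irrs F n)) ps.
  by apply/allP => P; rewrite mem_filter => /andP[].
have psd P : P \in ps -> P ^+ L %| r.
  by rewrite mem_filter => /andP[/eqP Pc Pn]; apply: dr.
have /andP[/size_mem_monics sz /dvdp_leq] := prod_irr_dvd psu psn psd.
rewrite sz => /(_ r0) /ltnW H; rewrite mulnAC mulnC (mulnC n).
exact: leq_trans H sr.
Qed.

End Stepanov.

(** * Distribution of values over irreducible polynomials *)

Section CharacterPrimeSum.
Variables (F : finFieldType) (C : numFieldType) (s : seq F) (chi : F -> C).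
Hypothesis s0 : 0 \notin s.
Hypothesis chi0 : chi 0 = 0.
Hypothesis chi_le1 : forall x, `|chi x| <= 1.
Hypothesis chi_sum : \sum_x chi x = 0.
Hypothesis b2 : (2 < #|F|)%N.
Local Notation b := #|F|.
Local Notation m := (size s).+1.
Local Notation d := b.-1.

Definition vals_prod (P : {poly F}) : F := \prod_(a <- 0 :: s) P.[a].

Lemma irr_vals_neq0 n P : (1 < n)%N -> P \in irrs F n -> vals_prod P != 0.
Proof.
move=> n1 Pn; rewrite prodf_seq_neq0; apply/allP => a _ /=.
have sP := size_mem_monics (irrs_monics Pn).
move: Pn; rewrite mem_irrs => /andP[/irreducibleP [_ Pirr] _].
apply/negP; rewrite -[_ == 0]/(root P a) root_factor_theorem => aP.
have := Pirr _ _ aP; rewrite size_XsubC => /(_ isT)/eqp_size.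
by rewrite size_XsubC sP => -[n1']; rewrite -n1' in n1.
Qed.

Section FixedDegree.
Variable nu : nat.
Hypothesis nu_large : (m + 4 <= nu)%N.
Local Notation u := (b ^ nu)%N.
Local Notation n := (4 * nu)%N.
Local Notation q := (b ^ n)%N.
(** With I = u = q^(1/4) one has J = d u = L + 1, and the unknowns outnumber the equations once L (L
    m + u) + u < D. The two sides are about b^2 m u^2 and u^4 / b, and [nu_large] gives b^3 (m + 1)
    <= u^2. The error left at the end, (d m + 1) q / L, is at most (d m + 1) u^3, with u^3 =
    q^(3/4). *)
Let L := (d * u).-1.
Let D := (\sum_(i < n) b ^ i)%N.
Let R := (D - u)%N.

Let u0 : (0 < u)%N. Proof. by rewrite expn_gt0; apply/orP; left; lia. Qed.

Let qu : q = (u ^ 4)%N. Proof. by rewrite -expnM mulnC. Qed.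

Let qD : q = (d * D + 1)%N.
Proof. by rewrite /D -predn_exp addn1 prednK // expn_gt0; lia. Qed.

Let uu : (b ^ 3 * (m + 1) <= u ^ 2)%N.
Proof.
rewrite -expnM; apply: (@leq_trans (b ^ 3 * b ^ (m + 1))).
  by rewrite leq_mul2l ltnW ?orbT // ltn_expl //; lia.
by rewrite -expnD leq_exp2l //; lia.
Qed.

Let Lu : (u <= L)%N.
Proof. by have := u0; rewrite /L; nia. Qed.

Let D_large : (L * (L * m + u) + u < D)%N.
Proof.
have du : (L < b * u)%N by have := u0; rewrite /L; nia.
have h1 : (L * (L * m + u) + u <= b * u * (b * u * m + u))%N.
  have -> : (b * u * (b * u * m + u) = b * u * (b * u * m) + b * u * u)%N by ring.
  have : (L * (L * m) <= b * u * (b * u * m))%N.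
    by rewrite leq_mul ?leq_mul2r ?(ltnW du) ?orbT // ltnW.
  have : (L * u + u <= b * u * u)%N by rewrite addnC -mulSn leq_mul2r du orbT.
  by lia.
have h2 : (b * (b * u * (b * u * m + u)) < u ^ 4)%N.
  apply: (@leq_trans (b ^ 3 * (m + 1) * u ^ 2)).
    have -> : (b * (b * u * (b * u * m + u)) = (b ^ 3 * m + b ^ 2) * u ^ 2)%N by ring.
    rewrite ltn_mul2r expn_gt0 u0 /= mulnDr muln1 ltn_add2l.
    by rewrite ltn_exp2l // ltnW.
  by rewrite (_ : u ^ 4 = u ^ 2 * u ^ 2)%N ?leq_mul2r ?uu ?orbT // -expnD.
have h3 : (u ^ 4 <= b * D)%N.
  rewrite -qu qD -[X in (_ <= X * _)%N](@prednK b); last lia.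
  rewrite mulSn addnC leq_add2r.
  by case: (D) qD => //; have := h2; rewrite -qu => /[swap] ->; rewrite muln0; lia.
rewrite -(@ltn_pmul2l b); last lia.
apply: leq_trans (leq_trans h2 h3); rewrite ltnS leq_mul2l h1 orbT //.
Qed.

Let RDE : (R + u = D)%N.
Proof. by rewrite /R subnK //; move: D_large; lia. Qed.

Let count_le (c : F) :
  (n * size [seq P <- irrs F n | vals_prod P == c] * L <= L * m + q * (u + m))%N.
Proof.
have h1 : (R + u <= (\sum_(i < n) b ^ i).+1)%N by rewrite RDE.
have h2 : (L * (L * m + R + u) < d * u * R)%N.
  have -> : (d * u = L.+1)%N by rewrite prednK // muln_gt0 u0; lia.
  rewrite mulSn (_ : L * (L * m + R + u) = L * (L * m + u) + L * R)%N; last by ring.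
  by rewrite ltn_add2r; move: D_large RDE; lia.
have h3 : (L <= q)%N.
  have : (d * u <= q)%N.
    rewrite (@leq_trans (b * u)) ?leq_mul2r ?leq_pred ?orbT // -expnS leq_exp2l; lia.
  by rewrite /L; lia.
exact: (stepanov_count s0 c h1 h2 h3).
Qed.

Let N := size (irrs F n).

Let sum_count :
  (\sum_(c | c != 0%R) size [seq P <- irrs F n | vals_prod P == c] = N)%N.
Proof.
transitivity (\sum_(P <- irrs F n) 1)%N; last by rewrite sum1_size.
under eq_bigr do rewrite -sum1_size big_filter big_mkcond.
rewrite exchange_big; apply: eq_big_seq => P Pn.
rewrite -big_mkcondr (big_pred1 (vals_prod P)) // => c /=.
rewrite [vals_prod P == c]eq_sym; case: eqVneq => [->|_] //=.
by apply/esym/negbTE; rewrite eq_sym; apply: irr_vals_neq0 Pn; lia.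
Qed.

(** Since chi sums to 0, the common upper bound [V] for all the n [K c] L can be subtracted from
    each of them. The differences V - n K_c L are nonnegative, so their total d V - n N L bounds the
    sum, and it is small because N is nearly q / n. *)
Lemma char_sum_irrs :
  `|n%:R * \sum_(P <- irrs F n) chi (vals_prod P)| <=
     (d * m + n * u ^ 2 + (d * m + 1) * u ^ 3)%:R.
Proof.
pose V := (L * m + q * (u + m))%N.
pose K c := size [seq P <- irrs F n | vals_prod P == c].
have L0 : (0 < L)%N by apply: leq_trans Lu; exact: u0.
have chi_sum' : \sum_(c | c != 0) chi c = 0.
  by have := chi_sum; rewrite (bigD1 0) //= chi0 add0r.
have E : L%:R * (n%:R * \sum_(P <- irrs F n) chi (vals_prod P)) =
    \sum_(c | c != 0) chi c * ((n * K c * L)%:R - V%:R).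
  under [RHS]eq_bigr do rewrite mulrBr.
  rewrite sumrB -mulr_suml chi_sum' mul0r subr0.
  transitivity (L%:R * (n%:R * \sum_(c | c != 0) chi c * (K c)%:R)); last first.
    by rewrite !mulr_sumr; apply: eq_bigr => c _; rewrite !natrM; ring.
  congr (_ * (_ * _)).
  transitivity (\sum_(P <- irrs F n) \sum_(c | c != 0)
     (if vals_prod P == c then chi c else 0)).
    apply: eq_big_seq => P Pn.
    rewrite -big_mkcondr (big_pred1 (vals_prod P)) // => c /=.
    rewrite [vals_prod P == c]eq_sym.
    case: eqVneq => [->|_] //=.
    by apply/esym/negbTE; rewrite eq_sym; apply: irr_vals_neq0 Pn; lia.
  rewrite exchange_big; apply: eq_bigr => c _; rewrite -big_mkcond.
  by rewrite -big_filter big_const_seq count_predT iter_addr_0 mulr_natr.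
rewrite -(ler_pM2l (_ : 0 < L%:R)) ?ltr0n // -{1}[L%:R]ger0_norm ?ler0n //.
rewrite -normrM E; apply: le_trans (ler_norm_sum _ _ _) _.
apply: (@le_trans _ _ (\sum_(c : F | c != 0) (V - n * K c * L)%:R)).
  apply: ler_sum => c _; rewrite normrM distrC -natrB ?count_le // normr_nat.
  by rewrite ler_piMl.
rewrite -natr_sum -natrM ler_nat sumnB; last by move=> c _; exact: count_le.
rewrite sum_nat_const (_ : #|_| = d); last first.
  by rewrite (eq_card (B := predC1 0)) ?cardC1.
rewrite -!(big_distrl, big_distrr) /= sum_count.
have n0 : (0 < n)%N by lia.
have := card_irrs_ge F n0; rewrite -/N (_ : b ^ n./2 = u ^ 2)%N; last first.
  by rewrite -expnM; congr (_ ^ _)%N; lia.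
move=> qN; rewrite leq_subLR /V.
have duL : (d * u = L + 1)%N by rewrite addn1 prednK // muln_gt0 u0; lia.
have e1 : (q * L <= n * N * L + L * (n * u ^ 2))%N.
  by rewrite (mulnC L) -mulnDl leq_mul2r qN orbT.
have e2 : (q * (d * m + 1) <= L * ((d * m + 1) * u ^ 3))%N.
  rewrite qu (_ : u ^ 4 * (d * m + 1) = u * ((d * m + 1) * u ^ 3))%N; last by ring.
  by rewrite leq_mul2r Lu orbT.
have -> : (d * (L * m + q * (u + m)) =
   L * (d * m) + q * L + q * (d * m + 1))%N.
  have -> : (d * (L * m + q * (u + m)) = L * (d * m) + q * (d * u) + q * (d * m))%N.
    by ring.
  by rewrite duL; ring.
have arith x1 x2 x3 x4 x5 x6 : (x2 <= x4 + x5)%N -> (x3 <= x6)%N ->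
  (x1 + x2 + x3 <= x4 + (x1 + x5 + x6))%N by lia.
by rewrite !(mulnDr L); apply: arith e1 e2.
Qed.
End FixedDegree.

Definition vals_chi (P : {poly F}) : C := chi (vals_prod P).

Lemma vals_chi_lpsum nu : (m + 4 <= nu)%N ->
  `|lpsum vals_chi (4 * nu)| <= ((2 * b * m + 8) * nu.+1 * (b ^ 3) ^ nu)%:R.
Proof.
move=> nu_large; have n0 : (0 < 4 * nu)%N by lia.
have h1 := lpsum_irrs (lam := vals_chi) n0 (fun P => chi_le1 _).
have h2 := char_sum_irrs nu_large.
rewrite -[lpsum _ _](subrK ((4 * nu)%:R * \sum_(P <- irrs F (4 * nu)) vals_chi P)).
apply: le_trans (ler_normD _ _) _; apply: le_trans (lerD h1 h2) _.
rewrite -natrD ler_nat (_ : b ^ (4 * nu)./2 = (b ^ nu) ^ 2)%N; last first.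
  by rewrite -expnM; congr (_ ^ _)%N; lia.
rewrite (_ : (b ^ 3) ^ nu = (b ^ nu) ^ 3)%N; last by rewrite -!expnM mulnC.
set u := (b ^ nu)%N; have u0 : (0 < u)%N by rewrite expn_gt0; lia.
have u23 : (u ^ 2 <= u ^ 3)%N by rewrite leq_pexp2l.
have u13 : (1 <= u ^ 3)%N by rewrite expn_gt0 u0.
have dmb : (d * m + 1 <= b * m)%N.
  by rewrite -[X in (_ <= X * _)%N](@prednK b) ?mulSn; lia.
move: dmb u23 u13; move: (d * m)%N (u ^ 2)%N (u ^ 3)%N => x y z dmb yz z0.
apply: (@leq_trans ((8 * nu + 2 * x + 1) * z)); first by nia.
by rewrite leq_mul2r; apply/orP; right; nia.
Qed.

End CharacterPrimeSum.

(** * Bound for complete character sums *)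

Section ComplexModulus.
Variable R : rcfType.
Implicit Types z : R[i].

Lemma normr_normc z : `|z| = (normc z)%:C%C.
Proof. by rewrite normc_def; case: z. Qed.

Lemma normc_le z (x : R) : (`|z| <= x%:C%C) = (normc z <= x).
Proof. by rewrite normr_normc lecR. Qed.

Lemma normc_ge0 z : 0 <= normc z.
Proof. by rewrite -lecR -normr_normc normr_ge0. Qed.

Lemma normcX z n : normc (z ^+ n) = normc z ^+ n.
Proof.
by apply: (@complexI R); rewrite rmorphXn -!normr_normc normrX.
Qed.

Lemma normc_opp z : normc (- z) = normc z.
Proof. by apply: (@complexI R); rewrite -!normr_normc normrN. Qed.

Lemma normc_add z w : normc (z + w) <= normc z + normc w.
Proof. by rewrite -lecR rmorphD /= -!normr_normc ler_normD. Qed.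

Lemma normc_sum (I : Type) (r : seq I) (P : pred I) (f : I -> R[i]) :
  normc (\sum_(i <- r | P i) f i) <= \sum_(i <- r | P i) normc (f i).
Proof.
rewrite -lecR -normr_normc; apply: le_trans (ler_norm_sum _ _ _) _.
by rewrite rmorph_sum; apply: ler_sum => i _; rewrite normr_normc.
Qed.

Lemma normc_eq0 z : (normc z == 0) = (z == 0).
Proof.
by apply/eqP/eqP => [/ComplexField.Normc.eq0_normc|->] //; rewrite ComplexField.Normc.normc0.
Qed.

Lemma normc_nat n : normc (n%:R : R[i]) = n%:R.
Proof. by apply: (@complexI R); rewrite -normr_normc normr_nat rmorph_nat. Qed.

End ComplexModulus.

(** * Newton identities and the size of inverse roots *)

Section NewtonIdentities.
Variable C : numClosedFieldType.
Implicit Types (r : seq C).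

Let E r : {poly C} := \prod_(z <- r) (1 - z *: 'X).
Let p r n : C := \sum_(z <- r) z ^+ n.

Let E_cons z r n : (E (z :: r))`_n = (E r)`_n - (if n is k.+1 then z * (E r)`_k else 0).
Proof.
rewrite /E big_cons mulrBl mul1r -scalerAl coefB coefZ coefXM.
by case: n => [|n] /=; rewrite ?mulr0.
Qed.

Let E0 r : (E r)`_0 = 1.
Proof. by elim: r => [|z r IH]; rewrite ?E_cons ?IH ?subr0 // /E big_nil coef1. Qed.

Lemma newton_roots r n :
  \sum_(1 <= j < n.+1) p r j * (E r)`_(n - j) = - (n%:R * (E r)`_n).
Proof.
elim: r n => [|z r IHr] n.
  rewrite big1 => [|j _]; last by rewrite /p big_nil mul0r.
  by rewrite /E big_nil coef1; case: n => [|n]; rewrite ?mul0r ?mulr0 oppr0.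
case: n => [|n]; first by rewrite big_geq // mul0r oppr0.
have pE j : p (z :: r) j = z ^+ j + p r j by rewrite /p big_cons.
pose e k := if (k <= n)%N then (E r)`_(n - k) else 0.
have EE j : (0 < j <= n.+1)%N -> (E (z :: r))`_(n.+1 - j) = (E r)`_(n.+1 - j) - z * e j.
  case/andP=> j0 jn; rewrite E_cons /e; have [le_jn|lt_nj] := leqP j n.
    by rewrite subSn.
  by rewrite (_ : n.+1 - j = 0)%N ?mulr0 //; lia.
transitivity (\sum_(1 <= j < n.+2) (z ^+ j * ((E r)`_(n.+1 - j) - z * e j))
   + \sum_(1 <= j < n.+2) p r j * (E r)`_(n.+1 - j)
   - z * \sum_(1 <= j < n.+2) p r j * e j).
  rewrite mulr_sumr -big_split -sumrB /=; apply: eq_big_nat => j jn.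
  by rewrite pE EE //; ring.
have en : e n.+1 = 0 by rewrite /e ltnn.
rewrite IHr [X in z * X]big_nat_recr //= en mulr0 addr0.
have -> : \sum_(1 <= j < n.+1) p r j * e j = - (n%:R * (E r)`_n).
  rewrite -IHr; apply: eq_big_nat => j /andP[_ jn].
  by rewrite /e -ltnS jn.
rewrite big_add1 /= (@telescope_sumr_eq _ _ _ (fun k => - (z ^+ k.+1 * e k))) //.
  by rewrite en E_cons /e leq0n subn0; ring.
move=> i /andP[_ ni]; have ei : e i = (E r)`_(n - i) by rewrite /e -ltnS ni.
by rewrite ei subSS !exprS; ring.
Qed.

Let size_E r : (size (E r) <= (size r).+1)%N.
Proof.
elim: r => [|z r IH]; first by rewrite /E big_nil size_poly1.
rewrite /E big_cons; apply: leq_trans (size_polyMleq _ _) _.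
have : (size (1 - z *: 'X)%R <= 2)%N.
  rewrite (leq_trans (size_polyD _ _)) // size_poly1 size_polyN geq_max /=.
  by rewrite (leq_trans (size_scale_leq _ _)) // size_polyX.
move=> h; apply: (@leq_trans (2 + (size r).+1).-1) => //.
by rewrite -!subn1 leq_sub2r // leq_add.
Qed.

Lemma coef_prod_XsubC r n : (n <= size r)%N ->
  (\prod_(z <- r) ('X - z%:P))`_(size r - n) = (E r)`_n.
Proof.
elim: r n => [|z r IH] n; first by rewrite leqn0 => /eqP ->; rewrite /E !big_nil.
have top : (\prod_(z <- r) ('X - z%:P))`_(size r).+1 = 0.
  by rewrite nth_default // size_prod_XsubC.
rewrite big_cons mulrBl coefB coefXM coefCM /= E_cons.
case: n => [_|n]; first by rewrite subn0 /= top mulr0 -[in LHS](subn0 (size r)) IH.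
rewrite ltnS subSS => le_n; rewrite IH // subn_eq0; congr (_ - _).
have [le_sr|lt_n] := leqP (size r) n; last by rewrite -IH // subnS.
by rewrite nth_default //; apply: leq_trans (size_E r) _.
Qed.

(** The recursion determines S from c. The inverse roots of sum c_n T^n are the roots of the
    reversed polynomial, which is monic because c_0 = 1, so there are exactly N of them, zeros
    included, even if c_N = 0. *)
Lemma newton_power_sums (N : nat) (c S : nat -> C) :
  c 0%N = 1 -> (forall n, (N < n)%N -> c n = 0) ->
  (forall n, n%:R * c n = \sum_(1 <= j < n.+1) S j * c (n - j)%N) ->
  exists r, [/\ size r = N, c 1%N = - p r 1 & forall n, (0 < n)%N -> S n = - p r n].
Proof.
move=> c0 cN newton.
pose Q := \poly_(i < N.+1) c (N - i)%N.
have QN : Q`_N = 1 by rewrite coef_poly ltnSn subnn.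
have sQ : size Q = N.+1.
  by apply/eqP; rewrite eqn_leq size_poly /= ltnNge; apply/negP => /leq_sizeP/(_ N);
     rewrite QN leqnn => /(_ isT)/eqP; rewrite oner_eq0.
have [r Qr] := closed_field_poly_normal Q.
have lQ : lead_coef Q = 1 by rewrite lead_coefE sQ.
rewrite lQ scale1r in Qr.
have sr : size r = N by move: sQ; rewrite Qr size_prod_XsubC => -[].
have cE n : c n = (E r)`_n.
  have [le_n|lt_n] := leqP n N.
    by rewrite -coef_prod_XsubC ?sr // -Qr coef_poly ltnS leq_subr subKn.
  rewrite cN // nth_default // /E; apply: leq_trans lt_n.
  by rewrite -sr; exact: size_E.
exists r; split => //.
  have := newton_roots r 1; rewrite big_nat1 subnn E0 mulr1 mul1r -cE => ->.
  by rewrite opprK.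
elim/ltn_ind => -[//|n] IH _.
have nr := newton_roots r n.+1; rewrite big_nat_recr //= subnn E0 mulr1 in nr.
have nS := newton n.+1; rewrite big_nat_recr //= subnn c0 mulr1 cE in nS.
have sumE : \sum_(1 <= j < n.+1) S j * c (n.+1 - j)%N =
    - \sum_(1 <= j < n.+1) p r j * (E r)`_(n.+1 - j).
  rewrite -sumrN; apply: eq_big_nat => j /andP[j0 jn].
  by rewrite IH // cE mulNr.
rewrite {}sumE in nS; move: nr nS; set X := \sum_(_ <= _ < _) _.
set a := _ * (E r)`_ _ => nr nS.
have -> : p r n.+1 = - a - X by rewrite -nr; ring.
by rewrite nS; ring.
Qed.

End NewtonIdentities.

Section RootBound.
Variable R : realType.

(** Bernoulli's inequality squared: for h = x - 1 > 0, x^(2k) is at least (k h)^2, quadratic against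
    linear. *)
Lemma linear_lt_geometric (x K : R) n0 :
  0 <= x -> (forall n, (n0 <= n)%N -> x ^+ n <= K * n.+1%:R) -> x <= 1.
Proof.
move=> x0 H; rewrite leNgt; apply/negP => x1.
pose h := x - 1; have h0 : 0 < h by rewrite subr_gt0.
have bern k : 1 + k%:R * h <= x ^+ k.
  elim: k => [|k IH]; first by rewrite mul0r addr0 expr0.
  rewrite exprS; apply: le_trans (ler_wpM2l x0 IH).
  rewrite (_ : x = 1 + h); last by rewrite /h; ring.
  rewrite -subr_ge0 (_ : _ - _ = k%:R * h ^+ 2); first by rewrite mulr_ge0 ?sqr_ge0.
  by rewrite -natr1; ring.
have K0 : 0 <= K.
  have := le_trans (exprn_ge0 n0 x0) (H n0 (leqnn _)).
  by rewrite pmulr_lge0 // ltr0n.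
pose k := (Num.Def.archi_bound (3 * K / h ^+ 2) + n0).+1.
have hk : 3 * K / h ^+ 2 < k%:R.
  apply: lt_le_trans (archi_boundP _) _; last by rewrite ler_nat /k; lia.
  by rewrite divr_ge0 ?sqr_ge0 // mulr_ge0.
have := H (k * 2)%N (_ : (n0 <= _)%N); rewrite exprM => /(_ _) H1.
have {}H1 : (x ^+ k) ^+ 2 <= K * (k * 2).+1%:R by apply: H1; rewrite /k; lia.
have H2 : (k%:R * h) ^+ 2 <= (x ^+ k) ^+ 2.
  have kh0 : 0 <= k%:R * h by rewrite mulr_ge0 // ltW.
  rewrite lerXn2r ?nnegrE ?exprn_ge0 //; apply: le_trans (bern k).
  by rewrite lerDr.
have H3 : K * (k * 2).+1%:R <= 3 * K * k%:R.
  rewrite (mulrC 3) -mulrA ler_wpM2l // -natrM ler_nat /k; lia.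
have k0 : (0 : R) < k%:R by rewrite ltr0n.
have := le_trans H2 (le_trans H1 H3).
rewrite exprMn expr2 mulrAC ler_pM2r // leNgt => /negP; apply.
by rewrite -ltr_pdivrMr ?exprn_gt0.
Qed.

(** A combination of consecutive power sums isolates one root: if h vanishes at all the other roots,
    the sum over l of h_l p_(n+l) is w^n h(w) times the multiplicity of w. The bound passes to w^n
    with another constant. *)
Lemma power_sum_root_bound (r : seq R[i]) (K th : R) n0 : 0 < th ->
  (forall n, (n0 <= n)%N ->
     normc (\sum_(z <- r) z ^+ n) <= K * n.+1%:R * th ^+ n) ->
  forall z, z \in r -> normc z <= th.
Proof.
move=> th0 H w wr.
pose h : {poly R[i]} := \prod_(z <- rem w (undup r)) ('X - z%:P).
have hw : h.[w] != 0.
  rewrite horner_prod prodf_seq_neq0; apply/allP => z /=.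
  rewrite mem_rem_uniq ?undup_uniq // !inE => /andP[zw _].
  by rewrite !hornerE subr_eq0 eq_sym.
have hz z : z \in r -> z != w -> h.[z] = 0.
  move=> zr zw; apply/eqP; rewrite horner_prod prodf_seq_eq0; apply/hasP.
  exists z => /=; last by rewrite !hornerE subrr.
  by rewrite mem_rem_uniq ?undup_uniq // !inE zw mem_undup.
have K0 : 0 <= K.
  have := le_trans (normc_ge0 _) (H n0 (leqnn _)).
  by rewrite -mulrA pmulr_lge0 // mulr_gt0 ?exprn_gt0 ?ltr0n.
have E n : \sum_(l < size h) h`_l * \sum_(z <- r) z ^+ (n + l) =
    (count_mem w r)%:R * (w ^+ n * h.[w]).
  transitivity (\sum_(z <- r) z ^+ n * h.[z]).
    under eq_bigr do rewrite mulr_sumr.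
    rewrite exchange_big; apply: eq_bigr => z _ /=.
    rewrite horner_coef mulr_sumr; apply: eq_bigr => l _.
    by rewrite exprD; ring.
  rewrite (bigID (pred1 w)) /= [X in _ + X]big1_seq ?addr0; last first.
    by move=> z /andP[zw zr]; rewrite hz ?mulr0.
  rewrite (eq_bigr (fun=> w ^+ n * h.[w])) => [|z /eqP -> //].
  by rewrite -big_filter big_const_seq count_predT iter_addr_0 size_filter mulr_natl.
pose A := normc h.[w]; have A0 : 0 < A by rewrite lt0r normc_ge0 normc_eq0 hw.
pose K' := \sum_(l < size h) normc h`_l * (K * l.+1%:R * th ^+ l).
have B n : (n0 <= n)%N -> (normc w / th) ^+ n <= K' / A * n.+1%:R.
  move=> n0n; rewrite expr_div_n ler_pdivrMr ?exprn_gt0 //.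
  have -> : K' / A * n.+1%:R * th ^+ n = K' * (n.+1%:R * th ^+ n) / A by ring.
  rewrite ler_pdivlMr //.
  have -> : normc w ^+ n * A = normc (w ^+ n * h.[w]).
    by rewrite ComplexField.Normc.normcM normcX.
  apply: (@le_trans _ _ (normc (\sum_(l < size h) h`_l * \sum_(z <- r) z ^+ (n + l)))).
    rewrite E [leRHS]ComplexField.Normc.normcM normc_nat ler_peMl ?normc_ge0 //.
    by rewrite ler1n -has_count has_pred1.
  apply: le_trans (normc_sum _ _ _) _; rewrite mulr_suml; apply: ler_sum => l _.
  rewrite ComplexField.Normc.normcM -mulrA ler_wpM2l ?normc_ge0 //.
  apply: le_trans (H _ _) _; first by rewrite (leq_trans n0n) ?leq_addr.
  have -> : K * l.+1%:R * th ^+ l * (n.+1%:R * th ^+ n) =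
     K * (l.+1 * n.+1)%:R * th ^+ (n + l) by rewrite natrM exprD; ring.
  apply: ler_wpM2r; first by rewrite exprn_ge0 // ltW.
  by apply: ler_wpM2l => //; rewrite ler_nat; nia.
have := linear_lt_geometric _ B; rewrite divr_ge0 ?normc_ge0 ?(ltW th0) // => /(_ isT).
by rewrite ler_pdivrMr // mul1r.
Qed.

End RootBound.

(** * A Weil-type bound with exponent 3/4 *)

Section WeilBound.
Variables (R : realType) (F : finFieldType) (s : seq F) (chi : F -> R[i]).
Hypothesis s0 : 0 \notin s.
Hypothesis chi0 : chi 0 = 0.
Hypothesis chi1 : chi 1 = 1.
Hypothesis chiM : {morph chi : x y / x * y}.
Hypothesis chi_le1 : forall x, normc (chi x) <= 1.
Hypothesis chi_sum : \sum_x chi x = 0.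
Local Notation b := #|F|.

Let lam := vals_chi s chi.

Let lam1 : lam 1 = 1.
Proof. by rewrite /lam /vals_chi /vals_prod big1 // => a _; rewrite hornerC. Qed.

Let lamM : {morph lam : p q / p * q}.
Proof.
move=> p q; rewrite /lam /vals_chi -chiM /vals_prod -big_split /=.
by congr chi; apply: eq_bigr => a _; rewrite hornerM.
Qed.

(** Let w be the product of the X - a over the distinct a in s. Adding t w permutes the monic
    polynomials of degree n and fixes their values at s, while the value at 0 runs through F since
    w(0) is nonzero. Summation over t produces the full sum of chi, which is 0. *)
Let lcoef_large n : (size (undup s) < n)%N -> lcoef lam n = 0.
Proof.
move=> n_large; pose w : {poly F} := \prod_(a <- undup s) ('X - a%:P).
have sw : (size w <= n)%N by rewrite size_prod_XsubC.
have w0 : w.[0] != 0.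
  rewrite horner_prod prodf_seq_neq0; apply/allP => a /=; rewrite mem_undup => a_s.
  by rewrite !hornerE ?sub0r oppr_eq0; apply: contraNneq s0 => <-.
have ws a : a \in s -> w.[a] = 0.
  move=> a_s; apply/eqP; rewrite horner_prod prodf_seq_eq0; apply/hasP.
  by exists a; rewrite ?mem_undup //= !hornerE subrr.
have sub t g : g \in monics F n -> g + t *: w \in monics F n.
  have lt_sw : (size (t *: w) < n.+1)%N by rewrite ltnS (leq_trans (size_scale_leq _ _)).
  rewrite !mem_monics => /andP[gm /eqP sg].
  by rewrite monicE lead_coefDl ?sg // (monicP gm) eqxx size_polyDl sg ?lt_sw /=.
have perm t : perm_eq [seq g + t *: w | g <- monics F n] (monics F n).
  apply: uniq_perm (monics_uniq _ _) _; first by rewrite map_inj_uniq ?monics_uniq // => ? ? /addIr.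
  move=> g; apply/mapP/idP => [[h hn ->]|gn]; first exact: sub.
  exists (g + (- t) *: w); first exact: sub.
  by rewrite -addrA -scalerDl addNr scale0r addr0.
have b0 : (b%:R : R[i]) != 0.
  by rewrite pnatr_eq0 -lt0n ltnW // finNzRing_gt1.
apply: (mulfI b0); rewrite mulr0.
have -> : b%:R * lcoef lam n = \sum_(t : F) \sum_(g <- monics F n) lam (g + t *: w).
  rewrite (eq_bigr (fun=> lcoef lam n)) => [|t _]; last first.
    by rewrite -(big_map (fun g => g + t *: w) predT lam) (perm_big _ (perm t)).
  by rewrite big_const iter_addr_0 mulr_natl.
rewrite exchange_big big1 //= => g _.
pose k := \prod_(a <- s) g.[a].
rewrite (eq_bigr (fun t => chi k * chi (g.[0] + t * w.[0]))) => [|t _]; last first.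
  rewrite /lam /vals_chi /vals_prod big_cons -chiM mulrC !hornerE; congr (chi (_ * _)).
  by apply: eq_big_seq => a a_s; rewrite !hornerE ws // mulr0 addr0.
rewrite -mulr_sumr (reindex_onto (fun y => (y - g.[0]) / w.[0]) (fun t => g.[0] + t * w.[0])) /=; last first.
  by move=> t _; rewrite addrC addKr mulfK.
rewrite (eq_big xpredT chi) ?chi_sum ?mulr0 // => y; first by rewrite mulfVK // addrC subrK eqxx.
by rewrite mulfVK // addrC subrK.
Qed.

Let card_gt2 : (2 < b)%N.
Proof.
rewrite ltn_neqAle finNzRing_gt1 andbT; apply/eqP => b2.
have := chi_sum; rewrite (bigD1 0) //= (bigD1 1) ?oner_neq0 //= chi0 chi1 add0r.
rewrite big_pred0 ?addr0 => [/eqP|x]; first by rewrite oner_eq0.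
apply/negP => /andP[x0 x1]; have := max_card [set 0; 1; x].
have n01 : (0 : F) != 1 by rewrite eq_sym oner_neq0.
by rewrite -b2 finset.setUC cardsU1 cards2 !inE (negPf x0) (negPf x1) n01.
Qed.

(** The monic polynomials of degree 1 are the X - x, so the sum is the coefficient of T in L, that
    is, minus the sum of the inverse roots. Fourth powers avoid fractional exponents. *)
Lemma weil_bound :
  normc (\sum_x chi (\prod_(a <- 0 :: s) (a - x))) ^+ 4
    <= (size (undup s))%:R ^+ 4 * b%:R ^+ 3.
Proof.
have := newton_power_sums (lcoef0 lam1) lcoef_large (lcoef_newton lamM lam1).
move=> [r [sr c1 Sr]].
have -> : \sum_x chi (\prod_(a <- 0 :: s) (a - x)) = lcoef lam 1.
  have perm1 : perm_eq [seq 'X - x%:P | x : F] (monics F 1).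
    apply: uniq_perm (monics_uniq _ _) _.
      by rewrite map_inj_uniq ?enum_uniq // => x y /addrI/oppr_inj/polyC_inj.
    move=> g; rewrite mem_monics; apply/fintype.imageP/andP => [[x _ ->]|[gm /eqP sg]].
      by rewrite monicXsubC size_XsubC.
    exists (- g`_0) => //; apply/polyP => -[|[|k]].
    - by rewrite coefB coefX coefC sub0r opprK.
    - rewrite coefB coefX coefC subr0.
      by have := monicP gm; rewrite lead_coefE sg.
    - by rewrite coefB coefX coefC subr0 nth_default ?sg.
  rewrite /lcoef -(perm_big _ perm1) big_map enumT; apply: eq_bigr => x _.
  by rewrite /lam /vals_chi /vals_prod; congr chi; apply: eq_bigr => a _; rewrite !hornerE.
rewrite c1 normc_opp.
have th0 : (0 : R) < b%:R ^+ 3 by rewrite exprn_gt0 // ltr0n ltnW // finNzRing_gt1.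
(* Power sums are controlled only in degrees 4 nu, which are the nu-th power sums of the fourth
   powers of the roots. *)
have root4 z : z \in r -> normc z ^+ 4 <= b%:R ^+ 3.
  move=> zr; rewrite -normcX.
  apply: (@power_sum_root_bound R [seq y ^+ 4 | y <- r]
    (2 * b * (size s).+1 + 8)%:R _ ((size s).+1 + 4)%N) => //; last first.
    exact: map_f.
  move=> n n_large; rewrite big_map -natrX -natrM -natrX -natrM.
  have chi_le1' x : `|chi x| <= 1 by rewrite (normc_le _ 1).
  have := vals_chi_lpsum s0 chi0 chi_le1' chi_sum card_gt2 n_large.
  rewrite -/lam Sr; last by rewrite muln_gt0; lia.
  rewrite normrN -(rmorph_nat (real_complex R)) normc_le.
  by rewrite (eq_bigr (fun y => (y ^+ 4) ^+ n)) => [|y _]; rewrite ?exprM.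
pose t : R := Num.sqrt (Num.sqrt (b%:R ^+ 3)).
have t0 : 0 <= t by exact: sqrtr_ge0.
have t4 : t ^+ 4 = b%:R ^+ 3.
  by rewrite -[4%N]/(2 * 2)%N exprM !sqr_sqrtr ?sqrtr_ge0 // ltW.
rewrite -t4 -exprMn lerXn2r ?nnegrE ?normc_ge0 ?mulr_ge0 //.
rewrite (eq_bigr id) => [|z _]; last exact: expr1.
apply: le_trans (normc_sum _ _ _) _.
rewrite -sr -sum1_size natr_sum mulr_suml big_seq [leRHS]big_seq.
apply: ler_sum => z zr; rewrite mul1r -(@ler_pXn2r _ 4%N) ?nnegrE ?normc_ge0 //.
by rewrite t4 root4.
Qed.

End WeilBound.

(** * Means over intervals and iterated van der Corput differencing *)

Definition mean (K : numFieldType) (N : nat) (f : nat -> K) : K :=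
  (\sum_(0 <= i < N) f i) / N%:R.

Definition periodic (T : Type) (q : nat) (f : nat -> T) :=
  forall n, f (n + q)%N = f n.

Section Periodic.
Variables (T : Type) (q : nat) (f : nat -> T).
Hypothesis fP : periodic q f.

Lemma periodicD n k : f (n + k * q)%N = f n.
Proof. by elim: k => [|k IH]; rewrite ?addn0 // mulSn addnCA addnC fP IH. Qed.

Lemma periodic_modn n : f (n %% q)%N = f n.
Proof. by rewrite [in RHS](divn_eq n q) addnC periodicD. Qed.

End Periodic.

Section Mean.
Variable K : numFieldType.
Implicit Types (f g : nat -> K).

Lemma eq_mean N f g : (forall i, (i < N)%N -> f i = g i) -> mean N f = mean N g.
Proof. by move=> fg; congr (_ / _); apply: eq_big_nat => i /andP[_ /fg]. Qed.

Lemma meanD N f g : mean N (fun i => f i + g i) = mean N f + mean N g.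
Proof. by rewrite /mean big_split mulrDl. Qed.

Lemma meanZ N (c : K) f : mean N (fun i => c * f i) = c * mean N f.
Proof. by rewrite /mean -mulr_sumr mulrA. Qed.

Lemma mean_cst N (c : K) : (0 < N)%N -> mean N (fun=> c) = c.
Proof.
move=> N0; rewrite /mean big_const_nat iter_addr_0 subn0 -[c *+ N]mulr_natr mulfK //.
by rewrite pnatr_eq0 -lt0n.
Qed.

Lemma mean_exchange M N (h : nat -> nat -> K) :
  mean M (fun i => mean N (h i)) = mean N (fun j => mean M (fun i => h i j)).
Proof.
rewrite /mean -!mulr_suml exchange_big /= mulrAC; congr (_ * _ * _).
Qed.

Lemma le_mean N f g : (forall i, (i < N)%N -> f i <= g i) -> mean N f <= mean N g.
Proof.
move=> fg; rewrite ler_wpM2r ?invr_ge0 // !big_nat.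
by apply: ler_sum => i /andP[_ /fg].
Qed.

Lemma mean_ge0 N f : (forall i, 0 <= f i) -> 0 <= mean N f.
Proof. by move=> f0; rewrite divr_ge0 // sumr_ge0. Qed.

Lemma mean_le N f (c : K) : (0 < N)%N -> (forall i, (i < N)%N -> f i <= c) -> mean N f <= c.
Proof. by move=> N0 fc; rewrite -[leRHS](mean_cst c N0) le_mean. Qed.

Lemma mean_mull_coprime q a f : (0 < q)%N -> periodic q f -> coprime a q ->
  mean q (fun i => f (i * a)%N) = mean q f.
Proof.
move=> q0 fP aq; congr (_ / _); rewrite !big_mkord.
pose s (i : 'I_q) := Ordinal (ltn_pmod (i * a) q0).
have s_inj : injective s.
  move=> i j /(congr1 val) /= E; apply: val_inj; move: E.
  wlog ij : i j / (i <= j)%N => [H|/esym/eqP].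
    by case/orP: (leq_total i j) => [/H//|/H{}H /esym/H].
  rewrite eqn_mod_dvd ?leq_mul2r ?ij ?orbT // -mulnBl Gauss_dvdl; last first.
    by rewrite coprime_sym.
  rewrite -eqn_mod_dvd // => /eqP; rewrite !modn_small //.
rewrite [RHS](reindex_inj s_inj); apply: eq_bigr => i _ /=.
by rewrite periodic_modn.
Qed.

Lemma mean_crt q1 q2 f1 f2 : (0 < q1)%N -> (0 < q2)%N -> coprime q1 q2 ->
  periodic q1 f1 -> periodic q2 f2 ->
  mean (q1 * q2) (fun i => f1 i * f2 i) = mean q1 f1 * mean q2 f2.
Proof.
move=> q10 q20 q12 f1P f2P; rewrite /mean natrM invfM mulrACA; congr (_ * _).
rewrite !big_mkord big_distrlr /= pair_bigA /=.
have q0 : (0 < q1 * q2)%N by rewrite muln_gt0 q10.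
pose s (i : 'I_(q1 * q2)) := (Ordinal (ltn_pmod i q10), Ordinal (ltn_pmod i q20)).
pose t (ij : 'I_q1 * 'I_q2) := Ordinal (ltn_pmod (chinese q1 q2 ij.1 ij.2) q0).
rewrite (reindex_onto s t) => [|[i j] _]; last first.
  congr (_, _); apply: val_inj => /=.
    by rewrite modn_dvdm ?dvdn_mulr // chinese_modl // modn_small.
  by rewrite modn_dvdm ?dvdn_mull // chinese_modr // modn_small.
apply: eq_big => [i|i _]; last by rewrite /= !periodic_modn.
apply/esym/eqP/val_inj => /=; rewrite -chinese_mod // modn_small //.
Qed.

End Mean.

Section CubeMean.
Variable R : rcfType.
Implicit Types (v : nat -> R[i]).
Local Notation C := R[i].

Lemma normc_mean N (f : nat -> C) : normc (mean N f) <= mean N (fun i => normc (f i)).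
Proof.
rewrite /mean ComplexField.Normc.normcM ComplexField.Normc.normcV normc_nat.
by rewrite ler_wpM2r ?invr_ge0 // normc_sum.
Qed.

Lemma mean_sqr_le N (f : nat -> R) : (0 < N)%N ->
  mean N f ^+ 2 <= mean N (fun i => f i ^+ 2).
Proof.
move=> N0; set c := mean N f.
have : 0 <= mean N (fun i => (f i - c) ^+ 2) by apply: mean_ge0 => i; exact: sqr_ge0.
have -> : mean N (fun i => (f i - c) ^+ 2) =
    mean N (fun i => f i ^+ 2) + (- c *+ 2) * c + c ^+ 2.
  rewrite -[in RHS](mean_cst (c ^+ 2) N0) -/c -{4}/(mean N f) -meanZ -!meanD.
  by apply: eq_mean => i _; ring.
by move=> H; rewrite -subr_ge0; apply: le_trans H _; rewrite le_eqVlt; apply/orP; left; apply/eqP; ring.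
Qed.

Lemma mean_exp2_le N (f : nat -> R) k : (0 < N)%N -> (forall i, 0 <= f i) ->
  mean N f ^+ (2 ^ k) <= mean N (fun i => f i ^+ (2 ^ k)).
Proof.
move=> N0 f0; elim: k => [|k IH].
  by rewrite expr1 (eq_mean (g := f)) // => i _; rewrite expr1.
rewrite expnSr exprM; apply: (@le_trans _ _ (mean N (fun i => f i ^+ (2 ^ k)) ^+ 2)).
  rewrite lerXn2r ?nnegrE ?exprn_ge0 ?mean_ge0 // => i; exact: exprn_ge0.
apply: le_trans (mean_sqr_le _ N0) _; rewrite le_mean // => i _.
by rewrite -exprM.
Qed.

(* A Gowers norm, without the last squaring. *)
Fixpoint cube_mean (q k : nat) v : R :=
  if k is j.+1 then
    mean q (fun h => mean q (fun h' => cube_mean q j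
      (fun n => v (n + h)%N * conjc (v (n + h')%N))))
  else normc (mean q v).

Lemma eq_cube_mean q k v v' : v =1 v' -> cube_mean q k v = cube_mean q k v'.
Proof.
elim: k v v' => [|k IH] v v' vv' /=; first by congr normc; apply: eq_mean.
by do 2!apply: eq_mean => ? _; apply: IH => n; rewrite !vv'.
Qed.

Lemma cube_mean_ge0 q k v : 0 <= cube_mean q k v.
Proof.
elim: k v => [|k IH] v /=; first exact: normc_ge0.
by do 2!apply: mean_ge0 => ?.
Qed.

Lemma periodic_diff q v h h' : periodic q v ->
  periodic q (fun n => v (n + h)%N * conjc (v (n + h')%N)).
Proof. by move=> vP n; rewrite !(addnAC n q) !vP. Qed.

Lemma cube_mean_periodic q k v : periodic q v ->
  (forall h', periodic q (fun h => cube_mean q k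
      (fun n => v (n + h)%N * conjc (v (n + h')%N)))) /\
  (forall h, periodic q (fun h' => cube_mean q k
      (fun n => v (n + h)%N * conjc (v (n + h')%N)))).
Proof.
by move=> vP; split=> ? ?; apply: eq_cube_mean => n; rewrite addnA vP.
Qed.

Lemma cube_mean_crt q1 q2 k v1 v2 : (0 < q1)%N -> (0 < q2)%N -> coprime q1 q2 ->
  periodic q1 v1 -> periodic q2 v2 ->
  cube_mean (q1 * q2) k (fun n => v1 n * v2 n) =
  cube_mean q1 k v1 * cube_mean q2 k v2.
Proof.
move=> q10 q20 q12; elim: k v1 v2 => [|k IH] v1 v2 v1P v2P /=.
  by rewrite mean_crt // ComplexField.Normc.normcM.
transitivity (mean (q1 * q2) (fun h =>
  mean q1 (fun h' => cube_mean q1 k (fun n => v1 (n + h)%N * conjc (v1 (n + h')%N))) *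
  mean q2 (fun h' => cube_mean q2 k (fun n => v2 (n + h)%N * conjc (v2 (n + h')%N))))).
  apply: eq_mean => h _; rewrite -mean_crt //; try exact: (cube_mean_periodic _ _).2.
  apply: eq_mean => h' _; rewrite -IH; try exact: periodic_diff.
  by apply: eq_cube_mean => n; rewrite rmorphM /=; ring.
rewrite mean_crt // => h; apply: eq_mean => h' _; exact: (cube_mean_periodic _ _).1.
Qed.

End CubeMean.

(** * Van der Corput differencing *)

Section VanDerCorput.
Variable R : rcfType.
Local Notation C := R[i].
Implicit Types (u v f g : nat -> C).

Lemma normc_prod (I : Type) (r : seq I) (f : I -> C) :
  normc (\prod_(i <- r) f i) = \prod_(i <- r) normc (f i).
Proof.
elim: r => [|i r IH]; first by rewrite !big_nil ComplexField.Normc.normc1.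
by rewrite !big_cons ComplexField.Normc.normcM IH.
Qed.

Lemma normc_conj (z : C) : normc (conjc z) = normc z.
Proof. by case: z => a b /=; rewrite sqrrN. Qed.

Lemma mean_shift_le N f s : (0 < N)%N -> (forall n, normc (f n) <= 1) ->
  normc (mean N f - mean N (fun n => f (n + s)%N)) <= 2 * s%:R / N%:R.
Proof.
move=> N0 f1; rewrite /mean -mulrBl ComplexField.Normc.normcM ComplexField.Normc.normcV.
rewrite normc_nat ler_wpM2r ?invr_ge0 //.
have E : \sum_(0 <= i < N) f i - \sum_(0 <= i < N) f (i + s)%N =
    \sum_(0 <= i < s) f i - \sum_(N <= i < N + s) f i.
  have -> : \sum_(0 <= i < N) f (i + s)%N = \sum_(s <= i < N + s) f i.
    by rewrite -{2}(add0n s) big_addn addnK.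
  apply/eqP; rewrite subr_eq addrAC -subr_eq opprK; apply/eqP.
  by rewrite -!big_cat_nat ?leq_addr ?leq_addl.
have bnd a c : normc (\sum_(a <= i < a + c) f i) <= c%:R.
  apply: le_trans (normc_sum _ _ _) _.
  apply: (@le_trans _ _ (\sum_(a <= i < a + c) 1)); first exact: ler_sum.
  by rewrite big_const_nat iter_addr_0 addKn.
rewrite E; apply: le_trans (normc_add _ _) _; rewrite normc_opp mulr_natl mulr2n.
by apply: lerD; [exact: (bnd 0%N) | exact: bnd].
Qed.

(** Shifts by h q leave u unchanged, so averaging over h < H pulls u out; Cauchy-Schwarz in n
    removes it, and expanding the square gives correlations of g. Shifting moves the mean by at most
    2 e, and (a + 2 e)^2 <= 2 a^2 + 8 e^2. *)
Lemma van_der_corput N H q u g : (0 < N)%N -> (0 < H)%N -> periodic q u ->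
  (forall n, normc (u n) <= 1) -> (forall n, normc (g n) <= 1) ->
  normc (mean N (fun n => u n * g n)) ^+ 2 <=
   2 * mean H (fun h => mean H (fun h' =>
     normc (mean N (fun n => g (n + h * q)%N * conjc (g (n + h' * q)%N)))))
   + 8 * (H%:R * q%:R / N%:R) ^+ 2.
Proof.
move=> N0 H0 uP u1 g1.
set Y := mean H _; set e := H%:R * q%:R / N%:R.
pose f n := u n * g n.
have f1 n : normc (f n) <= 1.
  by rewrite ComplexField.Normc.normcM mulr_ile1 ?normc_ge0.
pose S := mean H (fun h => mean N (fun n => f (n + h * q)%N)).
have e0 : 0 <= e by rewrite mulr_ge0 ?invr_ge0 ?mulr_ge0.
have close : normc (mean N f) <= normc S + 2 * e.
  rewrite -[mean N f](subrK S) [leRHS]addrC; apply: le_trans (normc_add _ _) _.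
  rewrite lerD2r -[mean N f](mean_cst _ H0) /S.
  have -> : mean H (fun=> mean N f) - mean H (fun h => mean N (fun n => f (n + h * q)%N))
    = mean H (fun h => mean N f - mean N (fun n => f (n + h * q)%N)).
    rewrite -[X in _ + X]mulN1r -meanZ -meanD; apply: eq_mean => h _.
    by rewrite mulN1r.
  apply: le_trans (normc_mean _ _) _; apply: mean_le => // h hH.
  apply: le_trans (mean_shift_le _ N0 f1) _.
  rewrite /e -mulrA ler_wpM2l // natrM ler_wpM2r ?invr_ge0 // ler_wpM2r //.
  by rewrite ler_nat ltnW.
have SY : normc S ^+ 2 <= Y.
  have -> : S = mean N (fun n => u n * mean H (fun h => g (n + h * q)%N)).
    rewrite /S mean_exchange; apply: eq_mean => n _; rewrite -meanZ.
    by apply: eq_mean => h _; rewrite /f periodicD.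
  apply: (@le_trans _ _ (mean N (fun n => normc (mean H (fun h => g (n + h * q)%N))) ^+ 2)).
    rewrite lerXn2r ?nnegrE ?normc_ge0 ?mean_ge0 // => [n|]; first exact: normc_ge0.
    apply: le_trans (normc_mean _ _) _; apply: le_mean => n _.
    by rewrite ComplexField.Normc.normcM ler_piMl ?normc_ge0.
  apply: le_trans (mean_sqr_le _ N0) _.
  have sqE (z : C) : (normc z ^+ 2)%:C%C = z * conjc z.
    by have := normCK z; rewrite normr_normc rmorphXn => ->.
  rewrite -lecR -[leLHS]ger0_norm; last first.
    by rewrite ler0c mean_ge0 // => n; rewrite sqr_ge0.
  have -> : (mean N (fun n => normc (mean H (fun h => g (n + h * q)%N)) ^+ 2))%:C%C =
    mean H (fun h => mean H (fun h' => mean N (fun n =>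
      g (n + h * q)%N * conjc (g (n + h' * q)%N)))).
    transitivity (mean N (fun n => mean H (fun h => mean H (fun h' =>
       g (n + h * q)%N * conjc (g (n + h' * q)%N))))); last first.
      rewrite mean_exchange; apply: eq_mean => h _; exact: mean_exchange.
    rewrite /mean rmorphM fmorphV rmorph_nat rmorph_sum; congr (_ / _).
    apply: eq_bigr => n _; apply: etrans (sqE _) _.
    rewrite rmorphM fmorphV rmorph_nat rmorph_sum.
    rewrite -!mulr_suml -big_distrlr /=.
    by ring.
  rewrite normr_normc lecR /Y; apply: le_trans (normc_mean _ _) _.
  by apply: le_mean => h _; exact: normc_mean.
apply: (@le_trans _ _ ((normc S + 2 * e) ^+ 2)).
  apply: lerXn2r; rewrite ?nnegrE ?normc_ge0 //.
  by apply: addr_ge0; [exact: normc_ge0 | exact: mulr_ge0].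
apply: (@le_trans _ _ (2 * normc S ^+ 2 + 8 * e ^+ 2)); last first.
  by rewrite lerD2r ler_wpM2l.
rewrite -subr_ge0 (_ : _ - _ = (normc S - 2 * e) ^+ 2) ?sqr_ge0 //; ring.
Qed.

Lemma exprD_le (x y : R) n : 0 <= x -> 0 <= y ->
  (x + y) ^+ n <= 2 ^+ n * (x ^+ n + y ^+ n).
Proof.
wlog xy : x y / x <= y => [H x0 y0|x0 y0].
  case: (leP x y) => [xy|/ltW yx]; first exact: H.
  by rewrite addrC [X in _ * X]addrC; exact: H.
apply: (@le_trans _ _ ((2 * y) ^+ n)).
  rewrite lerXn2r ?nnegrE ?addr_ge0 ?mulr_ge0 // mulr_natl mulr2n lerD2r //.
by rewrite exprMn ler_wpM2l ?exprn_ge0 // lerDr exprn_ge0.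
Qed.

(** Multiplication by [a] permutes the residues mod q, so shifts by multiples of [a] average like
    all shifts. This is where the coprimality of the blocks enters. *)
Lemma cube_mean_step q k a v : (0 < q)%N -> periodic q v -> coprime a q ->
  mean q (fun h => mean q (fun h' => cube_mean q k
     (fun n => v (n + h * a)%N * conjc (v (n + h' * a)%N)))) = cube_mean q k.+1 v.
Proof.
move=> q0 vP aq /=.
transitivity (mean q (fun h => mean q (fun h' => cube_mean q k
     (fun n => v (n + h * a)%N * conjc (v (n + h')%N))))).
  apply: eq_mean => h _.
  exact: (mean_mull_coprime q0 ((cube_mean_periodic k vP).2 (h * a)%N) aq).
apply: (mean_mull_coprime (f := fun h => mean q (fun h' => cube_mean q k
     (fun n => v (n + h)%N * conjc (v (n + h')%N)))) q0 _ aq) => h.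
by apply: eq_mean => h' _; exact: (cube_mean_periodic k vP).1.
Qed.

Lemma mean_addl q (f : nat -> C) n : (0 < q)%N -> periodic q f ->
  mean q (fun i => f (n + i)%N) = mean q f.
Proof.
move=> q0 fP; congr (_ / _); rewrite !big_mkord.
pose s (i : 'I_q) := Ordinal (ltn_pmod (n + i) q0).
have s_inj : injective s.
  move=> i j /(congr1 val) /= /eqP; rewrite eqn_modDl !modn_small //.
  by move=> /eqP /val_inj.
rewrite [RHS](reindex_inj s_inj); apply: eq_bigr => i _ /=.
by rewrite periodic_modn.
Qed.

Lemma mean_periodic_le q N v : (0 < q)%N -> (0 < N)%N -> periodic q v ->
  (forall n, normc (v n) <= 1) ->
  normc (mean N v) <= normc (mean q v) + 2 * q%:R / N%:R.
Proof.
move=> q0 N0 vP v1; have E : mean q v = mean q (fun h => mean N (fun n => v (n + h)%N)).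
  rewrite mean_exchange -[LHS](mean_cst _ N0); apply: eq_mean => n _.
  by rewrite mean_addl.
rewrite -[mean N v](subrK (mean q v)) [leRHS]addrC.
apply: le_trans (normc_add _ _) _; rewrite lerD2r {1}E -{1}[mean N v](mean_cst _ q0).
have -> : mean q (fun=> mean N v) - mean q (fun h => mean N (fun n => v (n + h)%N))
  = mean q (fun h => mean N v - mean N (fun n => v (n + h)%N)).
  rewrite -[X in _ + X]mulN1r -meanZ -meanD; apply: eq_mean => h _.
  by rewrite mulN1r.
apply: le_trans (normc_mean _ _) _; apply: mean_le => // h hH.
apply: le_trans (mean_shift_le _ N0 v1) _.
by rewrite -mulrA -[leRHS]mulrA ler_wpM2l // ler_wpM2r ?invr_ge0 // ler_nat ltnW.
Qed.

Lemma van_der_corput_iter k (qs : nat -> nat) (u : nat -> nat -> C) v q N (eps : R) :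
  (0 < q)%N -> (0 < N)%N -> periodic q v -> (forall n, normc (v n) <= 1) ->
  (forall i, (i < k)%N -> periodic (qs i) (u i)) ->
  (forall i, (i < k)%N -> forall n, normc (u i n) <= 1) ->
  (forall i, (i < k)%N -> coprime (qs i) q) ->
  0 <= eps <= 1 -> 2 * q%:R / N%:R <= eps ->
  (forall i, (i < k)%N -> 8 * (q%:R * (qs i)%:R / N%:R) ^+ 2 <= eps) ->
  normc (mean N (fun n => (\prod_(i < k) u i n) * v n)) ^+ (2 ^ k) <=
    8 ^+ (2 ^ k) * (cube_mean q k v + eps).
Proof.
move=> q0 N0 + + + + + /andP[eps0 eps1] qN.
elim: k u v => [|k IH] u v vP v1 uP u1 qq small /=.
  rewrite expr1 (eq_mean (g := v)) => [|n _]; last by rewrite big_ord0 mul1r.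
  apply: le_trans (mean_periodic_le q0 N0 vP v1) _.
  rewrite expr1 -[leLHS]mul1r; apply: ler_pM; rewrite ?ler1n ?lerD2l //.
  by rewrite addr_ge0 ?normc_ge0 // !mulr_ge0 ?invr_ge0.
pose g n := (\prod_(i < k) u i n) * v n.
have g1 n : normc (g n) <= 1.
  rewrite ComplexField.Normc.normcM normc_prod mulr_ile1 ?normc_ge0 //.
    by apply: prodr_ge0 => i _; exact: normc_ge0.
  apply: prodr_ile1 => i _.
  rewrite normc_ge0 u1 //; exact: ltn_trans (ltn_ord i) (ltnSn k).
pose X h h' := normc (mean N (fun n => g (n + h * qs k)%N * conjc (g (n + h' * qs k)%N))).
pose W h h' := cube_mean q k (fun n => v (n + h * qs k)%N * conjc (v (n + h' * qs k)%N)).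
have IHX h h' : X h h' ^+ (2 ^ k) <= 8 ^+ (2 ^ k) * (W h h' + eps).
  pose u' i n := u i (n + h * qs k)%N * conjc (u i (n + h' * qs k)%N).
  pose v' n := v (n + h * qs k)%N * conjc (v (n + h' * qs k)%N).
  have -> : X h h' = normc (mean N (fun n => (\prod_(i < k) u' i n) * v' n)).
    congr normc; apply: eq_mean => n _.
    by rewrite /u' big_split /g /v' rmorphM rmorph_prod /=; ring.
  apply: IH => [|n|i ik|i ik n|i ik|i ik].
  - exact: periodic_diff.
  - by rewrite ComplexField.Normc.normcM normc_conj mulr_ile1 ?normc_ge0.
  - by apply: periodic_diff; apply: uP; exact: ltnW.
  - by rewrite ComplexField.Normc.normcM normc_conj mulr_ile1 ?normc_ge0 // u1 // ltnW.
  - by apply: qq; exact: ltnW.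
  - by apply: small; exact: ltnW.
have X0 h h' : 0 <= X h h' by exact: normc_ge0.
set Y := mean q (fun h => mean q (X h)).
have Y0 : 0 <= Y by do 2!apply: mean_ge0 => ?.
have -> : mean N (fun n => (\prod_(i < k.+1) u i n) * v n) =
          mean N (fun n => u k n * g n).
  by apply: eq_mean => n _; rewrite big_ord_recr /= /g; ring.
(* [H] is taken to be q, the period of v, so that h and h' run over complete residue systems and the
   averages are those of [cube_mean]. *)
have step := van_der_corput N0 q0 (uP k (ltnSn k)) (u1 k (ltnSn k)) g1.
have {}step : normc (mean N (fun n => u k n * g n)) ^+ 2 <= 2 * Y + eps.
  by apply: le_trans step _; rewrite lerD2l small.
rewrite expnS exprM.
apply: (@le_trans _ _ ((2 * Y + eps) ^+ (2 ^ k))).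
  apply: lerXn2r => //; rewrite nnegrE.
    by apply: exprn_ge0; exact: normc_ge0.
  by apply: addr_ge0 => //; exact: mulr_ge0.
apply: le_trans (exprD_le _ _ _) _ => //; first by rewrite mulr_ge0.
set K := (2 ^ k)%N.
have Kk : (0 < K)%N by rewrite expn_gt0.
have YK : Y ^+ K <= 8 ^+ K * (cube_mean q k.+1 v + eps).
  apply: le_trans (mean_exp2_le _ q0 _) _.
    by move=> h; apply: mean_ge0.
  rewrite -(cube_mean_step _ q0 vP (qq k (ltnSn k))).
  rewrite -[X in _ + X](mean_cst _ q0) -meanD -meanZ; apply: le_mean => h _.
  apply: le_trans (mean_exp2_le _ q0 _) _; first by move=> h'; exact: X0.
  rewrite -[X in _ + X](mean_cst _ q0) -meanD -meanZ; apply: le_mean => h' _.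
  exact: IHX.
have epsK : eps ^+ K <= eps by rewrite -[leRHS]expr1 ler_wiXn2l.
set T := cube_mean q k.+1 v + eps in YK *.
have T0 : eps <= T by rewrite lerDr cube_mean_ge0.
(* The constant reproduces itself: 2^K (2^K 8^K + 1) = 32^K + 2^K is at most twice 32^K, hence at
   most 64^K = 8^(2K). *)
rewrite exprMn.
apply: (@le_trans _ _ (2 ^+ K * (2 ^+ K * (8 ^+ K * T) + T))).
  rewrite ler_wpM2l ?exprn_ge0 // lerD ?ler_wpM2l ?exprn_ge0 //.
  exact: le_trans T0.
have T0' : 0 <= T by exact: le_trans T0.
have -> : 2 ^+ K * (2 ^+ K * (8 ^+ K * T) + T) = (32 ^+ K + 2 ^+ K) * T.
  by rewrite (_ : 32 = 2 * 2 * 8 :> R) ?exprMn; ring.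
apply: ler_wpM2r => //.
rewrite exprM (_ : 8 ^+ 2 = 2 * 32 :> R); last by ring.
rewrite exprMn; apply: (@le_trans _ _ (2 * 32 ^+ K)).
  rewrite (_ : 2 * 32 ^+ K = 32 ^+ K + 32 ^+ K); last by ring.
  rewrite lerD2l; apply: lerXn2r; rewrite ?nnegrE ?ler0n ?ler_nat //.
by apply: ler_wpM2r; rewrite ?exprn_ge0 // -[leLHS]expr1 ler_weXn2l // ler1n.
Qed.

End VanDerCorput.

(** * Cube averages of a character modulo a prime *)

Lemma sum_Fp (V : nmodType) p (f : 'F_p -> V) : prime p ->
  \sum_(0 <= i < p) f i%:R = \sum_x f x.
Proof.
move=> p_pr; rewrite -[X in \sum_(_ <= _ < X) _](Fp_cast p_pr) big_mkord.
by apply: eq_bigr => i _; rewrite natr_Zp.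
Qed.

Section PrimeCube.
Variables (R : realType) (p : nat) (chi : 'F_p -> R[i]).
Hypothesis p_pr : prime p.
Hypothesis chi0 : chi 0 = 0.
Hypothesis chi1 : chi 1 = 1.
Hypothesis chiM : {morph chi : x y / x * y}.
Hypothesis chi_unit : forall x, x != 0 -> normc (chi x) = 1.
Hypothesis chi_sum : \sum_x chi x = 0.

Let beta : R := Num.sqrt (Num.sqrt p%:R^-1).

Let p0 : (0 : R) < p%:R. Proof. by rewrite ltr0n prime_gt0. Qed.

Let beta0 : 0 <= beta. Proof. exact: sqrtr_ge0. Qed.

Let beta4 : beta ^+ 4 = p%:R^-1.
Proof. by rewrite -[4%N]/(2 * 2)%N exprM !sqr_sqrtr ?sqrtr_ge0 // invr_ge0 ltW. Qed.

Let inv_beta : p%:R^-1 <= beta.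
Proof.
rewrite -beta4 -[leRHS]expr1 ler_wiXn2l //.
rewrite -(@ler_pXn2r _ 4) ?nnegrE // expr1n beta4 invf_le1 // ler1n prime_gt0 //.
Qed.

Let chi_le1 x : normc (chi x) <= 1.
Proof.
by have [->|/chi_unit->] := eqVneq x 0; rewrite ?chi0 ?ComplexField.Normc.normc0.
Qed.

Let p_gt2 : (2 < p)%N.
Proof.
rewrite ltn_neqAle prime_gt1 // andbT; apply/eqP => p2.
have := sum_Fp chi p_pr; rewrite chi_sum -[X in \sum_(0 <= _ < X) _]p2 big_nat_recr //= big_nat1 chi0 chi1.
by rewrite add0r => /eqP; rewrite oner_eq0.
Qed.

(** On nonzero x, chi has modulus 1 and x^(p-2) is the inverse; at 0 both sides vanish because p >
    2. A product of values of chi and of conjugates thus becomes a single chi(f(x)). *)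
Let chi_conj x : conjc (chi x) = chi (x ^+ (p - 2)).
Proof.
have [->|x0] := eqVneq x 0.
  by rewrite expr0n subn_eq0 leqNgt p_gt2 chi0 conjc0.
have cx0 : chi x != 0 by rewrite -normc_eq0 chi_unit // oner_eq0.
apply: (mulfI cx0); rewrite -chiM -exprS.
have -> : x ^+ (p - 2).+1 = 1.
  apply: (mulfI x0); rewrite -exprS mulr1 (_ : (p - 2).+2 = p); last lia.
  by have := expf_card x; rewrite card_Fp.
rewrite chi1; have := normCK (chi x); rewrite normr_normc chi_unit //.
by rewrite rmorph1 expr1n => <-.
Qed.

(** The boolean is false for a conjugated factor. All iterated differences of chi have this form. *)
Definition shift_prod (l : seq ('F_p * bool)) (n : nat) : R[i] :=
  \prod_(x <- l) (if x.2 then chi (n%:R + x.1) else conjc (chi (n%:R + x.1))).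

Lemma shift_prod_le1 l n : normc (shift_prod l n) <= 1.
Proof.
rewrite /shift_prod normc_prod; apply: prodr_ile1 => x _.
by case: ifP; rewrite ?normc_conj normc_ge0 chi_le1.
Qed.

Lemma cube_mean_le1 q k (v : nat -> R[i]) : (0 < q)%N ->
  (forall n, normc (v n) <= 1) -> cube_mean q k v <= 1.
Proof.
move=> q0; elim: k v => [|k IH] v v1 /=.
  by apply: le_trans (normc_mean _ _) _; apply: mean_le.
do 2!(apply: mean_le => // ? _); apply: IH => n.
by rewrite ComplexField.Normc.normcM normc_conj mulr_ile1 ?normc_ge0.
Qed.

(** The substitution n = - a - y moves the isolated shift [a] to a simple root at 0. Conjugated
    factors become roots repeated p - 2 times, but only distinct roots count in [weil_bound]. *)
Lemma shift_prod_mean a l : a \notin [seq x.1 | x <- l] ->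
  normc (mean p (shift_prod ((a, true) :: l))) <= (size l)%:R * beta.
Proof.
move=> al; pose e (c : bool) := if c then 1%N else (p - 2)%N.
pose s := flatten [seq nseq (e x.2) (x.1 - a) | x <- l].
have s_l c : c \in s -> c \in [seq x.1 - a | x <- l].
  case/flattenP => _ /mapP[x xl ->]; rewrite mem_nseq => /andP[_ /eqP ->].
  exact: map_f.
have s0 : 0 \notin s.
  apply/negP => /s_l /mapP[x xl /esym/eqP]; rewrite subr_eq0 => /eqP xa.
  by case/negP: al; rewrite -xa map_f.
have su : (size (undup s) <= size l)%N.
  rewrite -(size_map (fun x => x.1 - a) l); apply: uniq_leq_size; first exact: undup_uniq.
  by move=> c; rewrite mem_undup; exact: s_l.
have := weil_bound s0 chi0 chi1 chiM chi_le1 chi_sum.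
have -> : \sum_x chi (\prod_(c <- 0 :: s) (c - x)) = \sum_(0 <= n < p) shift_prod ((a, true) :: l) n.
  rewrite (sum_Fp (fun y => \prod_(x <- (a, true) :: l)
    (if x.2 then chi (y + x.1) else conjc (chi (y + x.1)))) p_pr).
  pose h (y : 'F_p) := - a - y.
  have h_inj : injective h by move=> y z /addrI/oppr_inj.
  rewrite [RHS](reindex_inj h_inj); apply: eq_bigr => y _.
  rewrite !big_cons chiM /= (_ : h y + a = 0 - y); last by rewrite /h; ring.
  congr (_ * _); rewrite /s; elim: (l) => [|[c t] l' IH] /=.
    by rewrite !big_nil chi1.
  rewrite big_cat big_cons /= chiM IH; congr (_ * _).
  rewrite big_nseq iter_mulr_1 (_ : h y + c = c - a - y); last by rewrite /h; ring.
  by case: t => //=; rewrite chi_conj.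
move=> H; rewrite /mean ComplexField.Normc.normcM ComplexField.Normc.normcV normc_nat.
rewrite ler_pdivrMr // -(@ler_pXn2r _ 4) ?nnegrE ?normc_ge0 ?mulr_ge0 ?ler0n //.
apply: le_trans H _; rewrite card_Fp // !exprMn beta4.
rewrite -mulrA ler_pM ?exprn_ge0 //.
  by apply: lerXn2r; rewrite ?nnegrE ?ler_nat.
by rewrite -[4%N]/(1 + 3)%N exprD expr1 mulrA mulVf ?mul1r // gt_eqF.
Qed.

(** A difference replaces [L], of size M, by its shift by h without the pivot, and its conjugated
    shift by h', next to the pivot a + h. The pivot stays isolated unless h' takes one of at most M
    values, a proportion of at most M p^(-1/4), where the trivial bound 1 is used. The constants
    obey C_(k+1) = 2 C_k + 1, hence 2^(k+1) - 1. *)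
Lemma cube_mean_shift_prod k a l : a \notin [seq x.1 | x <- l] ->
  cube_mean p k (shift_prod ((a, true) :: l)) <=
    (2 ^+ k.+1 - 1) * (size l).+1%:R * beta.
Proof.
elim: k a l => [|k IH] a l al.
  apply: le_trans (shift_prod_mean al) _.
  rewrite expr1 (_ : 2 - 1 = 1); last by ring.
  by rewrite mul1r ler_wpM2r // ler_nat.
set M := (size l).+1; pose L := (a, true) :: l.
have p0' := prime_gt0 p_pr.
pose hit (h h' : nat) (x : 'F_p * bool) := h'%:R == a + h%:R - x.1 :> 'F_p.
pose c := (2 ^+ k.+1 - 1) * (2 * M)%:R * beta.
have c0 : 0 <= c.
  by rewrite !mulr_ge0 // subr_ge0 exprn_ege1 // ler1n.
apply: mean_le => // h _.
apply: (@le_trans _ _ (mean p (fun h' =>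
   \sum_(x <- L) (hit h h' x)%:R + c))).
  apply: le_mean => h' _.
  have [bad|good] := boolP (has (hit h h') L).
    apply: (@le_trans _ _ 1); last first.
      rewrite -natr_sum -[leLHS]addr0 lerD // ler1n.
      have -> : (\sum_(x <- L) (hit h h' x) =
                 count (hit h h') L)%N.
        by rewrite -sum1_count [RHS]big_mkcond; apply: eq_bigr => x _; case: (hit h h' x).
      by rewrite -has_count.
    apply: cube_mean_le1 => // n.
    by rewrite ComplexField.Normc.normcM normc_conj mulr_ile1 ?normc_ge0 ?shift_prod_le1.
  rewrite -[leLHS]add0r lerD ?sumr_ge0 //.
  pose l2 := [seq (x.1 + h%:R, x.2) | x <- l] ++ [seq (x.1 + h'%:R, ~~ x.2) | x <- L].
  have E : cube_mean p k (fun n => shift_prod L (n + h)%N *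
      conjc (shift_prod L (n + h')%N)) = cube_mean p k (shift_prod ((a + h%:R, true) :: l2)).
    apply: eq_cube_mean => n.
    rewrite /shift_prod -cat_cons big_cat; congr (_ * _).
      rewrite !big_cons big_map /=; congr (_ * _).
        by rewrite natrD; congr chi; ring.
      apply: eq_bigr => x _ /=; rewrite natrD (_ : n%:R + h%:R + x.1 = n%:R + (x.1 + h%:R)) //.
      by ring.
    rewrite rmorph_prod [RHS]big_map; apply: eq_bigr => x _ /=.
    rewrite natrD (_ : n%:R + h'%:R + x.1 = n%:R + (x.1 + h'%:R)); last by ring.
    by case: x.2; rewrite //= conjcK.
  apply: (@le_trans _ _ (cube_mean p k (shift_prod ((a + h%:R, true) :: l2)))).
    by rewrite -E.
  have sl2 : (size l2).+1 = (2 * M)%N by rewrite size_cat !size_map /M /L /=; lia.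
  rewrite /c -sl2; apply: IH; rewrite map_cat mem_cat negb_or; apply/andP; split.
    apply/negP => /mapP[_ /mapP[x xl ->] /= /addIr xa].
    by case/negP: al; rewrite xa map_f.
  apply/negP => /mapP[_ /mapP[x xl ->] /= xa].
  by case/hasP: good; exists x; rewrite // /hit xa addrC addKr.
rewrite meanD mean_cst //.
have -> : mean p (fun h' => \sum_(x <- L) (hit h h' x)%:R) = M%:R / p%:R :> R.
  rewrite /mean; congr (_ / _); rewrite exchange_big /=.
  transitivity (\sum_(x <- L) (1 : R)); last first.
    by rewrite big_const_seq count_predT iter_addr_0.
  apply: eq_bigr => x _.
  rewrite (sum_Fp (fun y => (y == a + h%:R - x.1)%:R : R) p_pr).
  rewrite (bigD1 (a + h%:R - x.1)) //= eqxx big1 ?addr0 // => y /negPf ->.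
  by [].
apply: (@le_trans _ _ (M%:R * beta + c)).
  by rewrite lerD2r ler_wpM2l.
rewrite /c natrM [2 ^+ k.+2]exprS le_eqVlt; apply/orP; left; apply/eqP; ring.
Qed.

Lemma cube_mean_prime k :
  cube_mean p k (fun n => chi n%:R) <= 2 ^+ k.+1 * Num.sqrt (Num.sqrt p%:R^-1).
Proof.
rewrite (eq_cube_mean _ _ (v' := shift_prod [:: (0, true)])) => [|n]; last first.
  by rewrite /shift_prod big_seq1 addr0.
apply: le_trans (cube_mean_shift_prod _ _) _ => //.
by rewrite mulr1 ler_wpM2r // gerBl.
Qed.

End PrimeCube.

(** * Dirichlet characters *)

Section DirichletCharacters.
Variable R : realType.
Local Notation C := R[i].
Implicit Types (chi psi : nat -> C) (e Q : nat).

Lemma dirichlet_periodic Q chi : dirichlet_character Q chi -> periodic Q chi.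
Proof. by case=> chiP _ _ _ n; apply: chiP; rewrite modnDr. Qed.

Lemma dirichlet_exp Q chi n k : dirichlet_character Q chi -> chi (n ^ k)%N = chi n ^+ k.
Proof.
case=> _ chiM chi1 _; elim: k => [|k IH]; first by rewrite expr0.
by rewrite expnS chiM IH exprS.
Qed.

Lemma dirichlet_norm1 Q chi n : (0 < Q)%N -> dirichlet_character Q chi ->
  coprime n Q -> normc (chi n) = 1.
Proof.
move=> Q0 dchi nQ; have [chiP chiM chi1 _] := dchi.
have := dirichlet_exp n (totient Q) dchi.
rewrite (chiP _ 1%N (Euler_exp_totient nQ)) chi1 => /(congr1 (fun z => normc z)).
rewrite normcX ComplexField.Normc.normc1 => /esym/eqP.
by rewrite pexpr_eq1 ?normc_ge0 ?totient_gt0 // => /eqP.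
Qed.

Lemma dirichlet_eq0 Q chi n : dirichlet_character Q chi -> ~~ coprime n Q -> chi n = 0.
Proof. by case=> _ _ _ chiE; rewrite -chiE negbK => /eqP. Qed.

Lemma dirichlet_le1 Q chi n : (0 < Q)%N -> dirichlet_character Q chi ->
  normc (chi n) <= 1.
Proof.
move=> Q0 dchi; have [nQ|nQ] := boolP (coprime n Q).
  by rewrite (dirichlet_norm1 Q0 dchi).
by rewrite (dirichlet_eq0 dchi) // ComplexField.Normc.normc0.
Qed.

Lemma dirichlet_split e1 e2 chi : (0 < e1)%N -> (0 < e2)%N -> coprime e1 e2 ->
  dirichlet_character (e1 * e2) chi ->
  exists chi1 chi2, [/\ dirichlet_character e1 chi1, dirichlet_character e2 chi2 &
    forall n, chi n = chi1 n * chi2 n].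
Proof.
move=> e10 e20 co [chiP chiM chi1 chiE].
have eqP12 m n : m = n %[mod e1] -> m = n %[mod e2] -> chi m = chi n.
  move=> mn1 mn2; apply: chiP; apply/eqP.
  by rewrite chinese_remainder // mn1 mn2 !eqxx.
have c1 a c : chinese e1 e2 a c = a %[mod e1] by exact: chinese_modl.
have c2 a c : chinese e1 e2 a c = c %[mod e2] by exact: chinese_modr.
have cop a c : coprime (chinese e1 e2 a c) (e1 * e2) = coprime a e1 && coprime c e2.
  by rewrite coprimeMr -coprime_modl c1 coprime_modl -[X in _ && X]coprime_modl c2 coprime_modl.
(* In the Chinese remainder theorem, the other coordinate is frozen at 1. *)
exists (fun n => chi (chinese e1 e2 n 1)), (fun n => chi (chinese e1 e2 1 n)); split.
- split=> [m n mn|m n||n].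
  + by apply: eqP12; rewrite ?c1 ?c2.
  + rewrite -chiM; apply: eqP12; first by rewrite c1 -[RHS]modnMm !c1 modnMm.
    by rewrite c2 -[RHS]modnMm !c2 modnMm.
  + by rewrite -chi1; apply: eqP12; rewrite ?c1 ?c2.
  + by rewrite chiE cop coprime1n andbT.
- split=> [m n mn|m n||n].
  + by apply: eqP12; rewrite ?c1 ?c2.
  + rewrite -chiM; apply: eqP12; last by rewrite c2 -[RHS]modnMm !c2 modnMm.
    by rewrite c1 -[RHS]modnMm !c1 modnMm.
  + by rewrite -chi1; apply: eqP12; rewrite ?c1 ?c2.
  + by rewrite chiE cop coprime1n.
move=> n; rewrite -chiM; apply: eqP12.
  by rewrite -[RHS]modnMm !c1 modnMm muln1.
by rewrite -[RHS]modnMm !c2 modnMm mul1n.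
Qed.

Lemma dirichlet_mul e1 e2 chi1 chi2 : dirichlet_character e1 chi1 ->
  dirichlet_character e2 chi2 ->
  dirichlet_character (e1 * e2) (fun n => chi1 n * chi2 n).
Proof.
move=> [P1 M1 one1 E1] [P2 M2 one2 E2]; split=> [m n mn|m n||n].
- congr (_ * _); [apply: P1 | apply: P2].
    by rewrite -(modn_dvdm m (dvdn_mulr e2 (dvdnn e1))) mn modn_dvdm ?dvdn_mulr.
  by rewrite -(modn_dvdm m (dvdn_mull e1 (dvdnn e2))) mn modn_dvdm ?dvdn_mull.
- by rewrite M1 M2; ring.
- by rewrite one1 one2 mulr1.
- by rewrite mulf_eq0 negb_or E1 E2 coprimeMr.
Qed.

Lemma dirichlet_trivial : dirichlet_character 1 (fun=> 1 : C).
Proof. by split=> // [m n|n]; rewrite ?mulr1 // oner_eq0 coprimen1. Qed.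

Lemma dirichlet_prod (es : seq nat) (c : nat -> nat -> C) :
  (forall e, e \in es -> dirichlet_character e (c e)) ->
  dirichlet_character (\prod_(e <- es) e)%N (fun n => \prod_(e <- es) c e n).
Proof.
elim: es => [|e es IH] ces.
  rewrite big_nil (_ : (fun _ => _) = fun=> 1 : C); first exact: dirichlet_trivial.
  by apply/funext => n; rewrite big_nil.
rewrite big_cons (_ : (fun _ => _) = fun n => c e n * \prod_(e <- es) c e n).
  apply: dirichlet_mul; first by apply: ces; rewrite inE eqxx.
  by apply: IH => e' e'es; apply: ces; rewrite inE e'es orbT.
by apply/funext => n; rewrite big_cons.
Qed.

Lemma dirichlet_decompose (es : seq nat) chi : uniq es -> pairwise coprime es ->
  all (leq 1) es -> dirichlet_character (\prod_(e <- es) e)%N chi ->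
  exists c : nat -> nat -> C,
    (forall e, e \in es -> dirichlet_character e (c e)) /\
    (forall n, chi n = \prod_(e <- es) c e n).
Proof.
elim: es chi => [|e es IH] chi /=.
  rewrite big_nil => _ _ _ [chiP _ chi1 _]; exists (fun _ _ => 1); split=> // n.
  by rewrite big_nil -chi1; apply: chiP; rewrite !modn1.
case/andP=> ees esu /andP[co esco] /andP[e0 es0].
have pes : coprime e (\prod_(e <- es) e)%N.
  rewrite big_seq; elim/big_ind: _ => [|x y cx cy|e' e'es]; first exact: coprimen1.
    by rewrite coprimeMr cx.
  exact: (allP co).
have p0 : (0 < \prod_(e <- es) e)%N by rewrite big_seq prodn_cond_gt0 // => e' /(allP es0).
rewrite big_cons => dchi; have [chi1 [chi2 [d1 d2 chiE]]] := dirichlet_split e0 p0 pes dchi.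
have [c [cd cE]] := IH chi2 esu esco es0 d2.
exists (fun e' => if e' == e then chi1 else c e'); split=> [e'|n].
  by rewrite inE; case: eqVneq => [-> //|_ /=]; exact: cd.
rewrite big_cons eqxx chiE cE; congr (_ * _); apply: eq_big_seq => e' e'es.
by case: eqVneq => // ee; rewrite -ee e'es in ees.
Qed.

(** Were chi1 trivial on the units mod p, chi would agree with chi2 on all n coprime to Q and be
    induced from the modulus e < Q. *)
Lemma primitive_prime_factor Q chi p e (chi1 chi2 : nat -> C) :
  primitive_character Q chi -> (1 < p)%N -> Q = (p * e)%N -> (0 < Q)%N ->
  dirichlet_character p chi1 -> dirichlet_character e chi2 ->
  (forall n, chi n = chi1 n * chi2 n) ->
  exists2 n, coprime n p & chi1 n != 1.
Proof.
move=> [dchi prim] p1 QE Q0 d1 d2 chiE.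
have [//|H] := pselect (exists2 n, coprime n p & chi1 n != 1).
have eQ : (e < Q)%N by move: Q0; rewrite QE; nia.
have dvd : (e %| Q)%N by rewrite QE dvdn_mull.
case: (prim e chi2 dvd eQ d2) => n; rewrite QE coprimeMr => /andP[np ne].
rewrite chiE; suff -> : chi1 n = 1 by rewrite mul1r.
by apply/eqP; case: eqVneq => // n1; case: H; exists n.
Qed.

Lemma cube_mean_dirichlet_prime p chi k : prime p -> dirichlet_character p chi ->
  (exists2 n, coprime n p & chi n != 1) ->
  cube_mean p k chi <= 2 ^+ k.+1 * Num.sqrt (Num.sqrt p%:R^-1).
Proof.
move=> p_pr dchi [n0 n0p n01]; have [chiP chiM chi1 chiE] := dchi.
have p0 := prime_gt0 p_pr.
pose f (x : 'F_p) : C := chi (x : nat).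
have fnat n : f n%:R = chi n by apply: chiP; rewrite val_Fp_nat // modn_mod.
have coF (x : 'F_p) : coprime x p = (x != 0).
  rewrite coprime_sym prime_coprime // /dvdn modn_small //.
  by rewrite -[X in (_ < X)%N](Fp_cast p_pr) ltn_ord.
have f0 : f 0 = 0.
  apply: (dirichlet_eq0 dchi); by rewrite coF eqxx.
have f1 : f 1 = 1 by rewrite -chi1 -fnat.
have fM : {morph f : x y / x * y}.
  move=> x y; rewrite /f -chiM; apply: chiP.
  have -> : ((x * y)%R : nat) = (x * y %% p)%N.
    by rewrite -[X in (_ %% X)%N](Fp_cast p_pr).
  by rewrite modn_mod.
have f_unit x : x != 0 -> normc (f x) = 1.
  by rewrite -coF; exact: dirichlet_norm1.
have f_sum : \sum_x f x = 0.
  have n00 : (n0%:R : 'F_p) != 0.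
    rewrite -coF val_Fp_nat // coprime_modl //.
  apply/eqP; have : \sum_x f x = f n0%:R * \sum_x f x.
    rewrite mulr_sumr (reindex_inj (mulfI n00)).
    by apply: eq_bigr => x _; rewrite fM.
  rewrite fnat => /eqP; rewrite -subr_eq0 -{1}[\sum_x _]mul1r -mulrBl mulf_eq0.
  by rewrite subr_eq0 eq_sym (negPf n01).
have := cube_mean_prime p_pr f0 f1 fM f_unit f_sum k.
by rewrite (eq_cube_mean _ _ (v' := chi)).
Qed.

Lemma cube_mean_prod (ps : seq nat) (c : nat -> nat -> C) k :
  uniq ps -> all prime ps -> (forall p, p \in ps -> periodic p (c p)) ->
  cube_mean (\prod_(p <- ps) p)%N k (fun n => \prod_(p <- ps) c p n) =
  \prod_(p <- ps) cube_mean p k (c p).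
Proof.
elim: ps => [|p ps IH] /=.
  move=> _ _ _; rewrite !big_nil (eq_cube_mean _ _ (v' := fun=> 1)) => [|n]; last by rewrite big_nil.
  elim: k => [|k IHk] /=.
    by rewrite /mean big_nat1 invr1 mulr1 ComplexField.Normc.normc1.
  rewrite /mean !big_nat1 !invr1 !mulr1 -[RHS]IHk; apply: eq_cube_mean => n.
  by rewrite mul1r; exact: conjc1.
case/andP=> pps psu /andP[p_pr ps_pr] cP; rewrite !big_cons.
have ps0 : (0 < \prod_(p <- ps) p)%N.
  by rewrite big_seq prodn_cond_gt0 // => p' /(allP ps_pr)/prime_gt0.
rewrite (eq_cube_mean _ _ (v' := fun n => c p n * \prod_(p <- ps) c p n)) => [|n]; last first.
  by rewrite big_cons.
have cP' p' : p' \in ps -> periodic p' (c p').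
  by move=> p'ps; apply: cP; rewrite inE p'ps orbT.
have co : coprime p (\prod_(p <- ps) p)%N.
  rewrite big_seq; elim/big_ind: _ => [|x y cx cy|p' p'ps]; first exact: coprimen1.
    by rewrite coprimeMr cx.
  rewrite prime_coprime // dvdn_prime2 ?(allP ps_pr _ p'ps) //.
  by apply: contraNneq pps => ->.
have per : periodic (\prod_(p <- ps) p)%N (fun n => \prod_(p <- ps) c p n).
  move=> n; apply: eq_big_seq => e eps.
  have /dvdnP[j ->] : (e %| \prod_(p <- ps) p)%N by rewrite (big_rem e) //= dvdn_mulr.
  exact: (periodicD (cP' e eps)).
have cPp : periodic p (c p) by apply: cP; rewrite inE eqxx.
apply: etrans (cube_mean_crt k (prime_gt0 p_pr) ps0 co cPp per) _.
by rewrite IH.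
Qed.

End DirichletCharacters.

(** Primes join an open block [rest] of product below Z, which is closed as soon as its product
    reaches Z; the last prime overshoots by a factor below P at worst equal to it. *)
Lemma greedy_blocks (P Z : nat) (ps : seq nat) : (1 < Z)%N ->
  {in ps, forall p, (0 < p <= P)%N} ->
  exists gs rest, [/\ perm_eq ps (flatten gs ++ rest),
    {in gs, forall g, (Z <= \prod_(p <- g) p < Z * P)%N} &
    (\prod_(p <- rest) p < Z)%N].
Proof.
move=> Z1; elim: ps => [|p ps IH] psP.
  by exists [::], [::]; split; rewrite ?big_nil.
have [|gs [rest [perm gsZ restZ]]] := IH.
  by move=> p' p'ps; apply: psP; rewrite inE p'ps orbT.
have /andP[p0 pP] : (0 < p <= P)%N by apply: psP; rewrite inE eqxx.
have perm' : perm_eq (p :: ps) ((p :: rest) ++ flatten gs).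
  by rewrite /= perm_cons (permPl perm) perm_catC.
have [big|small] := leqP Z (p * \prod_(p <- rest) p).
  exists ((p :: rest) :: gs), [::]; rewrite cats0 big_nil; split => //.
  move=> g; rewrite inE => /orP[/eqP ->|]; last exact: gsZ.
  rewrite big_cons big /= mulnC.
  apply: (@leq_ltn_trans (\prod_(p <- rest) p * P)); first by rewrite leq_mul2l pP orbT.
  by rewrite ltn_mul2r restZ andbT; apply: leq_trans pP.
exists gs, (p :: rest); rewrite big_cons; split => //.
by apply: perm_trans perm' _; rewrite perm_catC.
Qed.

(** * Cube averages modulo a block and short means *)

Section ShortSums.
Variable R : realType.
Local Notation C := R[i].

(* For p < A^8 the trivial bound 1 is used; otherwise A <= p^(1/8). *)
Lemma prime_weight_le (A : nat) (p : nat) (w : R) : (1 < A)%N -> (0 < p)%N ->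
  w <= 1 -> w <= A%:R * Num.sqrt (Num.sqrt p%:R^-1) ->
  w <= expR ((if (p < A ^ 8)%N then ln A%:R else 0) - ln p%:R / 8).
Proof.
move=> A1 p0 w1 wA.
have A0 : (0 : R) < A%:R by rewrite ltr0n ltnW.
have pp : (0 : R) < p%:R by rewrite ltr0n.
have sqrtE : Num.sqrt (Num.sqrt p%:R^-1) = expR (- (ln p%:R / 4)) :> R.
  have -> : p%:R^-1 = (expR (- (ln p%:R / 4)) ^+ 2) ^+ 2 :> R.
    rewrite -exprM -expRM_natl -[LHS]lnK ?posrE ?invr_gt0 // lnV ?posrE //.
    by congr expR; field.
  by rewrite sqrtr_sqr ger0_norm ?sqr_ge0 // sqrtr_sqr ger0_norm ?expR_ge0.
have lnA8 : ln (A ^ 8)%:R = 8 * ln A%:R :> R.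
  by rewrite natrX lnXn // mulr_natl.
case: ltnP => [small|large].
  apply: le_trans w1 _; rewrite -[X in X <= _]expR0 ler_expR subr_ge0 ler_pdivrMr //.
  by rewrite (mulrC (ln A%:R)) -lnA8 ler_ln ?posrE ?ltr0n ?expn_gt0 ?(ltnW A1) // ler_nat ltnW.
apply: le_trans wA _; rewrite sqrtE -[X in X * _](lnK (_ : A%:R \is Num.pos)) ?posrE //.
rewrite -expRD ler_expR sub0r.
have : 8 * ln A%:R <= ln p%:R :> R.
  by rewrite -lnA8 ler_ln ?posrE ?ltr0n ?expn_gt0 ?(ltnW A1) // ler_nat.
by move: (ln _) (ln _) => x y; lra.
Qed.

Lemma count_lt_uniq (s : seq nat) n : uniq s -> (count (fun x => x < n) s <= n)%N.
Proof.
move=> su; rewrite -size_filter -[leqRHS](size_iota 0); apply: uniq_leq_size.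
  exact: filter_uniq.
by move=> x; rewrite mem_filter mem_iota => /andP[].
Qed.

(** The factors at distinct primes multiply. Only the primes below A^8 lose a factor A, and there
    are at most A^8 of them. *)
Lemma cube_mean_prod_le (ps : seq nat) (c : nat -> nat -> C) k (A := (2 ^ k.+1)%N) :
  uniq ps -> all prime ps -> (forall p, p \in ps -> dirichlet_character p (c p)) ->
  (forall p, p \in ps -> exists2 n, coprime n p & c p n != 1) ->
  cube_mean (\prod_(p <- ps) p)%N k (fun n => \prod_(p <- ps) c p n) <=
    expR ((A ^ 8)%:R * ln A%:R - ln (\prod_(p <- ps) p)%N%:R / 8).
Proof.
move=> psu ps_pr cd cn; have A1 : (1 < A)%N by rewrite -(expn0 2) ltn_exp2l.
rewrite cube_mean_prod //; last by move=> p pps; apply: dirichlet_periodic; exact: cd.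
pose h p : R := (if (p < A ^ 8)%N then ln A%:R else 0) - ln p%:R / 8.
apply: (@le_trans _ _ (\prod_(p <- ps) expR (h p))).
  rewrite big_seq [leRHS]big_seq; apply: ler_prod => p pps.
  rewrite cube_mean_ge0 /=; have p_pr := allP ps_pr p pps.
  apply: prime_weight_le => //; first exact: prime_gt0.
    apply: cube_mean_le1; first exact: prime_gt0.
    by move=> n; apply: dirichlet_le1 (cd p pps); exact: prime_gt0.
  rewrite natrX; apply: cube_mean_dirichlet_prime => //; [exact: cd | exact: cn].
rewrite -expR_sum ler_expR /h sumrB -mulr_suml.
have -> : \sum_(p <- ps) ln p%:R = ln (\prod_(p <- ps) p)%N%:R :> R.
  elim: (ps) ps_pr => [|p ps' IH] /=; first by rewrite !big_nil ln1.
  move=> /andP[p_pr ps'_pr].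
  have ps'0 : (0 < \prod_(p <- ps') p)%N.
    by rewrite big_seq prodn_cond_gt0 // => p' /(allP ps'_pr)/prime_gt0.
  by rewrite !big_cons natrM lnM ?posrE ?ltr0n ?(prime_gt0 p_pr) // IH.
rewrite lerD2r -big_mkcond /= -big_filter big_const_seq count_predT iter_addr_0.
rewrite size_filter -[leLHS]mulr_natl ler_wpM2r ?ler_nat ?count_lt_uniq //.
by rewrite ln_ge0 // ler1n ltnW.
Qed.

End ShortSums.

Section ShortCharacterSums.
Variable R : realType.
Local Notation C := R[i].

Lemma short_char_sum Q (chi : nat -> C) q' (ps : seq nat) P Z :
  primitive_character Q chi -> Q = (q' * \prod_(p <- ps) p)%N -> (0 < q')%N ->
  uniq ps -> all prime ps -> {in ps, forall p, coprime q' p} ->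
  {in ps, forall p, (p <= P)%N} -> (1 < Z)%N -> (Z <= \prod_(p <- ps) p)%N ->
  exists k, [/\ (0 < k)%N, (Z ^ k.-1 <= Q)%N &
    forall N (eps : R), (0 < N)%N -> 0 <= eps <= 1 ->
      2 * (Z * P)%:R / N%:R <= eps ->
      8 * ((Z * P)%:R * (Z * P * q')%:R / N%:R) ^+ 2 <= eps ->
      normc (mean N chi) ^+ (2 ^ k) <= 8 ^+ (2 ^ k) *
        (expR (((2 ^ k.+1) ^ 8)%:R * ln (2 ^ k.+1)%:R - ln Z%:R / 8) + eps)].
Proof.
move=> prim QE q'0 psu ps_pr co psP Z1 Zps.
have [dchi _] := prim.
have ps0 p : p \in ps -> (0 < p)%N by move=> /(allP ps_pr)/prime_gt0.
have q'ps : q' \notin ps.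
  apply/negP => q'ps; have := co _ q'ps; rewrite /coprime gcdnn => /eqP q'1.
  by have := allP ps_pr _ q'ps; rewrite q'1.
have prime_co p1 p2 : p1 \in ps -> p2 \in ps -> p1 != p2 -> coprime p1 p2.
  move=> p1s p2s ne; rewrite prime_coprime ?(allP ps_pr _ p1s) //.
  by rewrite dvdn_prime2 ?(allP ps_pr _ p1s) ?(allP ps_pr _ p2s).
have [||||c [cd chiE]] := @dirichlet_decompose R (q' :: ps) chi.
- by rewrite /= q'ps.
- rewrite /=; apply/andP; split; first exact/allP.
  move: psu; rewrite uniq_pairwise; apply: (@sub_in_pairwise _ (mem ps)); last exact/allP.
  by move=> p1 p2 p1s p2s; exact: prime_co.
- by rewrite /= q'0; apply/allP => p /ps0.
- by rewrite big_cons -QE; exact: dchi.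
have Qps : (0 < \prod_(p <- ps) p)%N by apply: leq_trans Zps; apply: ltnW.
have Q0 : (0 < Q)%N by rewrite QE muln_gt0 q'0.
have cn p : p \in ps -> exists2 n, coprime n p & c p n != 1.
  move=> pps; apply: (@primitive_prime_factor _ Q chi p
    (q' * \prod_(e <- rem p ps) e)%N (c p) (fun n => c q' n * \prod_(e <- rem p ps) c e n)) => //.
  - exact/prime_gt1/(allP ps_pr).
  - by rewrite QE (big_rem p) //= mulnCA.
  - by apply: cd; rewrite inE pps orbT.
  - apply: dirichlet_mul; first by apply: cd; rewrite inE eqxx.
    by apply: dirichlet_prod => e /mem_rem eps; apply: cd; rewrite inE eps orbT.
  - by move=> n; rewrite chiE big_cons (big_rem p) //=; ring.
have psP' : {in ps, forall p, (0 < p <= P)%N}.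
  by move=> p pps; rewrite ps0 // psP.
have [gs [rest [perm gsZ restZ]]] := greedy_blocks Z1 psP'.
case: gs perm gsZ => [|g0 gs] perm gsZ.
  by move: Zps; rewrite (perm_big _ perm) leqNgt restZ.
(* The moduli removed by differencing are q', the remainder and all full blocks but [g0], which
   carries the cube average. So k is the size of [gs] plus 2, and the k - 1 full blocks of product
   at least Z give Z^(k-1) <= Q. *)
pose bl := [:: q'] :: rest :: gs.
have mem_ps p : p \in ps = [|| p \in g0, p \in flatten gs | p \in rest].
  by rewrite (perm_mem perm) /= !mem_cat orbA.
have g0ps p : p \in g0 -> p \in ps by rewrite mem_ps => ->.
have bl_sub g e : g \in bl -> e \in g -> (e == q') || (e \in rest ++ flatten gs).
  rewrite !inE => /or3P[/eqP->|/eqP->|ggs] eg.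
  - by move: eg; rewrite inE => ->.
  - by rewrite mem_cat eg orbT.
  - by rewrite mem_cat orbA orbC; apply/orP; left; apply/flattenP; exists g.
have sub_ps e : e \in rest ++ flatten gs -> e \in ps.
  by rewrite mem_ps mem_cat => /orP[->|->]; rewrite !orbT.
have bl_mod g e : g \in bl -> e \in g -> e \in q' :: ps.
  by move=> gb eg; rewrite inE; case/orP: (bl_sub _ _ gb eg) => [->|/sub_ps ->] //; rewrite orbT.
have perm_u : uniq (g0 ++ (flatten gs ++ rest)).
  by rewrite catA -(perm_uniq perm).
have bl_co g e p : g \in bl -> e \in g -> p \in g0 -> coprime e p.
  move=> gb eg pg0; case/orP: (bl_sub _ _ gb eg) => [/eqP ->|er].
    exact/co/g0ps.
  apply: prime_co; [exact: sub_ps | exact: g0ps |].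
  apply: contraTneq pg0 => <-; move: perm_u; rewrite cat_uniq => /and3P[_ /hasPn H _].
  by apply: H; rewrite mem_cat orbC -mem_cat.
pose qs i := (\prod_(e <- nth [::] bl i) e)%N.
pose u i n : C := \prod_(e <- nth [::] bl i) c e n.
pose k := size bl.
have nth_bl i : (i < k)%N -> nth [::] bl i \in bl by exact: mem_nth.
have d_bl i : (i < k)%N -> dirichlet_character (qs i) (u i).
  by move=> ik; apply: dirichlet_prod => e eb; apply: cd; apply: bl_mod eb; exact: nth_bl.
have qs0 i : (i < k)%N -> (0 < qs i)%N.
  move=> ik; rewrite /qs big_seq prodn_cond_gt0 // => e eb.
  have := bl_mod _ _ (nth_bl i ik) eb; rewrite inE => /orP[/eqP ->//|]; exact: ps0.
pose q0 := (\prod_(p <- g0) p)%N.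
have q00 : (0 < q0)%N by rewrite /q0 big_seq prodn_cond_gt0 // => p /g0ps/ps0.
have /andP[Zq0 q0ZP] : (Z <= q0 < Z * P)%N by apply: gsZ; rewrite inE eqxx.
have ZP0 : (0 < Z * P)%N by apply: leq_ltn_trans q0ZP.
exists k; split => //.
  rewrite /k /=; apply: leq_trans (_ : \prod_(p <- ps) p <= _)%N; last first.
    by rewrite QE leq_pmull.
  rewrite (perm_big _ perm) big_cat big_flatten.
  apply: (@leq_trans (\prod_(g <- g0 :: gs) \prod_(p <- g) p)%N); last first.
    rewrite leq_pmulr // big_seq prodn_cond_gt0 // => p pr.
    by apply: ps0; rewrite mem_ps pr !orbT.
  have -> : (Z ^ (size gs).+1 = \prod_(g <- g0 :: gs) Z)%N.
    by rewrite big_const_seq count_predT iter_muln_1.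
  by rewrite big_seq [leqRHS]big_seq; apply: leq_prod => g /gsZ/andP[].
move=> N eps N0 eps01 eps1 eps2.
have chi_bl n : chi n = (\prod_(i < k) u i n) * \prod_(p <- g0) c p n.
  rewrite chiE big_cons (perm_big _ perm) big_cat big_flatten !big_cons /=.
  rewrite -(big_mkord xpredT (fun i => u i n)) -(big_nth [::] xpredT (fun g => \prod_(e <- g) c e n)).
  by rewrite /bl !big_cons /= big_nil; ring.
rewrite (eq_mean (g := fun n => (\prod_(i < k) u i n) * \prod_(p <- g0) c p n)) //.
have g0u : uniq g0 by move: perm_u; rewrite cat_uniq => /andP[].
have g0pr : all prime g0 by apply/allP => p /g0ps; exact: (allP ps_pr).
have g0d p : p \in g0 -> dirichlet_character p (c p).
  by move=> /g0ps pps; apply: cd; rewrite inE pps orbT.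
have dv : dirichlet_character q0 (fun n => \prod_(p <- g0) c p n) by exact: dirichlet_prod.
have qs_le i : (i < k)%N -> (qs i <= Z * P * q')%N.
  move=> ik; have := nth_bl i ik; rewrite !inE => /or3P[/eqP e|/eqP e|ggs].
  - by rewrite /qs e big_seq1 leq_pmull.
  - rewrite /qs e; apply: leq_trans (ltnW restZ) _; rewrite -mulnA leq_pmulr //.
    by move: ZP0; rewrite !muln_gt0 q'0 => /andP[_ ->].
  - have /andP[_ /ltnW H] := gsZ _ (mem_behead (s := g0 :: gs) ggs).
    by apply: leq_trans H _; rewrite leq_pmulr.
apply: le_trans (van_der_corput_iter (qs := qs) (u := u) (v := fun n => \prod_(p <- g0) c p n)
  (q := q0) (eps := eps) q00 N0 _ _ _ _ _ eps01 _ _) _.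
- exact: dirichlet_periodic dv.
- by move=> n; exact: dirichlet_le1 dv.
- by move=> i ik; exact: dirichlet_periodic (d_bl i ik).
- by move=> i ik n; apply: dirichlet_le1 (d_bl i ik); exact: qs0.
- move=> i ik; rewrite /qs big_seq; elim/big_ind: _ => [|x y cx cy|e eb].
  + exact: coprime1n.
  + by rewrite coprimeMl cx.
  rewrite /q0 big_seq; elim/big_ind: _ => [|x y cx cy|p pg0]; first exact: coprimen1.
    by rewrite coprimeMr cx.
  exact: bl_co (nth_bl i ik) eb pg0.
- apply: le_trans eps1; rewrite ler_wpM2r ?invr_ge0 // ler_wpM2l // ler_nat ltnW //.
- move=> i ik; apply: le_trans eps2; rewrite ler_wpM2l //.
  apply: lerXn2r; rewrite ?nnegrE ?divr_ge0 ?mulr_ge0 //.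
  rewrite ler_wpM2r ?invr_ge0 // ler_pM // ler_nat ?qs_le //; exact: ltnW.
rewrite ler_wpM2l ?exprn_ge0 // lerD2r.
apply: le_trans (cube_mean_prod_le _ g0u g0pr g0d _) _.
  by move=> p /g0ps; exact: cn.
rewrite ler_expR lerD2l lerN2 ler_wpM2r ?invr_ge0 //.
by rewrite ler_ln ?posrE ?ltr0n ?ler_nat // ltnW.
Qed.

End ShortCharacterSums.

(** * The Dirichlet L-function near 1 *)

Section LSeries.
Variables (R : realType) (chi : nat -> R[i]) (Q : nat) (s : R).
Local Notation C := R[i].
Hypothesis Q1 : (1 < Q)%N.
Hypothesis s1 : 1 < s.
Hypothesis chi_le1 : forall n, normc (chi n) <= 1.

Let w n : R := expR (- s * ln n.+1%:R).
Let S N : C := \sum_(0 <= n < N) chi n.+1.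
Let T N : C := \sum_(0 <= n < N) chi n.+1 * (w n)%:C%C.
Hypothesis S_leQ : forall N, normc (S N) <= Q%:R.

Lemma nat_cpowN_real n : nat_cpowN n.+1 s%:C%C = (w n)%:C%C.
Proof.
rewrite /nat_cpowN /cexp -rmorphN -rmorphM /= cos0 sin0.
by rewrite -[(1 +i* 0)%C]/(1 : C) mulr1.
Qed.

Let w_ge0 n : 0 <= w n. Proof. exact: expR_ge0. Qed.

(** Comparison with s = 1 is what makes the final bound uniform in s > 1. *)
Let w_le n : w n <= n.+1%:R^-1.
Proof.
rewrite -[leRHS]lnK ?posrE ?invr_gt0 // ler_expR lnV ?posrE // mulNr lerN2.
by rewrite ler_peMl ?ln_ge0 ?ler1n // ltW.
Qed.

Let w_decr n : w n.+1 <= w n.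
Proof.
rewrite ler_expR !mulNr lerN2 ler_wpM2l ?(ltW (lt_trans ltr01 s1)) //.
by rewrite ler_ln ?posrE // ler_nat.
Qed.

Let abel M N : (M <= N)%N -> T N - T M = S N * (w N)%:C%C - S M * (w M)%:C%C
  + \sum_(M <= n < N) S n.+1 * (w n - w n.+1)%:C%C.
Proof.
move=> MN.
have -> : T N - T M = \sum_(M <= n < N) chi n.+1 * (w n)%:C%C.
  by apply/eqP; rewrite subr_eq addrC /T -(big_cat_nat (n := M)).
rewrite -(telescope_sumr (fun n => S n * (w n)%:C%C) MN) -big_split /=.
apply: eq_bigr => n _; rewrite /S big_nat_recr //= rmorphB /=; ring.
Qed.

Let abel_le (b : nat -> R) M N : (M <= N)%N ->
  (forall n, (M <= n <= N)%N -> normc (S n) <= b n) ->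
  normc (T N - T M) <= b N * w N + b M * w M
    + \sum_(M <= n < N) b n.+1 * (w n - w n.+1).
Proof.
move=> MN Sb; rewrite abel //; apply: le_trans (normc_add _ _) _.
have nC (x : R) : 0 <= x -> normc x%:C%C = x.
  by move=> x0; apply: (@complexI R); rewrite -normr_normc ger0_norm // ler0c.
apply: lerD.
  apply: le_trans (normc_add _ _) _; rewrite normc_opp !ComplexField.Normc.normcM.
  by rewrite !nC //; apply: lerD; rewrite ler_wpM2r // Sb ?MN ?leqnn.
apply: le_trans (normc_sum _ _ _) _; rewrite big_nat [leRHS]big_nat.
apply: ler_sum => n /andP[Mn nN]; rewrite ComplexField.Normc.normcM.
have wd : 0 <= w n - w n.+1 by rewrite subr_ge0.
by rewrite nC // ler_wpM2r // Sb // nN andbT ltnW.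
Qed.

Lemma harmonic_le N : (0 < N)%N -> \sum_(0 <= n < N) n.+1%:R^-1 <= 1 + ln N%:R :> R.
Proof.
elim: N => [//|N IH] _; have [->|N0] := posnP N.
  by rewrite big_nat1 invr1 ln1 addr0.
rewrite big_nat_recr //=.
have : N.+1%:R^-1 <= ln N.+1%:R - ln N%:R :> R.
  have -> : ln N.+1%:R - ln N%:R = - ln (N%:R / N.+1%:R) :> R.
    by rewrite ln_div ?posrE ?ltr0n // opprB.
  have -> : (N%:R / N.+1%:R = 1 + - N.+1%:R^-1 :> R).
    by rewrite -[X in X / _](addrK 1) natr1 mulrDl mulfV ?pnatr_eq0 // mulN1r.
  rewrite lerNr; apply: le_ln1Dx.
  by rewrite ltrN2 invf_lt1 // ltr1n ltnS.
by move=> h; apply: le_trans (lerD (IH N0) h) _; rewrite addrC addrCA subrK.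
Qed.

Let tail_le (M N : nat) : (M <= N)%N -> normc (T N - T M) <= 2 * Q%:R / M.+1%:R.
Proof.
move=> MN; apply: le_trans (abel_le (b := fun=> Q%:R) MN _) _ => //.
rewrite -mulr_sumr.
have -> : \sum_(M <= n < N) (w n - w n.+1) = w M - w N.
  by rewrite -[RHS]opprB -(telescope_sumr _ MN) -sumrN; apply: eq_bigr => n _; rewrite opprB.
rewrite (_ : _ + _ = 2 * Q%:R * w M); last by ring.
by rewrite ler_wpM2l ?mulr_ge0 // w_le.
Qed.

Let w_term_le1 n : n%:R * w n <= 1.
Proof.
apply: (@le_trans _ _ (n%:R * n.+1%:R^-1)); first by rewrite ler_wpM2l.
by rewrite ler_pdivrMr // mul1r ler_nat.
Qed.

(** Three ranges: the harmonic sum up to X, partial summation with |S(n)| <= del n between X and Q,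
    and beyond Q the tail estimate 2 Q / (Q + 1) <= 2. *)
Let partial_le (X : nat) (del : R) N : (0 < X)%N -> (X <= Q)%N -> 0 <= del ->
  (forall n, (X <= n <= Q)%N -> normc (S n) <= del * n%:R) -> (Q <= N)%N ->
  normc (T N) <= 1 + ln X%:R + del * (3 + ln Q%:R) + 2.
Proof.
move=> X0 XQ del0 Sdel QN; have Q0 := ltnW Q1.
rewrite -(subrK (T Q) (T N)) [leRHS]addrC; apply: le_trans (normc_add _ _) _.
apply: lerD.
  apply: le_trans (tail_le QN) _; rewrite ler_pdivrMr // ler_wpM2l // ler_nat //.
rewrite -(subrK (T X) (T Q)) [leRHS]addrC; apply: le_trans (normc_add _ _) _.
apply: lerD; last first.
  apply: le_trans (harmonic_le X0); apply: le_trans (normc_sum _ _ _) _.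
  apply: ler_sum => n _; rewrite ComplexField.Normc.normcM.
  apply: (@le_trans _ _ (1 * w n)); last by rewrite mul1r w_le.
  have -> : normc (w n)%:C%C = w n.
    by apply: (@complexI R); rewrite -normr_normc ger0_norm // ler0c.
  by rewrite ler_wpM2r.
apply: le_trans (abel_le (b := fun n => del * n%:R) XQ Sdel) _.
have -> : \sum_(X <= n < Q) del * n.+1%:R * (w n - w n.+1) =
   del * (X%:R * w X - Q%:R * w Q + \sum_(X <= n < Q) w n).
  have -> : X%:R * w X - Q%:R * w Q = \sum_(X <= n < Q) (n%:R * w n - n.+1%:R * w n.+1).
    rewrite -[LHS]opprB -(telescope_sumr (fun n => n%:R * w n) XQ) -sumrN.
    by apply: eq_bigr => n _; rewrite opprB.
  rewrite -big_split /= mulr_sumr; apply: eq_bigr => n _.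
  by rewrite -natr1; ring.
rewrite (_ : _ + _ = del * (2 * (X%:R * w X) + \sum_(X <= n < Q) w n)); last by ring.
rewrite ler_wpM2l //.
have := w_term_le1 X.
have : \sum_(X <= n < Q) w n <= 1 + ln Q%:R.
  apply: le_trans (harmonic_le Q0).
  rewrite [leRHS](big_cat_nat (n := X)) //= -[leLHS]add0r lerD //.
    by apply: sumr_ge0 => n _; rewrite invr_ge0.
  by apply: ler_sum => n _.
by lra.
Qed.

Let cauchy_cvg (u : nat -> R) : (forall M N, (M <= N)%N -> `|u N - u M| <= 2 * Q%:R / M.+1%:R) ->
  exists l : R, forall M, `|l - u M| <= 2 * Q%:R / M.+1%:R.
Proof.
move=> uC; have cu : cvg (u @ \oo)%classic.
  apply/cauchy_cvgP/cauchy_exP => e e0.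
  pose M := Num.Def.archi_bound (2 * Q%:R / e).
  exists (u M); change ((\forall n \near \oo, ball (u M) e (u n))%classic); near=> n.
  have Mn : (M <= n)%N by near: n; exact: nbhs_infty_ge.
  rewrite /ball /= distrC; apply: le_lt_trans (uC _ _ Mn) _.
  rewrite ltr_pdivrMr // [ltRHS]mulrC -ltr_pdivrMr //.
  apply: lt_le_trans (archi_boundP _) _; first by rewrite divr_ge0 ?mulr_ge0 // ltW.
  by rewrite ler_nat leqnSn.
exists (lim (u @ \oo)%classic) => M.
have cuM : ((fun n => `|u n - u M|) @ \oo --> `|lim (u @ \oo)%classic - u M|)%classic.
  by apply: cvg_norm; apply: cvgB => //; exact: cvg_cst.
apply: (cvgr_to_le cuM); near=> n; apply: uC; near: n; exact: nbhs_infty_ge.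
Unshelve. all: by end_near.
Qed.

Let Re_le (z : C) : `|complex.Re z| <= normc z.
Proof. by case: z => a b /=; rewrite -sqrtr_sqr ler_wsqrtr // lerDl sqr_ge0. Qed.

Let Im_le (z : C) : `|complex.Im z| <= normc z.
Proof. by case: z => a b /=; rewrite -sqrtr_sqr ler_wsqrtr // lerDr sqr_ge0. Qed.

(** Real and imaginary parts converge separately at the rate of [tail_le]; adding the two errors
    doubles the constant. *)
Let T_cvg : exists l : C, forall M, normc (l - T M) <= 4 * Q%:R / M.+1%:R.
Proof.
have ReB (x y : C) : complex.Re (x - y) = complex.Re x - complex.Re y.
  by case: x y => [? ?] [? ?].
have ImB (x y : C) : complex.Im (x - y) = complex.Im x - complex.Im y.
  by case: x y => [? ?] [? ?].
have [a Ha] := cauchy_cvg (u := fun n => complex.Re (T n))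
  (fun M N MN => le_trans (eq_ind _ (fun x => `|x| <= _) (Re_le _) _ (ReB _ _)) (tail_le MN)).
have [b Hb] := cauchy_cvg (u := fun n => complex.Im (T n))
  (fun M N MN => le_trans (eq_ind _ (fun x => `|x| <= _) (Im_le _) _ (ImB _ _)) (tail_le MN)).
exists (a +i* b)%C => M.
move: (Ha M) (Hb M); case: (T M) => c d /= h1 h2.
apply: (@le_trans _ _ (`|a - c| + `|b - d|)).
  rewrite -[leRHS]ger0_norm ?addr_ge0 // -sqrtr_sqr ler_wsqrtr //.
  rewrite [leRHS]sqrrD !real_normK ?num_real // -addrA lerD2l lerDr.
  by rewrite mulrn_wge0 // mulr_ge0.
by apply: le_trans (lerD h1 h2) _; rewrite -mulrDl -mulrDl -natrD.
Qed.

Lemma dirichlet_L_le (X : nat) (del : R) : (0 < X)%N -> (X <= Q)%N -> 0 <= del ->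
  (forall n, (X <= n <= Q)%N -> normc (S n) <= del * n%:R) ->
  normc (dirichlet_L s%:C%C chi) <= 7 + ln X%:R + del * (3 + ln Q%:R).
Proof.
move=> X0 XQ del0 Sdel; have [l Hl] := T_cvg.
have -> : dirichlet_L s%:C%C chi = l.
  apply: (@cvg_lim C^o); first exact: norm_hausdorff.
  (* A positive element [e] of R[i] is real. *)
  apply/cvgrPdist_le => e e0; have [e1 eE] : 0 < complex.Re e /\ e = (complex.Re e)%:C%C.
    by case: e e0 => x y; rewrite ltcE /= => /andP[/eqP -> ?].
  near=> n.
  have -> : series (fun n => chi n.+1 * nat_cpowN n.+1 s%:C%C : C^o) n = T n.
    by apply: eq_bigr => i _; rewrite nat_cpowN_real.
  rewrite normr_normc eE lecR; apply: le_trans (Hl n) _.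
  rewrite ler_pdivrMr // [leRHS]mulrC -ler_pdivrMr //.
  have : (Num.Def.archi_bound (4 * Q%:R / complex.Re e) <= n)%N.
    by near: n; exact: nbhs_infty_ge.
  rewrite -(ler_nat R) => h; apply/ltW/(lt_trans (archi_boundP _)).
    by rewrite divr_ge0 ?mulr_ge0 // ltW.
  by apply: le_lt_trans h _; rewrite ltr_nat.
rewrite -(subrK (T (4 * Q)%N) l); apply: le_trans (normc_add _ _) _.
have -> : 7 + ln X%:R + del * (3 + ln Q%:R) =
  4 + (1 + ln X%:R + del * (3 + ln Q%:R) + 2) by ring.
apply: lerD; last by apply: partial_le => //; lia.
apply: le_trans (Hl _) _.
rewrite ler_pdivrMr // ler_wpM2l // ler_nat; lia.
Unshelve. all: by end_near.
Qed.

End LSeries.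

(** * Sums over periods and the factorization of Q *)

Section FullSums.
Variables (R : realType) (Q : nat) (chi : nat -> R[i]).
Hypotheses (Q1 : (1 < Q)%N) (chiP : primitive_character Q chi).
Let Q0 : (0 < Q)%N := ltnW Q1.

Lemma primitive_nontrivial : exists2 m, coprime m Q & chi m != 1.
Proof.
apply: contrapT => chi1; case: chiP => chiD /(_ 1%N (fun=> 1)).
rewrite dvd1n => /(_ isT Q1 (dirichlet_trivial R)); apply => n nQ.
by apply/eqP; apply: contrapT => /negP cn; apply: chi1; exists n.
Qed.

Lemma primitive_full_sum : \sum_(0 <= i < Q) chi i = 0.
Proof.
have [m mQ chim] := primitive_nontrivial; have chiD := chiP.1.
have Qn0 : Q%:R != 0 :> R[i] by rewrite pnatr_eq0 -lt0n.
have := mean_mull_coprime Q0 (dirichlet_periodic chiD) mQ.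
have -> : mean Q (fun i => chi (i * m)%N) = chi m * mean Q chi.
  by rewrite -meanZ; apply: eq_mean => i _; rewrite mulrC; case: chiD.
move/eqP; rewrite -subr_eq0 -{2}[mean Q chi]mul1r -mulrBl mulf_eq0 subr_eq0.
by rewrite (negbTE chim) /mean mulf_eq0 invr_eq0 (negbTE Qn0) orbF => /eqP.
Qed.

Lemma primitive_sum_le N : normc (\sum_(0 <= i < N) chi i) <= Q%:R.
Proof.
have chi_per := dirichlet_periodic chiP.1.
rewrite {1}(divn_eq N Q); elim: (N %/ Q)%N => [|k IH].
  rewrite mul0n add0n; apply: le_trans (normc_sum _ _ _) _.
  apply: (@le_trans _ _ (\sum_(0 <= i < N %% Q) 1)).
    by apply: ler_sum => i _; apply: dirichlet_le1 chiP.1.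
  by rewrite sumr_const_nat subn0 ler_nat ltnW ?ltn_pmod.
rewrite mulSn -addnA (big_cat_nat (n := Q)) ?leq_addr //= primitive_full_sum add0r.
rewrite -{1}[Q]add0n big_addn addKn.
by under eq_bigr do rewrite chi_per.
Qed.

(** The term at 0 is free: gcd(0, Q) = Q > 1, so chi(0) = 0. *)
Lemma primitive_shift_sum N : \sum_(0 <= n < N) chi n.+1 = \sum_(0 <= i < N.+1) chi i.
Proof.
rewrite big_nat_recl // (dirichlet_eq0 chiP.1) ?add0r // /coprime gcd0n.
by rewrite neq_ltn Q1 orbT.
Qed.

End FullSums.

Section BelowPart.
Variables (R : realType) (Q : nat) (r : R).
Hypothesis Q0 : (0 < Q)%N.

Let small : nat_pred := [pred p | p%:R < r].

Let below_partE : below_part Q r = (Q`_small)%N.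
Proof.
rewrite (widen_partn _ (leq_maxl Q (Num.truncn r))) /below_part.
rewrite [RHS](bigID prime) /= [X in (_ = _ * X)%N]big1 ?muln1; last first.
  by move=> p /andP[_ np]; rewrite lognE (negbTE np).
rewrite (big_nat_widen _ _ (maxn Q (Num.truncn r)).+1) ?ltnS ?leq_maxr //.
apply: eq_bigl => p; rewrite inE andbC [RHS]andbC; case: (prime p) => //=; last by rewrite andbF.
case: (ltrP p%:R r) => pr; last by rewrite andbF.
by rewrite andbT ltnS truncn_ge_nat ?ltW // (le_lt_trans _ pr).
Qed.

Lemma below_part_gt0 : (0 < below_part Q r)%N.
Proof. by rewrite below_partE part_gt0. Qed.

Definition primes_above := [seq p <- primes Q | r <= p%:R].

Hypothesis sqfree : forall p : nat, prime p -> r <= p%:R -> (logn p Q <= 1)%N.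

Lemma below_part_above : (Q = below_part Q r * \prod_(p <- primes_above) p)%N.
Proof.
rewrite -{1}(partnC small Q0) below_partE; congr (_ * _)%N.
transitivity (\prod_(p <- primes_above) p ^ logn p Q)%N.
  rewrite /partn; transitivity (\prod_(0 <= p < Q.+1 | p \in primes_above) p ^ logn p Q)%N.
    rewrite big_mkcond [RHS]big_mkcond; apply: eq_bigr => p _.
    rewrite !inE mem_filter mem_primes Q0 -leNgt; case: (r <= p%:R) => //=.
    by rewrite lognE Q0; case: (prime p) => //=; case: (p %| Q)%N.
  rewrite -big_filter; apply: perm_big; apply: uniq_perm.
  - by rewrite filter_uniq ?iota_uniq.
  - by rewrite filter_uniq ?primes_uniq.
  move=> p; rewrite !mem_filter mem_index_iota mem_primes Q0 ltnS.
  case: (r <= p%:R) => //=; case: (prime p) => //=; case: (boolP (p %| Q)%N) => // pQ.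
  by rewrite (dvdn_leq Q0 pQ).
rewrite !big_seq; apply: eq_bigr => p; rewrite mem_filter => /andP[rp pQ].
have pp : prime p by move: pQ; rewrite mem_primes => /andP[].
suff -> : logn p Q = 1%N by rewrite expn1.
by apply/eqP; rewrite eqn_leq sqfree // logn_gt0.
Qed.

Lemma below_part_coprime : {in primes_above, forall p, coprime (below_part Q r) p}.
Proof.
move=> p; rewrite mem_filter mem_primes => /and4P[rp pp _ pQ].
rewrite below_partE; apply: (@pnat_coprime small); first exact: part_pnat.
by rewrite pnatE // !inE -leNgt.
Qed.

End BelowPart.

(** * Choice of parameters *)

Section Numeric.
Variable R : realType.
Implicit Types (L Y l : R).

Lemma exp2_le_expR n : (2 ^ n)%:R <= expR n%:R :> R.
Proof.
rewrite natrX -[n%:R in leRHS]mulr1 expRM_natl.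
apply: lerXn2r; rewrite ?nnegrE ?expR_ge0 //.
by apply: le_trans (expR_ge1Dx _); lra.
Qed.

(** Meant for L = log log Q, where e^L = log Q. The exponent 9/64 is that of the ninth power of
    e^(L/64), a bound for 2^(k-1), and 2^16 is 4^9 / 4. The growth comes from the quartic Taylor
    term of e^(L/2). *)
Lemma large_exp_bounds L : 1024 <= L ->
  2 ^+ 16 * (L * expR (L * (9 / 64))) <= expR L /\ L ^+ 2 * expR (L / 64) <= expR L.
Proof.
move=> L1; have L0 : 0 <= L by lra.
have h4 : (L / 2) ^+ 4 / 24 <= expR (L / 2).
  by apply: le_trans (expR_ge1Dxn 3 (divr_ge0 L0 (ler0n _ 2))); rewrite lerDr.
have eL : expR L = expR (L / 2) * expR (L / 2) by rewrite -expRD; congr expR; lra.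
have LE : (L / 2) ^+ 4 * 16 = (L * L) * (L * L) by field.
have hx := ler_wpM2r L0 L1.
have hxx := ler_wpM2r (mulr_ge0 L0 L0) (ler_pM (ler0n R 1024) (ler0n R 1024) L1 L1).
rewrite -LE in hxx; rewrite expr2.
have hL2 : L * L <= expR (L / 2) by clear -h4 hx hxx L0 L1; lra.
have hL : 2 ^+ 16 * L <= expR (L / 2) by clear -h4 hx hxx L0 L1; lra.
split.
  by rewrite eL mulrA ler_pM ?mulr_ge0 ?expR_ge0 // ler_expR; lra.
by rewrite eL ler_pM ?mulr_ge0 ?expR_ge0 // ler_expR; lra.
Qed.

(** Here l = log Q, z = log Z and j = k - 1. As z >= 64 l / L, j is at most L / 64 and 2^j <=
    l^(1/64). The first bound lets the small primes eat at most half of the gain z / 8; the second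
    compares (log Q)^(2^k) with e^(3 Y / 1024). *)
Lemma depth_bounds l Y z j : 1024 <= ln l -> 1024 * (l / ln l) <= Y -> Y / 16 <= z ->
  j%:R * z <= l ->
  ((2 ^ j.+2) ^ 8)%:R * ln (2 ^ j.+2)%:R <= z / 16 /\
  (2 ^ j.+1)%:R * ln l <= Y * (3 / 1024).
Proof.
move=> L1 lY Yz jz; set L := ln l in L1 lY *.
have l0 : 0 < l by apply: contraTT L1; rewrite -leNgt /L => /ln0 ->; rewrite -ltNge ltr0n.
have lE : l = expR L by rewrite lnK.
have L0 : 0 < L by lra.
have [big1 big2] := large_exp_bounds L1; rewrite -lE in big1 big2.
have jL : j%:R <= L / 64.
  have : j%:R * (64 * (l / L)) <= l.
    apply: le_trans jz; rewrite ler_wpM2l //; lra.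
  by rewrite (_ : j%:R * _ = j%:R * 64 / L * l) ?ger_pMl // ?ler_pdivrMr //; [lra|field; lra].
have gj : (2 ^ j)%:R <= expR (L / 64).
  by apply: le_trans (exp2_le_expR j) _; rewrite ler_expR.
set x : R := (2 ^ j)%:R in gj.
have A2 : (2 ^ j.+2)%:R = 4 * x by rewrite !expnS mulnA natrM.
have lL0 : 0 < l / L by rewrite divr_gt0.
split.
  apply: (@le_trans _ _ ((4 * x) ^+ 9)).
    rewrite natrX A2 [leRHS]exprSr ler_wpM2l ?exprn_ge0 ?mulr_ge0 //.
    by apply/ltW/ln_sublinear; rewrite mulr_gt0 // ltr0n expn_gt0.
  apply: (@le_trans _ _ (4 * (l / L))); last by lra.
  rewrite exprMn; apply: (@le_trans _ _ (4 ^+ 9 * expR (L * (9 / 64)))).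
    rewrite ler_wpM2l // (_ : L * _ = L / 64 * 9%:R); last by lra.
    by rewrite expRM_natr; apply: lerXn2r; rewrite ?nnegrE ?expR_ge0.
  rewrite mulrA ler_pdivlMr //; move: big1; move: (expR (L * _)) => e; nra.
rewrite expnS natrM -/x; apply: (@le_trans _ _ (3 * (l / L))); last by lra.
rewrite mulrA ler_pdivlMr //.
have : x * L ^+ 2 <= l by apply: le_trans big2; rewrite mulrC ler_wpM2l ?sqr_ge0.
have : 0 <= x * L ^+ 2 by rewrite mulr_ge0 ?sqr_ge0.
by rewrite expr2; nra.
Qed.

Lemma block_size (Y : R) : 1024 <= Y -> exists Z : nat,
  [/\ (1 < Z)%N, Z%:R <= expR (Y / 8) & Y / 16 <= ln Z%:R].
Proof.
move=> Y1; exists (Num.truncn (expR (Y / 8))); set Z := Num.truncn _.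
have u64 : 64 <= expR (Y / 16) by apply: le_trans (expR_ge1Dx _); lra.
have ZS : expR (Y / 16) * expR (Y / 16) < Z.+1%:R.
  by rewrite -expRD (_ : _ + _ = Y / 8) ?truncnS_gt //; lra.
have Zu : expR (Y / 16) <= Z%:R.
  have uu := ler_wpM2r (expR_ge0 (Y / 16)) u64.
  by rewrite -[Z.+1%:R]natr1 in ZS; lra.
have Z1 : (1 < Z)%N.
  by rewrite -(ltr1n R); apply: lt_le_trans Zu; apply: lt_le_trans u64; rewrite ltr1n.
split=> //; first by rewrite truncn_le expR_ge0.
by rewrite -ler_expR lnK // posrE ltr0n ltnW.
Qed.

Lemma short_mean_le Q (chi : nat -> R[i]) q' (ps : seq nat) P Y :
  primitive_character Q chi -> Q = (q' * \prod_(p <- ps) p)%N -> (0 < q')%N ->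
  uniq ps -> all prime ps -> {in ps, forall p, coprime q' p} ->
  {in ps, forall p, (p <= P)%N} -> (0 < P)%N ->
  1024 <= ln (ln Q%:R : R) -> 1024 * (ln Q%:R / ln (ln Q%:R)) <= Y -> Y <= ln Q%:R ->
  ln q'%:R <= Y / 1024 -> ln P%:R <= Y / 1024 ->
  forall N, expR Y <= N%:R -> normc (mean N chi) <= 8 / ln Q%:R.
Proof.
move=> chiP QE q0 ups pps cps psP P0 L1 lY Yl qY PY N NY.
set l : R := ln Q%:R in L1 lY Yl *; set L := ln l in L1 lY.
have l0 : 0 < l by apply: contraTT L1; rewrite -leNgt /L => /ln0 ->; rewrite -ltNge ltr0n.
have Q0 : (0 < Q)%N by rewrite lt0n; apply: contraTneq l0 => Q0; rewrite /l Q0 ln0 // ltxx.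
have L0 : 0 < L by lra.
have lL1 : 1 <= l / L by rewrite ler_pdivlMr // mul1r; exact/ltW/ln_sublinear.
have Y1 : 1024 <= Y by clear -lL1 lY; lra.
have expE (n : nat) (x : R) : (0 < n)%N -> ln n%:R <= x -> n%:R <= expR x.
  by move=> n0 h; rewrite -[leLHS]lnK ?posrE ?ltr0n // ler_expR.
have PE := expE _ _ P0 PY; have qE := expE _ _ q0 qY.
have [Z [Z1 ZE lnZ]] := block_size Y1.
have prod0 : (0 < \prod_(p <- ps) p)%N.
  by rewrite lt0n; apply: contraTneq Q0 => h; rewrite QE h muln0.
have Zps : (Z <= \prod_(p <- ps) p)%N.
  rewrite -(ler_nat R); apply: le_trans ZE _.
  rewrite -[leRHS]lnK ?posrE ?ltr0n // ler_expR.
  have : l = ln q'%:R + ln (\prod_(p <- ps) p)%N%:R.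
    by rewrite /l QE natrM lnM ?posrE ?ltr0n.
  by clear -qY Yl Y1; lra.
have [[|j] [// _ ZQ bnd]] := short_char_sum chiP QE q0 ups pps cps psP Z1 Zps.
rewrite /= in ZQ.
have jz : j%:R * ln Z%:R <= l.
  have Z0 : 0 < Z%:R :> R by rewrite ltr0n ltnW.
  by rewrite mulr_natl -(lnXn j Z0) -natrX ler_ln ?posrE ?ltr0n ?expn_gt0 ?(ltnW Z1) ?ler_nat.
have [h1 h2] := depth_bounds L1 lY lnZ jz.
have N0 : (0 < N)%N by rewrite -(ltr0n R); apply: lt_le_trans NY; exact: expR_gt0.
have iN : N%:R^-1 <= expR (- Y) by rewrite expRN lef_pV2 ?posrE ?expR_gt0 ?ltr0n.
have e2 : 2 <= expR (Y / 1024) by apply: le_trans (expR_ge1Dx _); clear -Y1; lra.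
have ZP : (Z * P)%:R <= expR (Y / 8 + Y / 1024) by rewrite natrM expRD ler_pM.
(* This [eps] matches the main term, at most e^(- ln Z / 16) <= e^(-Y/256). The differencing errors
   are far smaller. *)
have := bnd N (expR (- Y / 256)) N0.
have -> : 0 <= expR (- Y / 256) <= 1 by rewrite expR_ge0 expR_le1; clear -Y1; lra.
move=> /(_ isT).
have -> : 2 * (Z * P)%:R / N%:R <= expR (- Y / 256).
  apply: (@le_trans _ _ (expR (Y / 1024) * expR (Y / 8 + Y / 1024) * expR (- Y))).
    by rewrite ler_pM ?mulr_ge0 ?invr_ge0 // ler_pM.
  by rewrite -!expRD ler_expR; clear -Y1; lra.
move=> /(_ isT).
have -> : 8 * ((Z * P)%:R * (Z * P * q')%:R / N%:R) ^+ 2 <= expR (- Y / 256).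
  have e8 : 8 <= expR (Y / 1024) ^+ 3.
    by rewrite [leLHS](_ : _ = 2 ^+ 3); [apply: lerXn2r; rewrite ?nnegrE ?expR_ge0|ring].
  apply: (@le_trans _ _ (expR (Y / 1024) ^+ 3 * (expR (Y / 8 + Y / 1024) *
      expR (Y / 8 + Y / 1024 + Y / 1024) * expR (- Y)) ^+ 2)).
    rewrite ler_pM // ?sqr_ge0 //; apply: lerXn2r; rewrite ?nnegrE ?mulr_ge0 ?invr_ge0 ?expR_ge0 //.
    rewrite ler_pM ?mulr_ge0 ?invr_ge0 // ler_pM //.
    by rewrite natrM [expR (_ + _ + _)]expRD ler_pM.
  by rewrite -!expRD -!expRM_natl -expRD ler_expR; clear -Y1; lra.
move=> /(_ isT) mb.
have k0 : (0 < 2 ^ j.+1)%N by rewrite expn_gt0.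
rewrite -(ler_pXn2r k0) ?nnegrE ?normc_ge0 ?divr_ge0 ?(ltW l0) //.
apply: le_trans mb _; rewrite expr_div_n ler_wpM2l ?exprn_ge0 //.
have -> : (l ^+ (2 ^ j.+1))^-1 = expR (- ((2 ^ j.+1)%:R * L)).
  by rewrite expRN expRM_natl lnK.
(* The two terms add up to at most 2 e^(-Y/256) <= e^(-3 Y / 1024), which is the room that
   [depth_bounds] leaves for (log Q)^(-2^k). *)
apply: (@le_trans _ _ (expR (Y / 1024) * expR (- Y / 256))).
  apply: (@le_trans _ _ (2 * expR (- Y / 256))); last by rewrite ler_wpM2r ?expR_ge0.
  have : expR (((2 ^ j.+2) ^ 8)%:R * ln (2 ^ j.+2)%:R - ln Z%:R / 8) <= expR (- Y / 256).
    by rewrite ler_expR; move: (_ * _) h1 => x h1; clear -h1 lnZ; lra.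
  by move: (expR (- Y / 256)) (expR (_ - _)) => x z; clear; lra.
by rewrite -expRD ler_expR; move: h2; rewrite -/L; move: (_ * L) => x; clear; lra.
Qed.
End Numeric.

(** From 5/6 <= e^(-1/6) follows e <= (6/5)^6 < 3. This makes log log Q positive already at Q =
    3. *)
Lemma expR1_lt3 (R : realType) : expR 1 < 3 :> R.
Proof.
have h : expR (- (1 / 6)) ^+ 6 * expR 1 = 1 :> R.
  by rewrite -expRM_natl -expRD (_ : _ + _ = 0) ?expR0 //; lra.
have : (5 / 6) ^+ 6 <= expR (- (1 / 6)) ^+ 6 :> R.
  apply: lerXn2r; rewrite ?nnegrE ?expR_ge0 //.
  by apply: le_trans (expR_ge1Dx _); lra.
move: h; move: (expR _ ^+ 6) => u; have := expR_gt0 (1 : R); move: (expR 1) => e e0 h u6.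
by rewrite ltNge; apply/negP => e3; nra.
Qed.

(** * The bound for L(s, chi) *)

Section Bound.
Variables (R : realType) (Q : nat) (chi : nat -> R[i]) (s : R).
Hypotheses (Q3 : (3 <= Q)%N) (chiP : primitive_character Q chi) (s1 : 1 < s).
Let l : R := ln Q%:R.

Let Q1 : (1 < Q)%N. Proof. exact: ltn_trans Q3. Qed.
Let chi_le n : normc (chi n) <= 1.
Proof. exact: dirichlet_le1 (ltnW Q1) chiP.1. Qed.
Let S_le N : normc (\sum_(0 <= n < N) chi n.+1) <= Q%:R.
Proof. by rewrite (primitive_shift_sum Q1 chiP) primitive_sum_le. Qed.

Lemma loglog_gt0 : 0 < ln (ln Q%:R) :> R.
Proof.
apply: ln_gt0; rewrite -ltr_expR lnK ?posrE ?ltr0n; last exact: ltnW.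
by apply: lt_le_trans (expR1_lt3 R) _; rewrite ler_nat.
Qed.

(** The choice X = Q, del = 1; it settles the case 1024 E > log Q. *)
Lemma dirichlet_L_trivial : normc (dirichlet_L s%:C chi) <= 10 + 2 * l.
Proof.
apply: le_trans (dirichlet_L_le Q1 s1 chi_le S_le (ltnW Q1) (leqnn Q) ler01 _) _ => [n /andP[Qn _]|].
  by rewrite mul1r; apply: le_trans (S_le n) _; rewrite ler_nat.
by rewrite -/l; lra.
Qed.

Lemma dirichlet_L_short (Y : R) : 1 <= l -> 1 <= Y -> Y <= l ->
  (forall N, expR Y <= N%:R -> normc (mean N chi) <= 8 / l) ->
  normc (dirichlet_L s%:C chi) <= 71 + Y.
Proof.
move=> l1 Y1 Yl mle; have l0 : 0 < l by lra.
pose X := Num.truncn (expR Y).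
have X0 : (0 < X)%N by rewrite truncn_gt0; apply: le_trans (expR_ge1Dx _); lra.
have XE : X%:R <= expR Y by rewrite truncn_le expR_ge0.
have XQ : (X <= Q)%N.
  rewrite -(ler_nat R); apply: le_trans XE _.
  by rewrite -[leRHS]lnK ?posrE ?ltr0n ?ler_expR // ltnW.
(* 16 instead of 8 because a sum over 1..n is one over [0, n + 1), and n + 1 <= 2 n. The constant 71
   is 7 + 3 * 16 + 16. *)
have d0 : 0 <= 16 / l by rewrite divr_ge0 // ltW.
apply: le_trans (dirichlet_L_le Q1 s1 chi_le S_le X0 XQ d0 _) _ => [n /andP[Xn _]|].
  rewrite (primitive_shift_sum Q1 chiP).
  have n0 : (0 < n)%N by apply: leq_trans Xn.
  have -> : \sum_(0 <= i < n.+1) chi i = mean n.+1 chi * n.+1%:R.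
    by rewrite divfK ?pnatr_eq0.
  rewrite ComplexField.Normc.normcM normc_nat.
  apply: (@le_trans _ _ (8 / l * n.+1%:R)).
    rewrite ler_wpM2r // mle //; apply/ltW; apply: lt_le_trans (truncnS_gt _) _.
    by rewrite ler_nat ltnS.
  rewrite (_ : 16 / l = 8 / l * 2); last by ring.
  by rewrite -[leRHS]mulrA ler_wpM2l ?divr_ge0 ?(ltW l0) // -natrM ler_nat; lia.
have : ln X%:R <= Y by rewrite -[leRHS]expRK ler_ln ?posrE ?ltr0n ?expR_gt0.
rewrite -/l mulrDr divfK ?gt_eqF //.
have : 16 / l <= 16 by rewrite ler_pdivrMr // ler_peMr.
by lra.
Qed.

End Bound.

Theorem lemma4 (R : realType) :
  exists C : R, 0 < C /\
    forall (Q : nat) (chi : nat -> R[i]) (r : R),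
      (3 <= Q)%N ->
      primitive_character Q chi ->
      0 < r ->
      (forall p : nat, prime p -> r <= p%:R -> (logn p Q <= 1)%N) ->
      forall y : R, 3 < y ->
        let s_y : R := 1 + (ln y)^-1 in
        let q' : nat := below_part Q r in
        `|dirichlet_L s_y%:C chi| <=
        (C * (ln (q'%:R : R)
              + ln (Q%:R : R) / ln (ln (Q%:R : R))
              + Num.sqrt (ln (Q%:R : R)
                          * (ln ((max_pdiv Q)%:R : R)
                             + ln ((size (divisors Q))%:R : R)))))%:C.
Proof.
(* If 1024 E > log Q, the trivial bound 10 + 2 log Q is at most 10 + 2048 E; otherwise Y = 1024 E
   gives 71 + 1024 E. Both are at most 2058 E, as E >= 1. *)
exists 2058; split; first by rewrite ltr0n.
move=> Q chi r Q3 chiP r0 sqfree y y3; set s := 1 + _; set q' := below_part Q r; cbv zeta.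
have s1 : 1 < s by rewrite ltrDl invr_gt0 ln_gt0 //; lra.
have Q0 : (0 < Q)%N by apply: leq_trans Q3.
have q0 : (0 < q')%N by exact: below_part_gt0.
have L0 := loglog_gt0 R Q3.
set l : R := ln Q%:R in L0 *; set L := ln l in L0 *.
set b : R := ln (max_pdiv Q)%:R; set c : R := ln (size (divisors Q))%:R.
have P0 : (0 < max_pdiv Q)%N := max_pdiv_gt0 Q.
have b0 : 0 <= b by rewrite ln_ge0 // ler1n.
have c0 : 0 <= c.
  by rewrite ln_ge0 // ler1n lt0n size_eq0; apply: contraTneq (divisors_id Q0) => ->.
have a0 : 0 <= ln q'%:R :> R by rewrite ln_ge0 // ler1n.
have l1 : 1 < l.
  by rewrite ltNge; apply: contraTN L0 => /ln_le0; rewrite leNgt.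
have l0 : 0 < l by lra.
have lL1 : 1 <= l / L by rewrite ler_pdivlMr // mul1r; exact/ltW/ln_sublinear.
have bl : b <= l.
  by rewrite ler_ln ?posrE ?ltr0n // ler_nat; apply: dvdn_leq (max_pdiv_dvd Q).
(* b^2 <= l (b + c) since b <= l, so the square root dominates log P(Q). *)
have bs : b <= Num.sqrt (l * (b + c)).
  rewrite -[leLHS]ger0_norm // -sqrtr_sqr ler_wsqrtr // expr2 ler_pM //; lra.
set E := _ + _ + _; have E1 : l / L <= E by rewrite /E; have := sqrtr_ge0 (l * (b + c)); lra.
have Ea : ln q'%:R <= E by rewrite /E; have := sqrtr_ge0 (l * (b + c)); lra.
have Eb : b <= E by rewrite /E; lra.
rewrite normr_normc lecR.
have [Yl|Yl] := lerP (1024 * E) l; last first.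
  by apply: le_trans (dirichlet_L_trivial Q3 chiP s1) _; rewrite -/l; lra.
have L1 : 1024 <= L.
  have : 1024 * (l / L) <= l by lra.
  by rewrite mulrCA ger_pMr // ler_pdivrMr // mul1r.
have Y1 : 1 <= 1024 * E by lra.
apply: le_trans (dirichlet_L_short Q3 chiP s1 (ltW l1) Y1 Yl _) _; last by lra.
apply: (short_mean_le chiP (below_part_above Q0 sqfree) q0).
- by rewrite filter_uniq ?primes_uniq.
- by apply/allP => p; rewrite mem_filter mem_primes => /and3P[].
- exact: below_part_coprime.
- by move=> p; rewrite mem_filter => /andP[_]; exact: max_pdiv_max.
- exact: P0.
- exact: L1.
- by rewrite ler_pM2l ?ltr0n.
- exact: Yl.
- by rewrite [1024 * _]mulrC mulfK ?pnatr_eq0.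
- by rewrite [1024 * _]mulrC mulfK ?pnatr_eq0.
Qed.
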